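(* Let $d\in\mathbb{N}$ and let $\mathcal{T}\in\{J_1,J_2,M_1,M_2\}$. For each $n\in\mathbb{N}$ let $Y^{(n)}=(Y^{(n)}_0,Y^{(n)}_1,Y^{(n)}_2,\ldots)$ be a time homogeneous Markov chain with values in $\mathbb{R}^d$ on a probability space $(\Omega,\mathcal{A},\mathbb{P})$, let $X^{n,J_1}$ be its $J_1$ embedding and let $X^{n,\mathcal{T}}$ be a $\mathcal{T}$ embedding of it (as defined in the context). Suppose that (i) for all $\varepsilon>0$ and all $R>0$ $$\lim_{h\to 0}\limsup_{n\to\infty}\sup_{|x|<R,\ 0\le t\leq h}\mathbb{P}\Big(\big|Y^{(n)}_{\lfloor tn\rfloor}-x\big|>\varepsilon\,\Big|\,Y^{(n)}_0=x\Big)=0,$$ (ii) for all $\varepsilon>0$ and all $m\in\mathbb{N}$ there exists $R>0$ such that $$\sup_n \mathbb{P}\Big(\sup_{t\in[0,1]}\big|Y^{(n)}_{\lfloor tnm\rfloor}\big|>R\Big)<\varepsilon.$$ Then $X^{n,\mathcal{T}}$ converges in distribution with respect to $\mathcal{T}$ (as $n\to\infty$) if and only if $X^{n,J_1}$ converges in distribution with respect to $J_1$.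
   Context: $[[x,y]]=\{\alpha x+(1-\alpha)y:\alpha\in[0,1]\}$ for $x,y\in\mathbb{R}^d$, and $\|\cdot\|_\infty$ is the supremum norm. $D[0,1]$ is the set of functions $f:[0,1]\to\mathbb{R}^d$ that are right continuous with left limits (rcll) and left continuous at $1$; $f(t-)$ is the left limit, with $f(0-):=f(0)$. Metrics on $D[0,1]$. Let $\Gamma_f=\{(z,t)\in\mathbb{R}^d\times[0,1]: z=f(t-)\text{ or }z=f(t)\}$ (incomplete graph) and $\overline{\Gamma_f}=\{(z,t)\in\mathbb{R}^d\times[0,1]: z\in[[f(t-),f(t)]]\}$ (complete graph). Order $\overline{\Gamma_f}$ by $(z_1,t_1)\le(z_2,t_2)$ if $t_1<t_2$, or $t_1=t_2$ and $|f(t_1-)-z_1|\le|f(t_2-)-z_2|$. Let $\pi(\overline{\Gamma_f})$ be the set of pairs $(u,r)$ with $u:[0,1]\to\mathbb{R}^d$ and $r:[0,1]\to[0,1]$ continuous, $(u,r)$ non-decreasing for this order, and $(u,r)([0,1])=\overline{\Gamma_f}$. Let $\Lambda_c$ be the set of continuous bijections of $[0,1]$. For $A,B\subset\mathbb{R}^d\times[0,1]$ let $m_H(A,B)=\inf\{\varepsilon>0:A\subset B^\varepsilon,\ B\subset A^\varepsilon\}$ with $B^\varepsilon=\{(x,t)\in\mathbb{R}^d\times[0,1]:\exists (y,s)\in B,\ |x-y|\vee|t-s|\le\varepsilon\}$. Then $d_{J_1}(f_1,f_2)=\inf_{\lambda\in\Lambda_c}\{\|f_1\circ\lambda-f_2\|_\infty\vee\|\lambda-\mathrm{id}\|_\infty\}$,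 $d_{M_1}(f_1,f_2)=\inf\{\|u_1-u_2\|_\infty\vee\|r_1-r_2\|_\infty:(u_j,r_j)\in\pi(\overline{\Gamma_{f_j}}),\ j=1,2\}$, $d_{J_2}(f_1,f_2)=m_H(\Gamma_{f_1},\Gamma_{f_2})$, $d_{M_2}(f_1,f_2)=m_H(\overline{\Gamma_{f_1}},\overline{\Gamma_{f_2}})$. The topology $\mathcal{T}$ is the one induced by $d_{\mathcal{T}}$. Embeddings. For a sequence $y^{(n)}=(y^{(n)}_0,y^{(n)}_1,\ldots)$ in $\mathbb{R}^d$, a $\mathcal{T}$ embedding is a function $x^{n,\mathcal{T}}\in D[0,1]$ such that for every integer $k$ with $0\le k<n$ one has $x^{n,\mathcal{T}}(k/n)=y^{(n)}_k$ and, for all $t\in(\frac kn,\frac{k+1}n)$: for $\mathcal{T}=J_1$: $x^{n,J_1}(t)=y^{(n)}_k$; for $\mathcal{T}=M_1$: $x^{n,M_1}(t)=y^{(n)}_k+n(t-\frac kn)(y^{(n)}_{k+1}-y^{(n)}_k)$; for $\mathcal{T}=J_2$: $x^{n,J_2}(t)\in\{y^{(n)}_k,y^{(n)}_{k+1}\}$; for $\mathcal{T}=M_2$: $x^{n,M_2}(t)\in[[y^{(n)}_k,y^{(n)}_{k+1}]]$. The requirement $x^{n,\mathcal{T}}\in D[0,1]$ forces $x^{n,\mathcal{T}}(1)=\lim_{t\nearrow1}x^{n,\mathcal{T}}(t)$. (For $J_2$ and $M_2$ any choice with $x^{n,\mathcal{T}}\in D[0,1]$ is allowed.) For a Markov chain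 $Y^{(n)}$, $X^{n,\mathcal{T}}$ is defined by applying such an embedding to $Y^{(n)}(\omega)$ for each $\omega$; each $X^{n,\mathcal{T}}$ is a $D[0,1]$-valued random variable. $X^{(n)}$ converges in distribution with respect to $\mathcal{T}$ if there is a $D[0,1]$-valued random variable $X$ with $\mathbb{E}(G(X^{(n)}))\to\mathbb{E}(G(X))$ for all bounded $\mathcal{T}$-continuous $G:D[0,1]\to\mathbb{R}$. $\mathbb{P}(\,\cdot\,|\,Y^{(n)}_0=x)$ denotes the law of the chain with the transition kernel of $Y^{(n)}$ started at $x$. *)

(* Defs.v *)
From HB Require Import structures.
From mathcomp Require Import all_boot all_order all_algebra.
From mathcomp Require Import all_classical all_reals all_analysis.

Set Implicit Arguments.
Unset Strict Implicit.
Unset Printing Implicit Defensive.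

Import Order.TTheory GRing.Theory Num.Theory.
Import numFieldNormedType.Exports.

Local Open Scope classical_set_scope.
Local Open Scope ring_scope.

(* R^d with its Borel sigma-algebra.  The topology of 'rV[R]_d is the usual
   product topology; the library norm on it is the max norm, so the Euclidean
   norm is defined separately. *)
Definition open_sets (R : realType) (d : nat) : set (set 'rV[R]_d) :=
  [set U | open U].

Notation borelRV R d := (g_sigma_algebraType (@open_sets R d)).

Definition enorm (R : realType) (d : nat) (x : 'rV[R]_d) : R :=
  Num.sqrt (\sum_(i < d) x ord0 i ^+ 2).

Definition segment (R : realType) (d : nat) (x y : 'rV[R]_d) : set 'rV[R]_d :=
  [set a *: x + (1 - a) *: y | a in `[0, 1]].

(* A function on [0,1] is encoded by its extension to R that is constant on
   ]-oo,0] and on [1,+oo[; this encoding is one-to-one, so that equality of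
   elements of skorokhod R d is equality of functions on [0,1]. *)
Record skorokhod (R : realType) (d : nat) := Skorokhod {
  skpath :> R -> 'rV[R]_d ;
  skpath_le0 : forall t : R, t <= 0 -> skpath t = skpath 0 ;
  skpath_ge1 : forall t : R, 1 <= t -> skpath t = skpath 1 ;
  skpath_right_continuous :
    forall t : R, 0 <= t < 1 -> skpath x @[x --> t^'+] --> skpath t ;
  skpath_left_limit :
    forall t : R, 0 < t <= 1 -> cvg (skpath x @[x --> t^'-]) ;
  skpath_left_continuous1 : skpath x @[x --> 1^'-] --> skpath 1 }.

Lemma skorokhod0_subproof (R : realType) (d : nat) (F : set_system R) :
  Filter F -> (fun=> 0 : 'rV[R]_d) x @[x --> F] --> (0 : 'rV[R]_d).
Proof. by move=> FF; exact: cvg_cst. Qed.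

Definition skorokhod0 (R : realType) (d : nat) : skorokhod R d :=
  @Skorokhod R d (fun=> 0) (fun _ _ => erefl) (fun _ _ => erefl)
    (fun t _ => @skorokhod0_subproof R d t^'+ _)
    (fun t _ => cvgP _ (@skorokhod0_subproof R d t^'- _))
    (@skorokhod0_subproof R d 1^'- _).

HB.instance Definition _ (R : realType) (d : nat) :=
  gen_eqMixin (skorokhod R d).
HB.instance Definition _ (R : realType) (d : nat) :=
  gen_choiceMixin (skorokhod R d).
HB.instance Definition _ (R : realType) (d : nat) :=
  isPointed.Build (skorokhod R d) (skorokhod0 R d).

(* Random elements of D[0,1] are taken with respect to the sigma-algebra
   generated by the coordinate maps f |-> f t, which is the Borel
   sigma-algebra of each of the four topologies J1, J2, M1, M2. *)
Definition coordinate_cylinders (R : realType) (d : nat) :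
    set (set (skorokhod R d)) :=
  [set A | exists2 t : R, `[0, 1]%classic t &
     exists2 B : set (borelRV R d), measurable B &
       A = [set f : skorokhod R d | B (f t)]].

Notation skorokhodM R d := (g_sigma_algebraType (@coordinate_cylinders R d)).

Definition left_lim (R : realType) (d : nat) (f : skorokhod R d) (t : R) :
    'rV[R]_d :=
  if t <= 0 then f 0 else lim (f x @[x --> t^'-]).

Definition incomplete_graph (R : realType) (d : nat) (f : skorokhod R d) :
    set ('rV[R]_d * R) :=
  [set p | 0 <= p.2 <= 1 /\ (p.1 = left_lim f p.2 \/ p.1 = f p.2)].

Definition complete_graph (R : realType) (d : nat) (f : skorokhod R d) :
    set ('rV[R]_d * R) :=
  [set p | 0 <= p.2 <= 1 /\ segment (left_lim f p.2) (f p.2) p.1].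

Definition graph_le (R : realType) (d : nat) (f : skorokhod R d)
    (p q : 'rV[R]_d * R) : Prop :=
  p.2 < q.2 \/
  (p.2 = q.2 /\
   enorm (left_lim f p.2 - p.1) <= enorm (left_lim f q.2 - q.1)).

Definition parametrization (R : realType) (d : nat) (f : skorokhod R d)
    (u : R -> 'rV[R]_d) (r : R -> R) : Prop :=
  [/\ {within `[0, 1], continuous u},
      {within `[0, 1], continuous r},
      (forall s1 s2 : R, 0 <= s1 -> s1 <= s2 -> s2 <= 1 ->
         graph_le f (u s1, r s1) (u s2, r s2)) &
      [set (u s, r s) | s in `[0, 1]] = complete_graph f].

Definition time_change (R : realType) (lambda : R -> R) : Prop :=
  {within `[0, 1], continuous lambda} /\
  set_bij `[0, 1]%classic `[0, 1]%classic lambda.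

Definition thickening (R : realType) (d : nat) (e : R)
    (B : set ('rV[R]_d * R)) : set ('rV[R]_d * R) :=
  [set p | 0 <= p.2 <= 1 /\
     exists2 q, B q & Num.max (enorm (p.1 - q.1)) `|p.2 - q.2| <= e].

Definition hausdorff_dist (R : realType) (d : nat)
    (A B : set ('rV[R]_d * R)) : \bar R :=
  ereal_inf [set e%:E | e in
    [set e : R | [/\ 0 < e, A `<=` thickening e B & B `<=` thickening e A]]].

Definition sup01 (R : realType) (g : R -> R) : \bar R :=
  ereal_sup [set (g t)%:E | t in `[0, 1]].

Definition distJ1 (R : realType) (d : nat) (f1 f2 : skorokhod R d) : \bar R :=
  ereal_inf [set Order.max (sup01 (fun t => enorm (f1 (lambda t) - f2 t)))
                           (sup01 (fun t => `|lambda t - t|))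
            | lambda in @time_change R].

Definition distM1 (R : realType) (d : nat) (f1 f2 : skorokhod R d) : \bar R :=
  ereal_inf [set e | exists u1 r1 u2 r2,
    [/\ parametrization f1 u1 r1, parametrization f2 u2 r2 &
        e = Order.max (sup01 (fun s => enorm (u1 s - u2 s)))
                      (sup01 (fun s => `|r1 s - r2 s|))]].

Definition distJ2 (R : realType) (d : nat) (f1 f2 : skorokhod R d) : \bar R :=
  hausdorff_dist (incomplete_graph f1) (incomplete_graph f2).

Definition distM2 (R : realType) (d : nat) (f1 f2 : skorokhod R d) : \bar R :=
  hausdorff_dist (complete_graph f1) (complete_graph f2).

Inductive skorokhod_topology := J1 | J2 | M1 | M2.

Definition sk_dist (R : realType) (d : nat) (T : skorokhod_topology) :
    skorokhod R d -> skorokhod R d -> \bar R :=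
  match T with
  | J1 => @distJ1 R d
  | J2 => @distJ2 R d
  | M1 => @distM1 R d
  | M2 => @distM2 R d
  end.

(* sk_dist T is a metric (finite, although \bar R-valued), so this is continuity
   for the topology it induces. *)
Definition sk_continuous (R : realType) (d : nat) (T : skorokhod_topology)
    (G : skorokhod R d -> R) : Prop :=
  forall (f : skorokhod R d) (eps : R), 0 < eps ->
    exists2 delta : R, 0 < delta &
      forall g : skorokhod R d,
        (sk_dist T f g < delta%:E)%E -> `|G f - G g| < eps.

Definition sk_bounded (R : realType) (d : nat) (G : skorokhod R d -> R) : Prop :=
  exists M : R, forall f, `|G f| <= M.

Definition cvg_in_distribution (R : realType) (d : nat)
    (T : skorokhod_topology) (dO : measure_display) (Omega : measurableType dO)
    (P : probability Omega R) (X : nat -> {RV P >-> skorokhodM R d}) : Prop :=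
  exists (dO' : measure_display) (Omega' : measurableType dO')
    (P' : probability Omega' R) (X' : {RV P' >-> skorokhodM R d}),
  forall G : skorokhod R d -> R, sk_bounded G -> sk_continuous T G ->
    ('E_P[fun w => G (X n w)] @[n --> \oo] --> 'E_P'[fun w => G (X' w)])%E.

Definition is_embedding (R : realType) (d : nat) (T : skorokhod_topology)
    (n : nat) (y : nat -> 'rV[R]_d) (x : skorokhod R d) : Prop :=
  forall k : nat, (k < n)%N ->
    x (k%:R / n%:R) = y k /\
    forall t : R, k%:R / n%:R < t < k.+1%:R / n%:R ->
      match T with
      | J1 => x t = y k
      | M1 => x t = y k + (n%:R * (t - k%:R / n%:R)) *: (y k.+1 - y k)
      | J2 => x t = y k \/ x t = y k.+1
      | M2 => segment (y k) (y k.+1) (x t)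
      end.

Definition past (R : realType) (d : nat) (dO : measure_display)
    (Omega : measurableType dO) (Y : nat -> Omega -> 'rV[R]_d) (k : nat) :
    set (set Omega) :=
  <<s [set A | exists2 i : nat, (i <= k)%N &
         exists2 B : set (borelRV R d), measurable B & A = Y i @^-1` B] >>.

(* P(Y_(k+1) \in B | Y_0, ..., Y_k) = K (Y_k) B almost surely, the kernel K not
   depending on k. *)
Definition markov_chain (R : realType) (d : nat) (dO : measure_display)
    (Omega : measurableType dO) (P : probability Omega R)
    (K : R.-pker borelRV R d ~> borelRV R d)
    (Y : nat -> {RV P >-> borelRV R d}) : Prop :=
  forall (k : nat) (A : set Omega) (B : set (borelRV R d)),
    past (fun i => Y i : Omega -> 'rV[R]_d) k A -> measurable B ->
    P (A `&` Y k.+1 @^-1` B) = (\int[P]_(w in A) K (Y k w) B)%E.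

(* The law of the k-th state of the chain with transition kernel K started
   at x. *)
Fixpoint chain_law (R : realType) (d : nat)
    (K : R.-pker borelRV R d ~> borelRV R d) (k : nat) (x : borelRV R d)
    (B : set (borelRV R d)) : \bar R :=
  match k with
  | 0 => \d_x B
  | k'.+1 => (\int[K x]_z chain_law K k' z B)%E
  end.

Definition small_time_condition (R : realType) (d : nat)
    (K : nat -> R.-pker borelRV R d ~> borelRV R d) : Prop :=
  forall eps Rad : R, 0 < eps -> 0 < Rad ->
    limn_esup (fun n : nat =>
      ereal_sup [set p : \bar R | exists (x : 'rV[R]_d) (t : R),
        [/\ enorm x < Rad, 0 <= t <= h &
            p = chain_law (K n) (Num.truncn (t * n%:R)) x
                  [set z : 'rV[R]_d | eps < enorm (z - x)]]])
    @[h --> (0 : R)^'+] --> (0 : \bar R).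

Definition compact_containment_condition (R : realType) (d : nat)
    (dO : measure_display) (Omega : measurableType dO)
    (P : probability Omega R)
    (Y : nat -> nat -> {RV P >-> borelRV R d}) : Prop :=
  forall (eps : R) (m : nat), 0 < eps -> (0 < m)%N ->
    exists2 Rad : R, 0 < Rad &
      (ereal_sup [set P [set w |
           (Rad%:E < sup01 (fun t : R =>
              enorm (Y n (Num.truncn (t * n%:R * m%:R)) w : 'rV[R]_d)))%E]
        | n in [set n : nat | (0 < n)%N]] < eps%:E)%E.

(* Main.v *)
Require Import Defs.
From mathcomp Require Import all_boot all_order all_algebra.
From mathcomp Require Import all_classical all_reals all_analysis.
From mathcomp Require Import measurable_realfun.
From mathcomp Require Import ring lra zify.

(** The four topologies differ in how a path may approximate a jump of its
limit: by one jump of about the same size, by several jumps, or by a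
continuous crossing.  Under the two hypotheses the chain observed at the times
0, ..., n has no room for this difference.  With probability close to one its
large moves are separated by at least a * n steps and it moves by at most e in
between (regular_sequence); the way in which the embedding fills a time step of
length 1/n then no longer matters.  The proof has three parts.

Paths.  In each of the four topologies a path f close to a path g is uniformly
close to g off a set of times of small length (weaknear,
sk_dist_weaknear).  If x is an embedding, in any of the four senses, of a
regular sequence, and if f is close to x in this weak sense, then f is close in
the sense of J1 to the step embedding of the same sequence
(regular_weaknear_J1near): both paths are almost constant between cutting
points that are far apart, and a change of time matches the cutting points.
Conversely, a path close in the sense of J1 to the step embedding of a sequence
is close, in each of the topologies, to the corresponding embedding of that
sequence, provided that 1/n and the last increment are small
(sk_dist_embedding_le).  The hard case is M1, where a common parametrization
must spend time at every jump of f; it comes from a clock that stops at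
countably many instants (split_clock_exists, clock_parametrization).

Chains.  By the Markov property the hypothesis on small times bounds the
probability of a large increment, conditionally on every event of the past
(increment_le).  Counting the successive moves of a given size as in the
inequality of Ottaviani and the criterion of Aldous, one finds that many moves
are unlikely, and so are two moves within a short time (many_moves_pr,
close_moves_pr).  This yields regularity off a small event (tightness).

Laws.  No compactness of families of laws is used.  Let F be the sequence of
random paths that converges, F' the other one, and let the pairs (F n, F' n) lie
with high probability in sets S k of pairs, where a path close to s is close to
t as soon as (s, t) is in S k.  For a bounded test function G for F', the
inf-convolution of G along S k is a continuous test function for F, it is at
most G (F' n) at F n, and its lower limit in k is at least G.  Hence
the lower limit of E G (F' n) is at least E G (X), X being the limit of F; the
same holds for - G (envelope_transfer).  The two implications of the theorem
are two instances of this principle.  All expectations make sense because a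
function that is continuous for one of the topologies is measurable for the
coordinates (sk_continuous_measurable). *)

Set Implicit Arguments.
Unset Strict Implicit.
Unset Printing Implicit Defensive.

Import Order.TTheory GRing.Theory Num.Theory.
Import numFieldNormedType.Exports.

Local Open Scope classical_set_scope.
Local Open Scope ring_scope.

(** * Norms, one-sided limits and partitions *)

Section Norms.
Variables (R : realType) (d : nat).
Implicit Types (x y : 'rV[R]_d).

Lemma enorm_ge0 x : 0 <= enorm x.
Proof. exact: sqrtr_ge0. Qed.

Lemma rV_normE x : `|x| = \big[Num.max/0]_ij `|x ij.1 ij.2|.
Proof. exact: mx_normrE. Qed.

Lemma coord_le_norm x i : `|x ord0 i| <= `|x|.
Proof.
rewrite rV_normE.
exact: (le_bigmax _ (fun ij : 'I_1 * 'I_d => `|x ij.1 ij.2|) (ord0, i)).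
Qed.

Lemma norm_le_coord x a : 0 <= a -> (forall i, `|x ord0 i| <= a) -> `|x| <= a.
Proof.
move=> a0 H; rewrite rV_normE.
by apply/bigmax_leP; split=> // -[i j] _; rewrite (ord1 i).
Qed.

Lemma coord_le_enorm x i : `|x ord0 i| <= enorm x.
Proof.
rewrite -sqrtr_sqr ler_wsqrtr// (bigD1 i)//= lerDl.
by apply: sumr_ge0 => j _; exact: sqr_ge0.
Qed.

Lemma norm_le_enorm x : `|x| <= enorm x.
Proof. by apply: norm_le_coord (enorm_ge0 x) (coord_le_enorm x). Qed.

(** All estimates on paths are made in the max norm; the factor d is paid only
where a distance, which is Euclidean, is evaluated. *)
Lemma enorm_le_norm x : enorm x <= d%:R * `|x|.
Proof.
have d0 : 0 <= (d%:R * `|x| : R) by rewrite mulr_ge0.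
rewrite -(ger0_norm d0) -sqrtr_sqr ler_wsqrtr//.
apply: (@le_trans _ _ (\sum_(i < d) `|x| ^+ 2)).
  apply: ler_sum => i _; rewrite -(real_normK (num_real (x ord0 i))).
  by rewrite lerXn2r ?nnegrE// coord_le_norm.
rewrite sumr_const card_ord -[leLHS]mulr_natl exprMn ler_wpM2r ?sqr_ge0//.
by rewrite -natrX ler_nat; case: (d) => // k; rewrite leq_pmulr.
Qed.

Lemma enormZ (c : R) x : enorm (c *: x) = `|c| * enorm x.
Proof.
rewrite /enorm -sqrtr_sqr -sqrtrM ?sqr_ge0// mulr_sumr.
by congr Num.sqrt; apply: eq_bigr => i _; rewrite mxE exprMn.
Qed.

End Norms.

Section Paths.
Variables (R : realType) (d : nat).
Implicit Types (f g : skorokhod R d) (t s a e : R) (S : seq R).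

Lemma skorokhod_near_right f t e : 0 <= t -> 0 < e ->
  exists2 h, 0 < h & forall s, t <= s < t + h -> `|f s - f t| <= e.
Proof.
move=> t0 e0; have [t1|t1] := leP 1 t.
  exists 1 => // s /andP[ts _].
  by rewrite (skpath_ge1 f t1) (skpath_ge1 f (le_trans t1 ts)) subrr normr0 ltW.
have t01 : 0 <= t < 1 by rewrite t0 t1.
have /cvgrPdist_le /(_ _ e0) := @skpath_right_continuous _ _ f _ t01.
rewrite near_withinE => /nbhs_ballP[h /= h0 H]; exists h => // s /andP[ts sh].
move: ts; rewrite le_eqVlt => /predU1P[->|ts]; first by rewrite subrr normr0 ltW.
rewrite distrC; apply: H => //=.
by rewrite /ball /= ler0_norm ?subr_le0 ?(ltW ts)//; lra.
Qed.

Lemma skorokhod_near_left f t e : 0 <= t <= 1 -> 0 < e ->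
  exists2 h, 0 < h & forall s, t - h < s < t -> `|f s - left_lim f t| <= e.
Proof.
move=> /andP[t0 t1] e0; rewrite /left_lim; have [tn|tp] := leP t 0.
  exists 1 => // s /andP[_ st].
  by rewrite skpath_le0 ?subrr ?normr0 ?ltW// (lt_le_trans st).
have /cvgrPdist_le /(_ _ e0) : f x @[x --> t^'-] --> lim (f x @[x --> t^'-]).
  by apply: skpath_left_limit; rewrite tp.
rewrite near_withinE => /nbhs_ballP[h /= h0 H]; exists h => // s /andP[ts sh].
rewrite distrC; apply: H => //=.
by rewrite /ball /= gtr0_norm ?subr_gt0//; lra.
Qed.

Lemma left_lim1 f : left_lim f 1 = f 1.
Proof.
rewrite /left_lim ler10; apply/cvg_lim => //; exact: skpath_left_continuous1.
Qed.

Lemma left_lim0 f : left_lim f 0 = f 0.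
Proof. by rewrite /left_lim lexx. Qed.

Lemma left_lim_dist_le f t (v : 'rV[R]_d) a h : 0 < t <= 1 -> 0 < h ->
  (forall s, t - h < s < t -> `|f s - v| <= a) -> `|left_lim f t - v| <= a.
Proof.
move=> /andP[t0 t1] h0 H; apply/ler_addgt0Pl => e e0.
have [k k0 Hk] := @skorokhod_near_left f t e (introT andP (conj (ltW t0) t1)) e0.
pose s := t - Num.min h k / 2.
have m0 : 0 < Num.min h k by rewrite lt_min h0.
have mh : Num.min h k <= h by rewrite ge_min lexx.
have mk : Num.min h k <= k by rewrite ge_min lexx orbT.
have -> : left_lim f t - v = (left_lim f t - f s) + (f s - v).
  by rewrite addrA subrK.
apply: (le_trans (ler_normD _ _)); apply: lerD.
  by rewrite distrC Hk// /s; apply/andP; split; lra.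
by apply: H; rewrite /s; apply/andP; split; lra.
Qed.

(** The cutting points form an unordered list; a cell is an interval that no
point of the list separates. *)
Definition separated_partition a S :=
  [/\ 0 \in S, 1 \in S, {in S, forall u, 0 <= u <= 1} &
      {in S &, forall u v, u < v -> u + a <= v}].

(** The excluded interval is s < u <= t because a cutting point belongs to the
cell that starts there. *)
Definition small_osc e S (f : R -> 'rV[R]_d) := forall s t,
  0 <= s -> s <= t -> t < 1 -> {in S, forall u, ~~ (s < u <= t)} ->
  `|f s - f t| <= e.

Lemma finite_gap S : exists2 a, 0 < a & {in S &, forall u v, u < v -> u + a <= v}.
Proof.
elim: S => [|x S [a a0 H]]; first by exists 1.
have [b b0 Hb] : exists2 b, 0 < b & {in S, forall u, u != x -> b <= `|u - x|}.
  elim: S {H} => [|y S [b b0 H]]; first by exists 1.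
  have [->|yx] := eqVneq y x.
    by exists b => // u; rewrite inE => /predU1P[->|/H//]; rewrite eqxx.
  exists (Num.min b `|y - x|); first by rewrite lt_min b0 normr_gt0 subr_eq0.
  move=> u; rewrite inE => /predU1P[-> _|uS ux]; first by rewrite ge_min lexx orbT.
  by rewrite ge_min H.
exists (Num.min a b); first by rewrite lt_min a0.
have ma : Num.min a b <= a by rewrite ge_min lexx.
have mb : Num.min a b <= b by rewrite ge_min lexx orbT.
move=> u v; rewrite !inE => /predU1P[->|uS] /predU1P[->|vS] uv.
- by rewrite ltxx in uv.
- have := Hb v vS; rewrite gt_eqF// gtr0_norm ?subr_gt0// => /(_ isT) ?; lra.
- have := Hb u uS; rewrite lt_eqF// ltr0_norm ?subr_lt0// => /(_ isT) ?; lra.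
- have := H u v uS vS uv; lra.
Qed.

(** The times t for which [0, t[ can be cut in this way have a supremum c. The
left limit at c extends a cutting from just before c up to c, and right
continuity extends it beyond c, so that c is 1. *)
Lemma rcll_partition f e : 0 < e ->
  exists a S, [/\ 0 < a, separated_partition a S & small_osc e S f].
Proof.
move=> e0.
pose good t S := [/\ 0 \in S, {in S, forall u, 0 <= u <= 1} &
  forall r s, 0 <= r -> r <= s -> s < t -> {in S, forall u, ~~ (r < u <= s)} ->
  `|f r - f s| <= e].
pose T := [set t | 0 <= t <= 1 /\ exists S, good t S].
have T0 : T 0.
  split; first by rewrite lexx ler01.
  exists [:: 0]; split; rewrite ?mem_head//.
    by move=> u; rewrite inE => /eqP ->; rewrite lexx ler01.
  by move=> r s r0 rs s0 _; move: (le_trans r0 rs); rewrite leNgt s0.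
have Tub : ubound T 1 by move=> t [/andP[]].
have supT : has_sup T by split; [exists 0|exists 1].
pose c := sup T.
have c0 : 0 <= c by apply: ub_le_sup => //; exists 1.
have c1 : c <= 1 by apply: ge_sup => //; exists 0.
have c01 : 0 <= c <= 1 by rewrite c0.
have e2 : 0 < e / 2 by lra.
have [h h0 Hh] := skorokhod_near_left f c01 e2.
have [k k0 Hk] := skorokhod_near_right f c0 e2.
have [t Tt ct] := sup_adherent h0 supT.
have tc : t <= c by apply: ub_le_sup => //; exists 1.
case: Tt => /andP[t0 t1] [S [S0 S01 HS]].
have close v r s : `|f r - v| <= e / 2 -> `|f s - v| <= e / 2 -> `|f r - f s| <= e.
  move=> Hr Hs; have -> : f r - f s = (f r - v) - (f s - v) by rewrite opprB addrA subrK.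
  by apply: (le_trans (ler_normB _ _)); lra.
(* the new cells are [t, c[ and [c, b[, on which f is close to its left limit at
c and to f c respectively *)
pose b := Num.min 1 (c + k).
have Tb : good b [:: t, c & S].
  split; first by rewrite !inE S0 !orbT.
    by move=> u; rewrite !inE => /predU1P[->|/predU1P[->|/S01//]]//; rewrite t0.
  move=> r s r0 rs sb HSrs.
  have HS' : {in S, forall u, ~~ (r < u <= s)}.
    by move=> u uS; apply: HSrs; rewrite !inE uS !orbT.
  have := HSrs t (mem_head _ _); rewrite negb_and -leNgt -ltNge => rt.
  have [st|ts] := ltP s t; first exact: HS.
  have tr : t <= r by case/orP: rt => // ?; lra.
  have := HSrs c; rewrite !inE eqxx orbT => /(_ isT).
  rewrite negb_and -leNgt -ltNge => /orP[cr|sc].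
    have sk : s < c + k by apply: (lt_le_trans sb); rewrite /b ge_min lexx orbT.
    by apply: (close (f c)); apply: Hk; apply/andP; split; lra.
  by apply: (close (left_lim f c)); apply: Hh; apply/andP; split; rewrite -/c in ct; lra.
have b1 : b = 1.
  apply/eqP; rewrite eq_le {1}/b ge_min lexx/=.
  have : b <= c.
    apply: ub_le_sup; first by exists 1.
    split; last by exists [:: t, c & S].
    by rewrite /b le_min ler01 ge_min lexx/= andbT; lra.
  by rewrite /b; case: (leP 1 (c + k)); lra.
have [S' [S'0 S'01 HS']] : exists S, good 1 S by rewrite -b1; exists [:: t, c & S].
have [a a0 Ha] := finite_gap (1 :: S').
exists a, (1 :: S'); split=> //.
  split=> //; rewrite ?mem_head ?inE ?S'0 ?orbT//.
  by move=> u; rewrite inE => /predU1P[->|/S'01//]; rewrite lexx ler01.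
move=> r s r0 rs s1 H; apply: HS' => // u uS; apply: H.
by rewrite inE uS orbT.
Qed.

Lemma dist_le3 (u v w z : 'rV[R]_d) a b c : `|u - v| <= a -> `|v - w| <= b ->
  `|w - z| <= c -> `|u - z| <= a + b + c.
Proof.
move=> uv vw wz; have := ler_distD v u z; have := ler_distD w v z; lra.
Qed.

Lemma separated_partition_le a b S : b <= a -> separated_partition a S ->
  separated_partition b S.
Proof.
by move=> ba [? ? ? H]; split=> // u v uS vS uv; have := H u v uS vS uv; lra.
Qed.

End Paths.

(** * Changes of time *)

Section Clocks.
Variables (R : realType) (d : nat).
Implicit Types (f g h : skorokhod R d) (l m : R -> R) (t s a b e : R) (S Q : seq R).

(** An increasing bijection l of [0, 1], given together with its inverse m,
which makes symmetry and composition immediate. *)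
Definition clock l m :=
  [/\ forall t, 0 <= t <= 1 -> 0 <= l t <= 1,
      forall t, 0 <= t <= 1 -> 0 <= m t <= 1,
      forall t, 0 <= t <= 1 -> m (l t) = t,
      forall t, 0 <= t <= 1 -> l (m t) = t &
      forall s t, 0 <= s <= 1 -> 0 <= t <= 1 -> s < t -> l s < l t].

Lemma clock_le l m s t : clock l m -> 0 <= s <= 1 -> 0 <= t <= 1 ->
  (l s <= l t) = (s <= t).
Proof.
move=> [_ _ _ _ H] s01 t01; have [st|ts|->] := ltgtP s t; last exact: lexx.
  by rewrite ltW// H.
by apply/negbTE; rewrite -ltNge H.
Qed.

Lemma clock_lt l m s t : clock l m -> 0 <= s <= 1 -> 0 <= t <= 1 ->
  (l s < l t) = (s < t).
Proof. by move=> lm s01 t01; rewrite !ltNge (clock_le lm). Qed.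

Lemma clock_sym l m : clock l m -> clock m l.
Proof.
move=> lm; have [l1 m1 ml lm' mono] := lm; split=> // s t s01 t01 st.
by rewrite -(clock_lt lm) ?m1// !lm'.
Qed.

Lemma clock_comp l m l' m' : clock l m -> clock l' m' ->
  clock (l \o l') (m' \o m).
Proof.
move=> [l1 m1 ml lm mono] [l1' m1' ml' lm' mono']; split=> /=.
- by move=> t /l1' /l1.
- by move=> t /m1 /m1'.
- by move=> t t01; rewrite ml ?ml'// l1'.
- by move=> t t01; rewrite lm' ?lm// m1.
- by move=> s t s01 t01 st; apply: mono; rewrite ?l1'//; apply: mono'.
Qed.

Lemma clock0 l m : clock l m -> l 0 = 0.
Proof.
move=> lm; have [l1 m1 ml lm' mono] := lm.
have z01 : 0 <= (0 : R) <= 1 by rewrite lexx ler01.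
have /andP[l00 l01] := l1 _ z01.
have /andP[m00 _] := m1 _ z01.
have := clock_le lm z01 (m1 _ z01); rewrite lm'// m00 => h.
by apply/eqP; rewrite eq_le l00 h.
Qed.

Lemma clock1 l m : clock l m -> l 1 = 1.
Proof.
move=> lm; have [l1 m1 ml lm' mono] := lm.
have z01 : 0 <= (1 : R) <= 1 by rewrite lexx ler01.
have /andP[l00 l01] := l1 _ z01.
have /andP[_ m01] := m1 _ z01.
have := clock_le lm (m1 _ z01) z01; rewrite lm'// m01 => h.
by apply/eqP; rewrite eq_le l01 h.
Qed.

Lemma clock_surj l :
  (forall t, 0 <= t <= 1 -> 0 <= l t <= 1) ->
  (forall s t, 0 <= s <= 1 -> 0 <= t <= 1 -> s < t -> l s < l t) ->
  (forall t, 0 <= t <= 1 -> exists2 s, 0 <= s <= 1 & l s = t) ->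
  exists m, clock l m.
Proof.
move=> l1 mono surj.
have /choice[m Hm] : forall t, exists s, 0 <= t <= 1 -> 0 <= s <= 1 /\ l s = t.
  move=> t; have [t01|tn] := boolP (0 <= t <= 1); last by exists 0.
  by have [s s01 ls] := surj t t01; exists s.
exists m; split=> // t t01; [by have [] := Hm t t01| |by have [] := Hm t t01].
have [m01 lm] := Hm _ (l1 _ t01).
by case: (ltgtP (m (l t)) t) => // h;
  [have := mono _ _ m01 t01 h|have := mono _ _ t01 m01 h]; rewrite lm ltxx.
Qed.

Lemma clock_time_change l m : clock l m -> time_change l.
Proof.
move=> lm; have [l1 m1 ml lm' mono] := lm; split.
  apply: segment_inc_surj_continuous.
    move=> s t; rewrite !in_itv /= => s01 t01; exact: (clock_le lm).
  rewrite (clock0 lm) (clock1 lm) => t /=; rewrite in_itv/= => t01.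
  by exists (m t); rewrite /= ?in_itv/= ?m1 ?lm'.
split.
- by move=> t /=; rewrite !in_itv/=; exact: l1.
- move=> s t; rewrite !inE /= !in_itv/= => s01 t01 st.
  by rewrite -(ml s) // st ml.
- by move=> t /=; rewrite in_itv/= => t01; exists (m t); rewrite /= ?in_itv/= ?m1 ?lm'.
Qed.

(** A continuous bijection is monotone, and a decreasing one moves the time 0 by
1. *)
Lemma time_change_clock l : time_change l ->
  (forall t, 0 <= t <= 1 -> `|l t - t| < 1) -> exists m, clock l m.
Proof.
move=> [lc [l1 linj lsurj]] near.
have z01 : 0 <= (0 : R) <= 1 by rewrite lexx ler01.
have l01 t : 0 <= t <= 1 -> 0 <= l t <= 1.
  by move=> t01; have := l1 t; rewrite /= !in_itv/=; apply.
have inj : {in `[0, 1] &, injective l}.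
  by move=> s t s01 t01; apply: linj; rewrite inE.
have surj t : 0 <= t <= 1 -> exists2 s, 0 <= s <= 1 & l s = t.
  move=> t01; have [|s] := lsurj t; first by rewrite /= in_itv.
  by rewrite /= in_itv /= => ? ?; exists s.
apply: clock_surj => // s t s01 t01 st.
have [inc|dec] := itv_continuous_inj_mono lc inj.
  by rewrite inc ?in_itv.
have [u u01 lu] := surj 1 (introT andP (conj ler01 (lexx _))).
have : l u <= l 0.
  have [->//|u0] := eqVneq u 0.
  by apply/ltW; rewrite dec ?in_itv//= lt_neqAle eq_sym u0; case/andP: u01.
have := near 0 z01; rewrite subr0 lu ger0_norm; first by lra.
by have /andP[] := l01 0 z01.
Qed.

(** Equivalent to a bound on distJ1 up to a factor (J1near_dist, dist_J1near),
but free of infima and of Euclidean norms. *)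
Definition J1near a f g := exists l m, clock l m /\
  forall t, 0 <= t <= 1 -> `|l t - t| <= a /\ `|f (l t) - g t| <= a.

Lemma J1near_sym a f g : J1near a f g -> J1near a g f.
Proof.
move=> [l [m [lm H]]]; have [l1 m1 ml lm' mono] := lm.
exists m, l; split; first exact: clock_sym.
move=> t t01; have := H (m t) (m1 _ t01); rewrite lm'// => -[h1 h2].
by rewrite distrC h1 distrC h2.
Qed.

Lemma J1near_trans a b f g h :
  J1near a f g -> J1near b g h -> J1near (a + b) f h.
Proof.
move=> [l [m [lm H]]] [l' [m' [lm' H']]]; have [l1' _ _ _ _] := lm'.
exists (l \o l'), (m' \o m); split; first exact: clock_comp.
move=> t t01 /=; have [h1 h2] := H' t t01; have [h3 h4] := H _ (l1' _ t01).
split.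
  have -> : l (l' t) - t = (l (l' t) - l' t) + (l' t - t) by rewrite addrA subrK.
  by apply: (le_trans (ler_normD _ _)); apply: lerD.
have -> : f (l (l' t)) - h t = (f (l (l' t)) - g (l' t)) + (g (l' t) - h t).
  by rewrite addrA subrK.
by apply: (le_trans (ler_normD _ _)); apply: lerD.
Qed.

Lemma J1near_le a b f g : a <= b -> J1near a f g -> J1near b f g.
Proof.
move=> ab [l [m [lm H]]]; exists l, m; split=> // t /H[h1 h2].
by split; exact: le_trans ab.
Qed.

Lemma sup01_le (k : R -> R) a :
  (forall t, 0 <= t <= 1 -> k t <= a) -> (sup01 k <= a%:E)%E.
Proof.
move=> H; apply: ge_ereal_sup => _ [t + <-]; rewrite /= in_itv /= => t01.
by rewrite lee_fin H.
Qed.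

Lemma le_sup01 (k : R -> R) t : 0 <= t <= 1 -> ((k t)%:E <= sup01 k)%E.
Proof.
by move=> t01; apply: ereal_sup_ubound; exists t => //=; rewrite in_itv.
Qed.

Lemma J1near_dist a f g : J1near a f g -> (distJ1 f g <= (d.+1%:R * a)%:E)%E.
Proof.
move=> [l [m [lm H]]].
have a0 : 0 <= a.
  by have [|+ _] := H 0; [rewrite lexx ler01|apply: le_trans].
apply: (le_trans (ereal_inf_lbound _)).
  by exists l; first exact: clock_time_change lm.
rewrite ge_max; apply/andP; split; apply: sup01_le => t /H[h1 h2].
  apply: (le_trans (enorm_le_norm _)); apply: ler_pM => //.
  by rewrite ler_nat.
by apply: (le_trans h1); rewrite ler_peMl// ler1n.
Qed.

(** The bound a <= 1 excludes the decreasing changes of time. *)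
Lemma dist_J1near a f g : a <= 1 -> (distJ1 f g < a%:E)%E -> J1near a f g.
Proof.
move=> a1 /ereal_inf_lt[_ [l lc <-]]; rewrite gt_max => /andP[h1 h2].
have lt t : 0 <= t <= 1 -> `|l t - t| < a.
  move=> t01; rewrite -lte_fin; apply: le_lt_trans h2.
  exact: (@le_sup01 (fun t => `|l t - t|)).
have [|m lm] := time_change_clock lc; first by move=> t /lt /lt_le_trans; apply.
exists l, m; split=> // t t01; split; first exact/ltW/lt.
apply: (le_trans (norm_le_enorm _)); rewrite -lee_fin; apply/ltW; apply: le_lt_trans h1.
exact: (@le_sup01 (fun t => enorm (f (l t) - g t))).
Qed.

End Clocks.

Section Matching.
Variables (R : realType) (d : nat).
Implicit Types (f g : skorokhod R d) (l m : R -> R) (t s a e r : R) (S Q : seq R).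

(** Since S is a-separated, a point u of Q has at most one point s of S at
distance less than a / 8. Add to the identity a bump of height s - u and
half-width a / 2 around each such u. The bumps of distinct points do not overlap
and have slope at most 1 / 4, so that the sum is increasing. *)
Lemma matching_clock S Q a : 0 < a -> separated_partition a S ->
  separated_partition a Q -> exists l m, [/\ clock l m,
  forall t, 0 <= t <= 1 -> `|l t - t| <= a / 8 &
  forall u s, u \in Q -> s \in S -> `|s - u| < a / 8 -> l u = s].
Proof.
move=> a0 PS PQ.
pose r := a / 8.
have gapS : {in S &, forall u v, `|u - v| < a -> u = v}.
{
case: PS => _ _ _ H u v uS vS; have [uv|vu|//] := ltgtP u v.
  by have := H _ _ uS vS uv; rewrite ltr0_norm ?subr_lt0//; lra.
by have := H _ _ vS uS vu; rewrite gtr0_norm ?subr_gt0//; lra.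
}
have gapQ : {in Q &, forall u v, `|u - v| < a -> u = v}.
{
case: PQ => _ _ _ H u v uS vS; have [uv|vu|//] := ltgtP u v.
  by have := H _ _ uS vS uv; rewrite ltr0_norm ?subr_lt0//; lra.
by have := H _ _ vS uS vu; rewrite gtr0_norm ?subr_gt0//; lra.
}
(* mate u is the partner of u in S, or u itself if there is none; centre t is
the point of Q whose bump may be nonzero at t *)
pose mate u := head u [seq s <- S | `|s - u| < r].
pose centre t := head 0 [seq u <- Q | `|t - u| < a / 2].
pose hat u t := Num.max 0 (1 - `|t - u| / (a / 2)).
pose bump u t := (mate u - u) * hat u t.
pose lam t := t + bump (centre t) t.
have mateE u s : s \in S -> `|s - u| < r -> mate u = s.
{
move=> sS su; have : s \in [seq s <- S | `|s - u| < r] by rewrite mem_filter su.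
rewrite /mate; case E : [seq _ <- _ | _] => [//|x q] _ /=.
have : x \in [seq s <- S | `|s - u| < r] by rewrite E mem_head.
rewrite mem_filter => /andP[xu xS]; apply: gapS => //.
rewrite -(subrK u x) -addrA; apply: (le_lt_trans (ler_normD _ _)).
by rewrite (distrC u); move: xu su; rewrite /r; lra.
}
have mate_near u : `|mate u - u| < r.
{
rewrite /mate; case E : [seq _ <- _ | _] => [|x q] /=.
  by rewrite subrr normr0 /r; lra.
have : x \in [seq s <- S | `|s - u| < r] by rewrite E mem_head.
by rewrite mem_filter => /andP[].
}
have centreE u t : u \in Q -> `|t - u| < a / 2 -> centre t = u.
{
move=> uQ tu; have : u \in [seq u <- Q | `|t - u| < a / 2] by rewrite mem_filter tu.
rewrite /centre; case E : [seq _ <- _ | _] => [//|x q] _ /=.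
have : x \in [seq u <- Q | `|t - u| < a / 2] by rewrite E mem_head.
rewrite mem_filter => /andP[xu xS]; apply: gapQ => //.
rewrite -(subrK t x) -addrA; apply: (le_lt_trans (ler_normD _ _)).
by rewrite (distrC x); lra.
}
have centreQ t : centre t \in Q.
{
rewrite /centre; case E : [seq _ <- _ | _] => [|x q] /=; first by case: PQ.
have : x \in [seq u <- Q | `|t - u| < a / 2] by rewrite E mem_head.
by rewrite mem_filter => /andP[].
}
have hat_far u t : a / 2 <= `|t - u| -> hat u t = 0.
{
move=> h; rewrite /hat; apply/max_idPl; rewrite subr_le0 ler_pdivlMr ?mul1r//; lra.
}
have hat_ge0 u t : 0 <= hat u t by rewrite /hat le_max lexx.
have hat_le1 u t : hat u t <= 1.
{
rewrite /hat ge_max ler01 /= gerBl mulr_ge0// invr_ge0; lra.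
}
have hat_lip u s t : `|hat u s - hat u t| <= `|s - t| * (2 / a).
{
have H x y : `|Num.max 0 x - Num.max 0 y| <= `|x - y| :> R.
  by rewrite /Num.max; case: ltP => ?; case: ltP => ?; case: (ger0P (x - y)) => ?;
    rewrite ?ler_norml; try (apply/andP; split); lra.
apply: (le_trans (H _ _)).
have -> : 1 - `|s - u| / (a / 2) - (1 - `|t - u| / (a / 2)) =
  (`|t - u| - `|s - u|) * (2 / a) by field; lra.
rewrite normrM.
rewrite (ger0_norm (_ : 0 <= 2 / a)); last by rewrite divr_ge0// ltW.
apply: ler_wpM2r; first by rewrite divr_ge0// ltW.
apply: (le_trans (ler_dist_dist _ _)).
by rewrite opprB addrA subrK distrC.
}
have bump_lip u s t : `|bump u s - bump u t| <= `|s - t| / 4.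
{
rewrite /bump -mulrBr normrM.
apply: (@le_trans _ _ (r * (`|s - t| * (2 / a)))).
  by apply: ler_pM => //; exact/ltW/mate_near.
by rewrite /r le_eqVlt; apply/orP; left; apply/eqP; field; lra.
}
have lam_lip s t : `|bump (centre s) s - bump (centre t) t| <= `|s - t| / 2.
{
have st0 : 0 <= `|s - t| by [].
have [->|ne] := eqVneq (centre s) (centre t).
  by apply: (le_trans (bump_lip _ _ _)); lra.
have far x y : centre x != centre y -> bump (centre x) y = 0.
  move=> xy; rewrite /bump hat_far ?mulr0// leNgt; apply: contra xy => h.
  by rewrite (centreE _ _ (centreQ _) h).
have -> : bump (centre s) s - bump (centre t) t =
  (bump (centre s) s - bump (centre s) t) + (bump (centre t) s - bump (centre t) t).
  by rewrite (far s t)// (far t s) ?subr0 ?sub0r// eq_sym.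
apply: (le_trans (ler_normD _ _)).
by have := bump_lip (centre s) s t; have := bump_lip (centre t) s t; lra.
}
have lam_lt s t : s < t -> lam s < lam t.
{
move=> st; rewrite /lam; have := lam_lip s t.
rewrite (ltr0_norm (_ : s - t < 0)) ?subr_lt0// ler_norml => /andP[_]; lra.
}
have lam_continuous : continuous lam.
{
move=> t; apply/cvgrPdist_le => e e0.
have e2 : 0 < e / 2 by lra.
apply: filterS (nbhsx_ballx t (e / 2) e2) => s; rewrite /ball /= => H.
rewrite /lam opprD addrACA; apply: (le_trans (ler_normD _ _)).
by have := lam_lip t s; lra.
}
have lam_on u : u \in Q -> lam u = mate u.
{
move=> uQ; rewrite /lam (centreE u) ?subrr ?normr0//; last by lra.
rewrite /bump /hat subrr normr0 mul0r subr0 (max_idPr _)// mulr1; ring.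
}
have lam0 : lam 0 = 0.
{
case: PS => S0 _ _ _; case: PQ => Q0 _ _ _.
by rewrite lam_on// (mateE _ _ S0)// subrr normr0 /r; lra.
}
have lam1 : lam 1 = 1.
{
case: PS => _ S0 _ _; case: PQ => _ Q0 _ _.
by rewrite lam_on// (mateE _ _ S0)// subrr normr0 /r; lra.
}
have mono s t : s <= t -> lam s <= lam t.
  by rewrite le_eqVlt => /predU1P[->//|/lam_lt/ltW].
have [m lm] : exists m, clock lam m.
  apply: clock_surj.
  - by move=> t /andP[/mono + /mono]; rewrite lam0 lam1 => -> ->.
  - by move=> s t _ _; exact: lam_lt.
  - move=> t t01; have [||c c01 <-] := @IVT R lam 0 1 t ler01.
    + exact/continuous_subspaceT/lam_continuous.
    + by rewrite lam0 lam1 (min_idPl _)// (max_idPr _).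
    + by exists c => //; rewrite in_itv in c01.
exists lam, m; split=> //.
  move=> t _; rewrite /lam addrAC subrr add0r /bump normrM -[leRHS]mulr1.
  by apply: ler_pM => //; [exact/ltW/mate_near|rewrite ger0_norm].
by move=> u s uQ sS su; rewrite lam_on// (mateE _ _ sS).
Qed.

Lemma cell_ends S a t : separated_partition a S -> 0 <= t < 1 -> exists p q,
  [/\ p \in S, q \in S, p <= t < q & {in S, forall u, ~~ (p < u < q)}].
Proof.
case=> S0 S1 _ _ /andP[t0 t1].
have lo : forall Q, 0 \in Q -> exists p, [/\ p \in Q, p <= t & {in Q, forall u, u <= t -> u <= p}].
  suff H Q x : x <= t -> exists p, [/\ p \in x :: Q, p <= t & {in x :: Q, forall u, u <= t -> u <= p}].
    move=> Q Q0; have [p [pQ pt Hp]] := H Q 0 t0; exists p; split=> //.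
      by move: pQ; rewrite inE => /predU1P[->|].
    by move=> u uQ; apply: Hp; rewrite inE uQ orbT.
  elim: Q x => [|y Q IH] x xt.
    by exists x; split; rewrite ?mem_head// => u; rewrite inE => /eqP ->.
  have [yt|ty] := leP y t.
    have mt : Num.max x y <= t by rewrite ge_max xt.
    have [p [pQ pt Hp]] := IH _ mt; exists p; split=> //.
      move: pQ; rewrite !inE /Num.max; case: ltP => _ /predU1P[->|->]; rewrite ?eqxx ?orbT//.
    have := Hp _ (mem_head _ _) mt; rewrite ge_max => /andP[xp yp] u.
    by rewrite !inE => /predU1P[->//|/predU1P[->//|uQ]]; apply: Hp; rewrite inE uQ orbT.
  have [p [pQ pt Hp]] := IH _ xt; exists p; split=> //.
    by move: pQ; rewrite !inE => /predU1P[->|->]; rewrite ?eqxx ?orbT.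
  move=> u; rewrite !inE => /predU1P[->|/predU1P[->|uQ]].
  - by apply: Hp; rewrite mem_head.
  - by rewrite leNgt ty.
  - by apply: Hp; rewrite inE uQ orbT.
have hi : forall Q, 1 \in Q -> exists p, [/\ p \in Q, t < p & {in Q, forall u, t < u -> p <= u}].
  suff H Q x : t < x -> exists p, [/\ p \in x :: Q, t < p & {in x :: Q, forall u, t < u -> p <= u}].
    move=> Q Q0; have [p [pQ pt Hp]] := H Q 1 t1; exists p; split=> //.
      by move: pQ; rewrite inE => /predU1P[->|].
    by move=> u uQ; apply: Hp; rewrite inE uQ orbT.
  elim: Q x => [|y Q IH] x xt.
    by exists x; split; rewrite ?mem_head// => u; rewrite inE => /eqP ->.
  have [yt|ty] := ltP t y.
    have mt : t < Num.min x y by rewrite lt_min xt.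
    have [p [pQ pt Hp]] := IH _ mt; exists p; split=> //.
      move: pQ; rewrite !inE /Num.min; case: ltP => _ /predU1P[->|->]; rewrite ?eqxx ?orbT//.
    have := Hp _ (mem_head _ _) mt; rewrite le_min => /andP[xp yp] u.
    by rewrite !inE => /predU1P[->//|/predU1P[->//|uQ]]; apply: Hp; rewrite inE uQ orbT.
  have [p [pQ pt Hp]] := IH _ xt; exists p; split=> //.
    by move: pQ; rewrite !inE => /predU1P[->|->]; rewrite ?eqxx ?orbT.
  move=> u; rewrite !inE => /predU1P[->|/predU1P[->|uQ]].
  - by apply: Hp; rewrite mem_head.
  - by rewrite ltNge ty.
  - by apply: Hp; rewrite inE uQ orbT.
have [p [pS pt Hp]] := lo S S0; have [q [qS qt Hq]] := hi S S1.
exists p, q; split=> //; first by rewrite pt.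
move=> u uS; rewrite negb_and -!leNgt.
by have [ut|tu] := leP u t; [rewrite Hp|rewrite (Hq u) ?orbT].
Qed.

Lemma small_osc_cell e S (f : R -> 'rV[R]_d) p q s t : small_osc e S f ->
  0 <= p -> q <= 1 -> {in S, forall u, ~~ (p < u < q)} ->
  p <= s < q -> p <= t < q -> `|f s - f t| <= e.
Proof.
move=> H p0 q1 Spq /andP[ps sq] /andP[pt tq].
have [st|ts] := leP s t.
  apply: H => //; try lra; move=> u uS; apply: contra (Spq u uS) => /andP[? ?].
  by apply/andP; split; lra.
rewrite distrC; apply: H; try lra; move=> u uS; apply: contra (Spq u uS) => /andP[? ?].
by apply/andP; split; lra.
Qed.

(** The clock of matching_clock sends a cutting point of g to the neighbouring
cutting point of f, if there is one. The cell of f around l s and the cell of g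
around s then overlap on a length of at least a / 8, hence contain a common time
u at which f and g are close, and one passes from f (l s) to g s through f u and
g u. The value at 1 is a limit of values at earlier times. *)
Lemma matching_J1near e a S Q f g : 0 < a -> 0 < e ->
  separated_partition a S -> small_osc e S f -> separated_partition a Q -> small_osc e Q g ->
  (forall x y, 0 <= x -> y <= 1 -> x + a / 8 <= y ->
     exists2 u, x <= u < y & `|f u - g u| <= e) ->
  J1near (Num.max (5 * e) (a / 8)) f g.
Proof.
move=> a0 e0 PS Hf PQ Hg good.
have [l [m [lm lid lmate]]] := matching_clock a0 PS PQ.
exists l, m; split=> // t t01; split; first by rewrite le_max lid ?orbT.
rewrite le_max; apply/orP; left.
have [l1 _ _ _ lmono] := lm.
have [S0 S1 S01 Sgap] := PS; have [Q0 Q1 Q01 Qgap] := PQ.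
have main s : 0 <= s < 1 -> `|f (l s) - g s| <= 3 * e.
  move=> /andP[s0 s1].
  have s01 : 0 <= s <= 1 by rewrite s0 ltW.
  have o01 : 0 <= (1 : R) <= 1 by rewrite lexx ler01.
  have ls01 : 0 <= l s < 1.
    have /andP[-> _] := l1 _ s01.
    by rewrite -(clock1 lm) (clock_lt lm).
  have [p [q [pS qS /andP[pl lq] Spq]]] := cell_ends PS ls01.
  have [p' [q' [pQ qQ /andP[ps sq] Qpq]]] := cell_ends PQ (introT andP (conj s0 s1)).
  have := S01 _ pS; have := S01 _ qS; have := Q01 _ pQ; have := Q01 _ qQ.
  move=> q'01 p'01 q01 p01.
  have := Sgap _ _ pS qS (le_lt_trans pl lq).
  have := Qgap _ _ pQ qQ (le_lt_trans ps sq) => gQ gS.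
  have := lid _ s01; rewrite ler_norml => /andP[lo hi].
  (* otherwise the clock would send q' to p, although s < q' and p <= l s *)
  have c1 : p + a / 8 <= q'.
    rewrite leNgt; apply/negP => h.
    have lq' : l q' = p.
      apply: lmate => //; rewrite ltr_norml; apply/andP; split; lra.
    by have := lmono _ _ s01 q'01 sq; rewrite lq'; lra.
  have c2 : p' + a / 8 <= q.
    rewrite leNgt; apply/negP => h.
    have lp' : l p' = q.
      apply: lmate => //; rewrite ltr_norml; apply/andP; split; lra.
    by have := clock_le lm p'01 s01; rewrite ps lp' => ?; lra.
  have [|||u /andP[u1 u2] Hu] := good (Num.max p p') (Num.min q q').
  - by rewrite le_max; lra.
  - by rewrite ge_min; lra.
  - rewrite le_min /Num.max; case: ltP => ?; apply/andP; split; lra.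
  move: u1 u2; rewrite ge_max lt_min => /andP[u1 u2] /andP[u3 u4].
  have /andP[p0 _] := p01; have /andP[_ q1] := q01.
  have /andP[p'0 _] := p'01; have /andP[_ q'1] := q'01.
  have h1 : `|f (l s) - f u| <= e.
    by apply: (small_osc_cell Hf p0 q1 Spq); rewrite ?pl ?lq ?u1 ?u3.
  have h2 : `|g u - g s| <= e.
    by apply: (small_osc_cell Hg p'0 q'1 Qpq); rewrite ?ps ?sq ?u2 ?u4.
  apply: le_trans (dist_le3 h1 Hu h2) _.
  by rewrite (_ : 3 * e = e + e + e)//; ring.
move: (t01) => /andP[t0]; rewrite le_eqVlt => /predU1P[->|t1]; last first.
  have := main t; rewrite t0 t1 => /(_ isT); lra.
have [h h0 Hh] := @skorokhod_near_left _ _ f 1 e (introT andP (conj ler01 (lexx _))) e0.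
have [k k0 Hk] := @skorokhod_near_left _ _ g 1 e (introT andP (conj ler01 (lexx _))) e0.
rewrite left_lim1 in Hh; rewrite left_lim1 in Hk.
have [_ m1 _ lm' _] := lm; rewrite (clock1 lm).
pose x := Num.max 0 (1 - h / 2).
have hx : 0 <= x < 1 by rewrite /x /Num.max; case: ltP => ?; apply/andP; split; lra.
have hx' : 1 - h < x by rewrite /x lt_max; apply/orP; right; lra.
have x01 : 0 <= x <= 1 by case/andP: hx => -> /ltW.
have mx1 : m x < 1.
  have o01 : 0 <= (1 : R) <= 1 by rewrite lexx ler01.
  by rewrite -(clock_lt lm) ?m1// lm'// (clock1 lm); case/andP: hx.
pose s := Num.max (m x) (1 - k / 2).
have ms : m x <= s by rewrite /s le_max lexx.
have s1 : s < 1 by rewrite /s gt_max mx1; lra.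
have sk : 1 - k < s by rewrite /s lt_max; apply/orP; right; lra.
have s0 : 0 <= s by have /andP[? _] := m1 _ x01; lra.
have s01 : 0 <= s <= 1 by rewrite s0 ltW.
have ls : x <= l s by rewrite -[x]lm'// (clock_le lm) ?m1.
have ls1 : l s < 1 by rewrite -(clock1 lm) (clock_lt lm)// lexx ler01.
have h1 : `|f (l s) - f 1| <= e by apply: Hh; apply/andP; split; lra.
have h2 : `|g s - g 1| <= e by apply: Hk; apply/andP; split.
have h3 := main s (introT andP (conj s0 s1)).
rewrite distrC in h1; apply: le_trans (dist_le3 h1 h3 h2) _.
by rewrite (_ : 5 * e = e + 3 * e + e)//; ring.
Qed.

End Matching.

(** * Closeness off a set of small length *)

Section Segments.
Variables (R : realType) (d : nat).
Implicit Types (x y z v : 'rV[R]_d).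

Lemma segment_dist_le x y z v (a : R) : segment x y z ->
  `|x - v| <= a -> `|y - v| <= a -> `|z - v| <= a.
Proof.
move=> [c]; rewrite /= in_itv /= => /andP[c0 c1] <- xv yv.
have -> : c *: x + (1 - c) *: y - v = c *: (x - v) + (1 - c) *: (y - v).
  rewrite !scalerBr addrACA -opprD -scalerDl.
  by rewrite (_ : c + (1 - c) = 1) ?scale1r//; lra.
apply: (le_trans (ler_normD _ _)); rewrite !normrZ ger0_norm// ger0_norm; last by lra.
have h1 := ler_wpM2l c0 xv.
have h2 : (1 - c) * `|y - v| <= (1 - c) * a by apply: ler_wpM2l => //; lra.
lra.
Qed.

Lemma segment_l x y : segment x y x.
Proof.
by exists 1; rewrite /= ?in_itv/= ?lexx ?ler01// subrr scale0r addr0 scale1r.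
Qed.

Lemma segment_r x y : segment x y y.
Proof.
by exists 0; rewrite /= ?in_itv/= ?lexx ?ler01// scale0r add0r subr0 scale1r.
Qed.

Lemma segment_sym x y z : segment x y z -> segment y x z.
Proof.
move=> [c]; rewrite /= in_itv /= => /andP[c0 c1] <-; exists (1 - c).
  by rewrite /= in_itv/=; apply/andP; split; lra.
by rewrite opprB addrC; congr (_ *: _ + _); lra.
Qed.

End Segments.

Section WeakCloseness.
Variables (R : realType) (d : nat).
Implicit Types (f g h : skorokhod R d) (t s a b e r : R) (S : seq R).
Implicit Types (c : seq (R * R)).

(** A list of pairs encodes a union of intervals by their centres and radii. *)
Definition cover_length c : R := \sum_(p <- c) 2 * p.2.

Definition uncovered c t := {in c, forall p : R * R, p.2 < `|t - p.1|}.

Lemma uncovered_point c t s : (forall p, p \in c -> 0 <= p.2) ->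
  t + cover_length c < s -> exists2 u, t <= u < s & uncovered c u.
Proof.
have [n] := ubnP (size c); elim: n c t => // n IH c t; rewrite ltnS => cn c0 ts.
have [[p pc tp]|none] := pselect (exists2 p, p \in c & `|t - p.1| <= p.2); last first.
  exists t; last first.
    by move=> p pc; rewrite ltNge; apply/negP => h; apply: none; exists p.
  rewrite lexx /=; apply: le_lt_trans ts; rewrite lerDl.
  by rewrite /cover_length big_seq; apply: sumr_ge0 => p /c0 ?; rewrite mulr_ge0.
have lenE : cover_length c = 2 * p.2 + cover_length (rem p c).
  by rewrite /cover_length (perm_big _ (perm_to_rem pc)) big_cons.
pose e := (s - t - cover_length c) / 2.
have e0 : 0 < e by rewrite /e; lra.
move: tp; rewrite ler_norml => /andP[tp1 tp2].
have [||//|u /andP[u1 u2] Hu] := IH (rem p c) (p.1 + p.2 + e).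
- by rewrite size_rem// ; apply: leq_trans cn; case: (c) pc.
- by move=> q /mem_rem; exact: c0.
- by rewrite lenE in ts; rewrite /e lenE; lra.
exists u.
  by rewrite u2 andbT; have := c0 _ pc; lra.
move=> q qc; have [->|qp] := eqVneq q p.
  by apply: lt_le_trans (ler_norm _); lra.
apply: Hu; move: qc; rewrite (perm_mem (perm_to_rem pc)) inE.
by rewrite (negbTE qp).
Qed.

(** This closeness is coarse enough to follow from closeness in each of the four
topologies, and it satisfies the triangle inequality exactly. *)
Definition weaknear a f g := exists c, [/\ forall p, p \in c -> 0 <= p.2,
  cover_length c <= a &
  forall t, 0 <= t < 1 -> uncovered c t -> `|f t - g t| <= a].

Lemma weaknear_refl a f : 0 <= a -> weaknear a f f.
Proof.
move=> a0; exists [::]; split=> //; first by rewrite /cover_length big_nil.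
by move=> t _ _; rewrite subrr normr0.
Qed.

Lemma weaknear_sym a f g : weaknear a f g -> weaknear a g f.
Proof. by move=> [c [c0 ca H]]; exists c; split=> // t; rewrite distrC; exact: H. Qed.

Lemma weaknear_trans a b f g h :
  weaknear a f g -> weaknear b g h -> weaknear (a + b) f h.
Proof.
move=> [c [c0 ca H]] [c' [c'0 c'a H']]; exists (c ++ c'); split.
- by move=> p; rewrite mem_cat => /orP[/c0|/c'0].
- by rewrite /cover_length big_cat; exact: lerD.
- move=> t t01 Ht; have -> : f t - h t = (f t - g t) + (g t - h t) by rewrite addrA subrK.
  apply: (le_trans (ler_normD _ _)); apply: lerD.
    by apply: H => // p pc; apply: Ht; rewrite mem_cat pc.
  by apply: H' => // p pc; apply: Ht; rewrite mem_cat pc orbT.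
Qed.

Definition graph_close a f g := forall t, 0 <= t <= 1 -> exists z s,
  [/\ complete_graph f (z, s), `|g t - z| <= a & `|t - s| <= a].

Lemma complete_graph_path f t : 0 <= t <= 1 -> complete_graph f (f t, t).
Proof. by move=> t01; split=> //=; exact: segment_r. Qed.

Lemma incomplete_complete f p : incomplete_graph f p -> complete_graph f p.
Proof.
by move=> [p01 [Hp|Hp]]; split=> //; rewrite Hp; [exact: segment_l|exact: segment_r].
Qed.

Lemma hausdorff_dist_lt (A B : set ('rV[R]_d * R)) a z t :
  (hausdorff_dist A B < a%:E)%E -> B (z, t) ->
  exists2 p, A p & `|z - p.1| <= a /\ `|t - p.2| <= a.
Proof.
move=> /ereal_inf_lt[_ [e [e0 _ BA] <-]]; rewrite lte_fin => ea.
move=> /BA [/= _ [p Ap]]; rewrite ge_max => /andP[h1 h2].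
exists p => //; split; last by lra.
by have := norm_le_enorm (z - p.1); lra.
Qed.

(** What the four distances have in common. Completing only the graph of f makes
the incomplete and the complete graphs fit into the same statement. *)
Lemma sk_dist_graph_close T a f g : (sk_dist T f g < a%:E)%E -> graph_close a f g.
Proof.
case: T => /= H t t01.
- have /ereal_inf_lt[_ [l [_ [l1 _ _]] <-]] := H; rewrite gt_max => /andP[h1 h2].
  exists (f (l t)), (l t); split.
  + by apply: complete_graph_path; have := l1 t; rewrite /= !in_itv/=; apply.
  + rewrite distrC; apply: (le_trans (norm_le_enorm _)).
    rewrite -lee_fin; apply/ltW; apply: le_lt_trans h1.
    exact: (@le_sup01 _ (fun t => enorm (f (l t) - g t))).
  + rewrite distrC -lee_fin; apply/ltW; apply: le_lt_trans h2.
    exact: (@le_sup01 _ (fun t => `|l t - t|)).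
- have [|[z s] /= /incomplete_complete ? [? ?]] := hausdorff_dist_lt H (z := g t) (t := t).
    by split=> //=; right.
  by exists z, s.
- have /ereal_inf_lt[_ [u1 [r1 [u2 [r2 [[_ _ _ E1] [_ _ _ E2] ->]]]]]] := H.
  rewrite gt_max => /andP[h1 h2].
  have : complete_graph g (g t, t) by exact: complete_graph_path.
  rewrite -E2 => -[s s01 [<- <-]].
  have s01' : 0 <= s <= 1 by move: s01; rewrite /= in_itv.
  exists (u1 s), (r1 s); split.
  + by rewrite -E1; exists s.
  + rewrite distrC; apply: (le_trans (norm_le_enorm _)).
    rewrite -lee_fin; apply/ltW; apply: le_lt_trans h1.
    exact: (@le_sup01 _ (fun t => enorm (u1 t - u2 t))).
  + rewrite distrC -lee_fin; apply/ltW; apply: le_lt_trans h2.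
    exact: (@le_sup01 _ (fun t => `|r1 t - r2 t|)).
- have [|[z s] /= ? [? ?]] := hausdorff_dist_lt H (z := g t) (t := t).
    exact: complete_graph_path.
  by exists z, s.
Qed.

(** Cut f into cells with small oscillation. For t at distance more than 2 a
from the cutting points, the point of the completed graph of f that is close to
g t lies over the cell of t, hence is close to f t. The excluded neighbourhoods
of the cutting points have small total length. *)
Lemma sk_dist_weaknear T f b : 0 < b -> exists2 a, 0 < a &
  forall g, (sk_dist T f g < a%:E)%E -> weaknear b f g.
Proof.
move=> b0; have b2 : 0 < b / 2 by lra.
have [w [S [w0 PS HS]]] := rcll_partition f b2.
pose N : R := (size S)%:R.
have N0 : 0 <= N by rewrite ler0n.
pose a := b / (4 * N + 4).
have a0 : 0 < a by rewrite divr_gt0//; lra.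
have aE : a * (4 * N + 4) = b by rewrite /a mulfVK// gt_eqF//; lra.
have aN : 0 <= a * N by rewrite mulr_ge0// ltW.
exists a => // g /sk_dist_graph_close close.
exists [seq (u, 2 * a) | u <- S]; split.
- by move=> p /mapP[u _ ->] /=; lra.
- rewrite /cover_length big_map /= big_const_seq iter_addr_0 count_predT.
  by rewrite -mulr_natr -/N; lra.
- move=> t t01 unc; have [p [q [pS qS /andP[pt tq] Spq]]] := cell_ends PS t01.
  have /andP[t0 t1] := t01.
  have [z [s [[/= s01 zs] zt ts]]] := close t (introT andP (conj t0 (ltW t1))).
  have [_ _ S01 _] := PS; have /andP[p0 p1] := S01 _ pS; have /andP[q0 q1] := S01 _ qS.
  have up : 2 * a < t - p.
    by have := unc (p, 2 * a) (map_f _ pS); rewrite /= ger0_norm//; lra.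
  have uq : 2 * a < q - t.
    by have := unc (q, 2 * a) (map_f _ qS); rewrite /= ler0_norm//; lra.
  move: ts; rewrite ler_norml => /andP[ts1 ts2].
  have cell r : p <= r < q -> `|f r - f t| <= b / 2.
    by move=> pr; apply: (small_osc_cell HS p0 q1 Spq) => //; rewrite pt.
  have zf : `|z - f t| <= b / 2.
    apply: (segment_dist_le zs); last by apply: cell; apply/andP; split; lra.
    apply: (@left_lim_dist_le _ _ f s _ _ (s - p)).
    + by apply/andP; split; lra.
    + by lra.
    + by move=> r /andP[r1 r2]; apply: cell; apply/andP; split; lra.
  have -> : f t - g t = - (z - f t) - (g t - z) by rewrite !opprB addrA subrK.
  apply: (le_trans (ler_normB _ _)); rewrite normrN; lra.
Qed.

End WeakCloseness.

(** * Regular sequences: weak closeness implies closeness for J1 *)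

Section Embeddings.
Variables (R : realType) (d : nat).
Implicit Types (f g x : skorokhod R d) (t s a b e r : R) (S : seq R).
Implicit Types (n k : nat) (y : nat -> 'rV[R]_d).

Lemma embedding_M2 T n y x : is_embedding T n y x -> is_embedding M2 n y x.
Proof.
move=> H k kn; have [-> Hx] := H k kn; split=> // t tk; have := Hx t tk.
case: T {H Hx} => //= [->|[->|->]|->].
- exact: segment_l.
- exact: segment_l.
- exact: segment_r.
have n0 : 0 < n%:R :> R by rewrite ltr0n; case: (n) kn.
move/andP: tk => [t1 t2].
exists (1 - n%:R * (t - k%:R / n%:R)).
  rewrite /= in_itv /=.
  rewrite ltr_pdivrMr// in t1; rewrite ltr_pdivlMr// in t2.
  rewrite -natr1 in t2.
  have -> : n%:R * (t - k%:R / n%:R) = t * n%:R - k%:R by field; rewrite gt_eqF.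
  by apply/andP; split; lra.
rewrite opprB addrCA subrr addr0 scalerBl scale1r scalerBr.
by rewrite addrA addrAC.
Qed.

Lemma grid_index n t : (0 < n)%N -> 0 <= t < 1 -> exists2 k,
  (k < n)%N & k%:R / n%:R <= t < k.+1%:R / n%:R.
Proof.
move=> n0 /andP[t0 t1]; have n0' : 0 < n%:R :> R by rewrite ltr0n.
have tn0 : 0 <= t * n%:R by rewrite mulr_ge0// ltW.
have /andP[k1 k2] := truncn_itv tn0.
exists (Num.truncn (t * n%:R)); last by rewrite ler_pdivrMr// ltr_pdivlMr// k1.
by rewrite -(ltr_nat R); apply: le_lt_trans k1 _; rewrite gtr_pMl.
Qed.

Lemma J1_embeddingE n y g k t : is_embedding J1 n y g -> (k < n)%N ->
  k%:R / n%:R <= t < k.+1%:R / n%:R -> g t = y k.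
Proof.
move=> H kn /andP[]; have [Hk Ht] := H k kn.
by rewrite le_eqVlt => /predU1P[<- _|h1 h2]; [|apply: Ht; rewrite h1].
Qed.

Lemma M2_embeddingE n y x k t : is_embedding M2 n y x -> (k < n)%N ->
  k%:R / n%:R <= t < k.+1%:R / n%:R -> segment (y k) (y k.+1) (x t).
Proof.
move=> H kn /andP[]; have [Hk Ht] := H k kn.
rewrite le_eqVlt => /predU1P[<- _|h1 h2]; last by apply: Ht; rewrite h1.
by rewrite Hk; exact: segment_l.
Qed.

(** The counterpart for sequences of a separated partition with small
oscillation. The list Q of cutting indices contains n, so that the last large
move is far from the end too. *)
Definition regular_sequence e a n y := exists Q : seq nat,
  [/\ 0%N \in Q, n \in Q, {in Q, forall k, (k <= n)%N},
      {in Q &, forall i j, (i < j)%N -> i%:R + a * n%:R <= j%:R} &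
      forall i j, (i <= j)%N -> (j < n)%N -> {in Q, forall k, ~~ (i < k <= j)%N} ->
        `|y i - y j| <= e].

(** The step embedding g inherits from y a separated partition with small
oscillation. In every interval of length a / 8 there is a stretch of length a /
32 that meets no time step ending at a cutting index; there x and g are close
whatever x does inside the time steps. This stretch is longer than the
exceptional set, so it contains a time at which f is close to x, hence to g, and
matching_J1near applies. *)
Lemma regular_weaknear_J1near e a r n y f g x S : 0 < e -> 0 < a ->
  r <= e -> r < a / 32 -> (0 < n)%N -> n%:R^-1 <= a / 32 ->
  regular_sequence e a n y -> is_embedding J1 n y g -> is_embedding M2 n y x ->
  separated_partition a S -> small_osc e S f -> weaknear r f x ->
  J1near (Num.max (10 * e) (a / 8)) f g.
Proof.
move=> e0 a0 re ra n0 na [Q [Q0 Qn Qle Qgap Qosc]] Hg Hx PS HS [c [c0 cr Hc]].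
have n0' : 0 < n%:R :> R by rewrite ltr0n.
have npos : n%:R != 0 :> R by rewrite gt_eqF.
pose Q' := [seq k%:R / n%:R : R | k <- Q].
have PQ : separated_partition a Q'.
  split.
  - by apply/mapP; exists 0%N; rewrite ?mul0r.
  - by apply/mapP; exists n; rewrite ?divff.
  - move=> _ /mapP[k kQ ->]; rewrite divr_ge0//= ler_pdivrMr// mul1r.
    by rewrite ler_nat Qle.
  - move=> _ _ /mapP[i iQ ->] /mapP[j jQ ->].
    rewrite ltr_pM2r ?invr_gt0// ltr_nat => ij.
    by rewrite -ler_pdivrMr ?invr_gt0// invrK mulrDl mulfVK// Qgap.
have HQ : small_osc e Q' g.
  move=> s t s0 st t1 H.
  have [i iN si] := grid_index n0 (introT andP (conj s0 (le_lt_trans st t1))).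
  have [j jN tj] := grid_index n0 (introT andP (conj (le_trans s0 st) t1)).
  rewrite (J1_embeddingE Hg iN si) (J1_embeddingE Hg jN tj).
  move/andP: si => [si1 si2]; move/andP: tj => [tj1 tj2].
  apply: Qosc => //.
    rewrite -ltnS -(ltr_nat R) -(@ltr_pM2r _ n%:R^-1) ?invr_gt0//.
    by apply: (le_lt_trans si1); exact: le_lt_trans tj2.
  move=> k kQ; apply: contra (H _ (map_f _ kQ)) => /andP[ik kj]; apply/andP; split.
    by apply: (lt_le_trans si2); rewrite ler_pM2r ?invr_gt0// ler_nat.
  by apply: le_trans tj1; rewrite ler_pM2r ?invr_gt0// ler_nat.
have e20 : 0 < 2 * e by lra.
have wider S' (h : R -> 'rV[R]_d) : small_osc e S' h -> small_osc (2 * e) S' h.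
  by move=> H s t s0 st t1 /(H _ _ s0 st t1) ?; lra.
have -> : 10 * e = 5 * (2 * e) by lra.
apply: (matching_J1near a0 e20 PS (wider _ _ HS) PQ (wider _ _ HQ)) => p q p0 q1 pq.
(* of two stretches at distance 3 * a / 32 one is free, as the cutting points
are a apart *)
have [p' [p'1 p'2 nobad]] : exists p', [/\ p <= p', p' + a / 32 <= q &
    forall t k, p' <= t < p' + a / 32 -> (k < n)%N ->
      k%:R / n%:R <= t < k.+1%:R / n%:R -> k.+1 \notin Q].
  apply: contrapT => none.
  have bad p' : p <= p' -> p' + a / 32 <= q -> exists2 k, k \in Q &
      p' < k%:R / n%:R <= p' + a / 16.
    move=> pp' p'q; apply: contrapT => none'; apply: none; exists p'; split=> //.
    move=> t k /andP[t1 t2] kn /andP[t3 t4]; apply/negP => kQ; apply: none'.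
    exists k.+1 => //; apply/andP; split; first lra.
    by rewrite -natr1 mulrDl mul1r; lra.
  have [||k kQ /andP[k1 k2]] := bad p; [lra|lra|].
  have [||k' k'Q /andP[k'1 k'2]] := bad (p + 3 * a / 32); [lra|lra|].
  have [_ _ _ gap] := PQ.
  have := gap _ _ (map_f _ kQ) (map_f _ k'Q); lra.
have [||t /andP[t1 t2] tc] := @uncovered_point R c p' (p' + a / 32) => //; first lra.
exists t; first by apply/andP; split; lra.
have t01 : 0 <= t < 1 by apply/andP; split; lra.
have [k kn tk] := grid_index n0 t01.
have kQ : k.+1 \notin Q by apply: nobad tk => //; rewrite t1.
have kn' : (k.+1 < n)%N.
  by rewrite ltn_neqAle kn andbT; apply: contraNneq kQ => ->.
have yk : `|y k.+1 - y k| <= e.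
  rewrite distrC; apply: Qosc => // j jQ.
  rewrite -eqn_leq; apply: contraNneq kQ => ->; exact: jQ.
have xy : `|x t - y k| <= e.
  apply: (segment_dist_le (M2_embeddingE Hx kn tk)) => //.
  by rewrite subrr normr0 ltW.
rewrite (J1_embeddingE Hg kn tk).
have -> : f t - y k = (f t - x t) + (x t - y k) by rewrite addrA subrK.
apply: (le_trans (ler_normD _ _)).
by have := Hc t t01 tc; lra.
Qed.

End Embeddings.

(** * From the step embedding to the J2 embeddings *)

Section Hausdorff.
Variables (R : realType) (d : nat).
Implicit Types (f g x : skorokhod R d) (t s a b e r : R).
Implicit Types (n k : nat) (y : nat -> 'rV[R]_d).

Definition close_to a (A : set ('rV[R]_d * R)) z t :=
  exists w s, [/\ A (w, s), `|z - w| <= a & `|t - s| <= a].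

Lemma close_to_trans a b A z z' t t' : close_to a A z t ->
  `|z' - z| <= b -> `|t' - t| <= b -> close_to (a + b) A z' t'.
Proof.
move=> [w [s [Aw zw ts]]] zz tt; exists w, s; split=> //.
  have -> : z' - w = (z' - z) + (z - w) by rewrite addrA subrK.
  by apply: (le_trans (ler_normD _ _)); rewrite addrC lerD.
have -> : t' - s = (t' - t) + (t - s) by rewrite addrA subrK.
by apply: (le_trans (ler_normD _ _)); rewrite addrC lerD.
Qed.

Lemma close_to_le a b A z t : a <= b -> close_to a A z t -> close_to b A z t.
Proof.
move=> ab [w [s [? h1 h2]]]; exists w, s; split=> //; exact: le_trans ab.
Qed.

Lemma hausdorff_dist_le (A B : set ('rV[R]_d * R)) e : 0 < e ->
  (forall z t, A (z, t) -> 0 <= t <= 1 /\ close_to e B z t) ->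
  (forall z t, B (z, t) -> 0 <= t <= 1 /\ close_to e A z t) ->
  (hausdorff_dist A B <= (d.+1%:R * e)%:E)%E.
Proof.
move=> e0 AB BA; apply: ereal_inf_lbound; exists (d.+1%:R * e) => //.
have e1 : e <= d.+1%:R * e by rewrite -[leLHS]mul1r ler_pM2r// ler1n.
have thick C D : (forall z t, C (z, t) -> 0 <= t <= 1 /\ close_to e D z t) ->
    C `<=` thickening (d.+1%:R * e) D.
  move=> CD [z t] /CD[t01 [w [s [Dw zw ts]]]]; split=> //=.
  exists (w, s) => //=; rewrite ge_max; apply/andP; split; last exact: le_trans e1.
  apply: (le_trans (enorm_le_norm _)); apply: ler_pM => //.
  by rewrite ler_nat.
by split; [rewrite mulr_gt0|exact: thick|exact: thick].
Qed.

Lemma left_lim_approx f t a s : 0 < t <= 1 -> 0 < a -> s < t -> exists r,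
  [/\ 0 <= r, s < r < t, t - a <= r & `|f r - left_lim f t| <= a].
Proof.
move=> /andP[t0 t1] a0 st.
have [h h0 Hh] := @skorokhod_near_left _ _ f t a (introT andP (conj (ltW t0) t1)) a0.
pose p := Num.max (Num.max 0 s) (Num.max (t - a) (t - h)).
have pt : p < t by rewrite /p !gt_max t0 st /=; lra.
have [p0 ps] : 0 <= p /\ s <= p by rewrite /p !le_max !lexx !orbT.
have [pa ph] : t - a <= p /\ t - h <= p by rewrite /p !le_max !lexx !orbT.
exists ((p + t) / 2); split; try lra.
by apply: Hh; apply/andP; split; lra.
Qed.

(** The times tau k are the images of the times k / n under the clock; f stays
near y k from tau k to tau (k + 1). Only these times enter the estimates of the
distances from f to the embeddings of y. *)
Lemma J1near_grid a n y f g : (0 < n)%N -> is_embedding J1 n y g ->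
  J1near a f g -> exists tau : nat -> R,
  [/\ tau 0%N = 0, tau n = 1,
      forall i j, (i < j)%N -> (j <= n)%N -> tau i < tau j,
      forall k, (k <= n)%N -> `|tau k - k%:R / n%:R| <= a &
      forall k t, (k < n)%N -> tau k <= t < tau k.+1 -> `|f t - y k| <= a].
Proof.
move=> n0 Hg [l [m [lm H]]]; have n0' : 0 < n%:R :> R by rewrite ltr0n.
have k01 k : (k <= n)%N -> 0 <= (k%:R / n%:R : R) <= 1.
  by move=> kn; rewrite divr_ge0//= ler_pdivrMr// mul1r ler_nat.
exists (fun k => l (k%:R / n%:R)); split.
- by rewrite mul0r (clock0 lm).
- by rewrite divff ?gt_eqF// (clock1 lm).
- move=> i j ij jn; rewrite (clock_lt lm) ?k01//; last exact: ltnW (leq_trans ij jn).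
  by rewrite ltr_pM2r ?invr_gt0// ltr_nat.
- by move=> k kn; have [] := H _ (k01 k kn).
- move=> k t kn /andP[t1 t2]; have [l1 m1 _ lm' _] := lm.
  have t01 : 0 <= t <= 1.
    have /andP[? _] := l1 _ (k01 _ (ltnW kn)).
    by have /andP[_ ?] := l1 _ (k01 _ kn); apply/andP; split; lra.
  rewrite -(J1_embeddingE Hg (t := m t) kn).
    by have [_ ] := H _ (m1 _ t01); rewrite lm'.
  rewrite -(clock_le lm) ?m1 ?k01//; last exact: ltnW.
  by rewrite -(clock_lt lm (s := m t)) ?m1 ?k01// lm'// t1.
Qed.

Section Grid.
Variables (tau : nat -> R) (n : nat).

Lemma grid_cell_right t : tau 0%N = 0 -> tau n = 1 -> 0 <= t < 1 ->
  exists2 k, (k < n)%N & tau k <= t < tau k.+1.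
Proof.
move=> tau0 taun /andP[t0 t1].
have ex : exists k, t < tau k by exists n; rewrite taun.
case: (ex_minnP ex) => -[|k] tk kmin; first by move: tk; rewrite tau0 ltNge t0.
exists k; first by apply: kmin; rewrite taun.
by rewrite tk andbT leNgt; apply/negP => /kmin; rewrite ltnn.
Qed.

Lemma grid_cell_left t : tau 0%N = 0 -> tau n = 1 -> 0 < t <= 1 ->
  exists2 k, (k < n)%N & tau k < t <= tau k.+1.
Proof.
move=> tau0 taun /andP[t0 t1].
have ex : exists k, t <= tau k by exists n; rewrite taun.
case: (ex_minnP ex) => -[|k] tk kmin; first by move: tk; rewrite tau0 leNgt t0.
exists k; first by apply: kmin; rewrite taun.
by rewrite tk andbT ltNge; apply/negP => /kmin; rewrite ltnn.
Qed.

End Grid.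

Lemma grid01 (tau : nat -> R) n : tau 0%N = 0 -> tau n = 1 ->
  (forall i j, (i < j)%N -> (j <= n)%N -> tau i < tau j) ->
  forall k, (k <= n)%N -> 0 <= tau k <= 1.
Proof.
move=> tau0 taun tau_lt k kn; apply/andP; split.
  by case: k kn => [|k] kn; rewrite -?tau0//; apply/ltW/tau_lt; rewrite ?tau0.
by rewrite -taun; move: kn; rewrite leq_eqVlt => /predU1P[->//|kn]; apply/ltW/tau_lt.
Qed.

Lemma uniform_grid n : (0 < n)%N ->
  0%:R / n%:R = 0 :> R /\ n%:R / n%:R = 1 :> R.
Proof. by move=> n0; rewrite mul0r divff// gt_eqF// ltr0n. Qed.

Lemma uniform_grid_step n k : k.+1%:R / n%:R = k%:R / n%:R + n%:R^-1 :> R.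
Proof. by rewrite -natr1 mulrDl mul1r. Qed.

Lemma grid_left_lim f tau k t (v : 'rV[R]_d) a : 0 <= tau k ->
  (forall t, tau k <= t < tau k.+1 -> `|f t - v| <= a) ->
  tau k < t <= tau k.+1 -> t <= 1 -> `|left_lim f t - v| <= a.
Proof.
move=> tk0 H /andP[t1 t2] tle; apply: (@left_lim_dist_le _ _ f t _ _ (t - tau k)).
- by apply/andP; split; lra.
- by lra.
- by move=> s /andP[s1 s2]; apply: H; apply/andP; split; lra.
Qed.

(** Left limits and the value at 1 are limits of values at earlier times, at the
price of an arbitrarily small a. *)
Lemma incomplete_graph_close A f a b : 0 < a ->
  (forall t, 0 <= t < 1 -> close_to b A (f t) t) ->
  forall z t, incomplete_graph f (z, t) -> 0 <= t <= 1 /\ close_to (b + a) A z t.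
Proof.
move=> a0 pathf z t [/= t01 Hz]; split=> //; have /andP[t0 t1] := t01.
have left : 0 < t -> close_to (b + a) A (left_lim f t) t.
  move=> t0'; have t01' : 0 < t <= 1 by rewrite t0'.
  have [r [r0 /andP[_ rt] tr frt]] := left_lim_approx f t01' a0 t0'.
  have r01 : 0 <= r < 1 by apply/andP; split; lra.
  apply: (close_to_trans (pathf _ r01)); first by rewrite distrC.
  by rewrite ger0_norm; lra.
have right : t < 1 -> close_to (b + a) A (f t) t.
  by move=> t1'; apply: close_to_le (pathf _ _); [rewrite lerDl ltW|rewrite t0].
case: Hz => ->.
  have [t0'|t0'] := ltP 0 t; first exact: left.
  have tE : t = 0 by lra.
  by move: right; rewrite tE left_lim0; apply; exact: ltr01.
have [t1'|t1'] := ltP t 1; first exact: right.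
have tE : t = 1 by lra.
by move: left; rewrite tE left_lim1; apply; exact: ltr01.
Qed.

(** The values of x are states y k taken at a time close to k / n, and f is near
y k at tau k. The exception is the last time step, during which x may take the
value y n that f never approaches: it is close to the previous state by the
assumption on the last increment. *)
Lemma distJ2_embedding_le a n y f g x : (0 < n)%N -> n%:R^-1 <= a ->
  `|y n - y n.-1| <= a -> J1near a f g ->
  is_embedding J1 n y g -> is_embedding J2 n y x ->
  (distJ2 f x <= (d.+1%:R * (4 * a))%:E)%E.
Proof.
move=> n0 na ya fg Hg Hx.
have n0' : 0 < n%:R :> R by rewrite ltr0n.
have a0 : 0 < a by apply: lt_le_trans na; rewrite invr_gt0.
have [tau [tau0 taun tau_lt tau_near Hf]] := J1near_grid n0 Hg fg.
have [u0 un] := uniform_grid n0.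
have us := uniform_grid_step n.
have tau01 := grid01 tau0 taun tau_lt.
have k01 k : (k < n)%N -> 0 <= (k%:R / n%:R : R) < 1.
  by move=> kn; rewrite divr_ge0//= ltr_pdivrMr// mul1r ltr_nat.
have xk k : (k < n)%N -> x (k%:R / n%:R) = y k by move=> /Hx[].
apply: hausdorff_dist_le; first by lra.
  have pathf t : 0 <= t < 1 -> close_to (3 * a) (incomplete_graph x) (f t) t.
    move=> t01; have [k kn tk] := grid_cell_right tau0 taun t01.
    exists (y k), (k%:R / n%:R); split.
    - by split=> /=; [have /andP[-> /ltW] := k01 k kn|right; rewrite xk].
    - by have := Hf _ _ kn tk; lra.
    - have := tau_near k (ltnW kn); have := tau_near k.+1 kn; rewrite us.
      case/andP: tk => ? ?; rewrite !ler_norml => /andP[? ?] /andP[? ?].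
      by apply/andP; split; lra.
  have -> : 4 * a = 3 * a + a by lra.
  exact: incomplete_graph_close a0 pathf.
have pathx t : 0 <= t < 1 -> close_to (3 * a) (incomplete_graph f) (x t) t.
  move=> t01; have [k kn tk] := grid_index n0 t01.
  have yk j : (j < n)%N -> close_to (2 * a) (incomplete_graph f) (y j) (j%:R / n%:R).
    move=> jn; exists (f (tau j)), (tau j); split.
    - by split=> /=; [rewrite tau01 ?(ltnW jn)|right].
    - rewrite distrC; have := Hf j (tau j) jn; rewrite lexx tau_lt// => /(_ isT); lra.
    - by rewrite distrC; have := tau_near j (ltnW jn); lra.
  have -> : 3 * a = 2 * a + a by lra.
  case/andP: tk => tk1 tk2.
  have [xE|xE] : x t = y k \/ x t = y k.+1.
    move: tk1; rewrite le_eqVlt => /predU1P[<-|tk1]; first by left; rewrite xk.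
    by have [_ /(_ t)] := Hx k kn; apply; rewrite tk1.
  - apply: (close_to_trans (yk _ kn)); first by rewrite xE subrr normr0 ltW.
    by rewrite us in tk2; rewrite ger0_norm; lra.
  - have [k1n|nk1] := ltnP k.+1 n.
      apply: (close_to_trans (yk _ k1n)); first by rewrite xE subrr normr0 ltW.
      by rewrite us in tk2 *; rewrite ler0_norm; lra.
    have nE : n = k.+1 by apply/eqP; rewrite eqn_leq nk1 kn.
    apply: (close_to_trans (yk _ kn)); first by move: ya; rewrite xE nE.
    by rewrite us in tk2; rewrite ger0_norm; lra.
have -> : 4 * a = 3 * a + a by lra.
exact: incomplete_graph_close a0 pathx.
Qed.

End Hausdorff.

(** * From the step embedding to the M2 embeddings *)

Section EmbeddingsM2.
Variables (R : realType) (d : nat).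
Implicit Types (f g x : skorokhod R d) (t s a b e r c : R).
Implicit Types (n k : nat) (y : nat -> 'rV[R]_d).

Lemma segmentP (u v z : 'rV[R]_d) : segment u v z <->
  exists2 c, 0 <= c <= 1 & z = u + c *: (v - u).
Proof.
split=> [/segment_sym[c]|[c c01 ->]].
  rewrite /= in_itv /= => c01 <-; exists c => //.
  by rewrite scalerBl scale1r scalerBr addrCA.
apply: segment_sym; exists c; first by rewrite /= in_itv.
by rewrite scalerBl scale1r scalerBr addrCA.
Qed.

Lemma segment_convex (u v z w p : 'rV[R]_d) :
  segment u v z -> segment u v w -> segment z w p -> segment u v p.
Proof.
move=> /segmentP[a /andP[a0 a1] ->] /segmentP[b /andP[b0 b1] ->].
move=> /segmentP[c /andP[c0 c1] ->]; apply/segmentP; exists (a + c * (b - a)).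
  have h1 : 0 <= c * b by rewrite mulr_ge0.
  have h2 : 0 <= (1 - c) * a by rewrite mulr_ge0//; lra.
  have h3 : c * b <= c * 1 by apply: ler_wpM2l.
  have h4 : (1 - c) * a <= (1 - c) * 1 by apply: ler_wpM2l => //; lra.
  by apply/andP; split; lra.
by rewrite opprD addrACA subrr add0r -scalerBl scalerA -addrA -scalerDl.
Qed.

Lemma segment_shift (u v u' v' z : 'rV[R]_d) a : segment u v z ->
  `|u - u'| <= a -> `|v - v'| <= a -> exists2 z', segment u' v' z' & `|z - z'| <= a.
Proof.
move=> [c]; rewrite /= in_itv /= => /andP[c0 c1] <- uu vv.
exists (c *: u' + (1 - c) *: v'); first by exists c; rewrite //= in_itv /= c0.
rewrite opprD addrACA -!scalerBr.
apply: (le_trans (ler_normD _ _)); rewrite !normrZ ger0_norm// ger0_norm; last by lra.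
have h1 := ler_wpM2l c0 uu.
have h2 : (1 - c) * `|v - v'| <= (1 - c) * a by apply: ler_wpM2l => //; lra.
lra.
Qed.

(** An M2 embedding may run along the segment of a time step in any way, jumps
included, but it starts at y k and ends at y (k + 1). At the infimum of the
times at which it has passed w, its completed graph contains w up to an
arbitrarily small error. *)
Lemma segment_crossing a n k y x w : 0 < a -> (k.+1 < n)%N -> is_embedding M2 n y x ->
  segment (y k) (y k.+1) w -> exists2 t, k%:R / n%:R <= t <= k.+1%:R / n%:R &
    close_to a (complete_graph x) w t.
Proof.
move=> a0 kn Hx /segmentP[c /andP[c0 c1] ->]; have kn' := ltnW kn.
have n0 : 0 < n%:R :> R by rewrite ltr0n; case: (n) kn.
have [xk _] := Hx k kn'; have [xk1 _] := Hx _ kn.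
set p := k%:R / n%:R : R; set q := k.+1%:R / n%:R : R.
have p0 : 0 <= p by rewrite divr_ge0.
have pq : p < q by rewrite ltr_pM2r ?invr_gt0// ltr_nat.
have q1 : q < 1 by rewrite ltr_pdivrMr// mul1r ltr_nat.
pose v := y k.+1 - y k.
have onseg t : p <= t <= q -> exists2 b, 0 <= b <= 1 & x t = y k + b *: v.
  move=> /andP[t1]; rewrite le_eqVlt => /predU1P[->|t2].
    by exists 1; rewrite ?lexx ?ler01// xk1 scale1r addrC subrK.
  by apply/segmentP; apply: (M2_embeddingE Hx kn'); rewrite -/p t1.
have [v0|v0] := eqVneq v 0.
  exists p; first by rewrite lexx ltW.
  exists (x p), p; split.
  - by apply: complete_graph_path; apply/andP; split; lra.
  - by rewrite -/v v0 scaler0 addr0 -xk subrr normr0 ltW.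
  - by rewrite subrr normr0 ltW.
have [i vi] : exists i, v ord0 i != 0.
  apply: contrapT => none; case/eqP: v0; apply/rowP => i; rewrite [RHS]mxE.
  by apply: contrapT => /eqP vi; apply: none; exists i.
(* the position of x t on the segment, read off a coordinate that is not
constant along it *)
pose th t := (x t - y k) ord0 i / v ord0 i.
have thE t : p <= t <= q -> x t = y k + th t *: v /\ 0 <= th t <= 1.
  move=> /onseg[b b01 xE]; suff thb : th t = b by rewrite thb.
  by rewrite /th xE addrC addKr mxE mulfK.
pose T := [set t | p <= t <= q /\ c <= th t].
have thp : th p = 0 by rewrite /th xk subrr mxE mul0r.
have thq : th q = 1 by rewrite /th xk1 -/v divff.
have Tq : T q by split; [rewrite lexx ltW|rewrite thq].
have infT : has_inf T by split; [exists q|exists p => t [/andP[]]].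
pose t := inf T.
have pt : p <= t by apply: lb_le_inf; [exists q|move=> s [/andP[]]].
have tq : t <= q by apply: ge_inf => //; case: infT.
have ct : c <= th t.
  rewrite leNgt; apply/negP => thc.
  pose e := (c - th t) / 2 * `|v ord0 i|.
  have e0 : 0 < e by rewrite mulr_gt0 ?normr_gt0//; lra.
  have [h h0 Hh] := skorokhod_near_right x (le_trans p0 pt) e0.
  have [s [/andP[ps sq] cs] sh] := inf_adherent h0 infT.
  have ts : t <= s by apply: ge_inf; [case: infT|split; rewrite ?ps].
  have := le_trans (coord_le_norm _ i) (Hh s (introT andP (conj ts sh))).
  have -> : (x s - x t) ord0 i = (th s - th t) * v ord0 i.
    have [xs _] := thE s (introT andP (conj ps sq)).
    have [xt _] := thE t (introT andP (conj pt tq)).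
    by rewrite {1}xs {1}xt opprD addrACA subrr add0r -scalerBl mxE.
  rewrite normrM ler_pM2r ?normr_gt0// => /(le_trans (ler_norm _)); lra.
exists t; first by rewrite pt.
have [tp|tp] := eqVneq t p.
  have -> : c = 0 by move: ct; rewrite tp thp; lra.
  exists (x t), t; split.
  - by apply: complete_graph_path; apply/andP; split; lra.
  - by rewrite scale0r addr0 -xk tp subrr normr0 ltW.
  - by rewrite subrr normr0 ltW.
have pt' : p < t by rewrite lt_neqAle eq_sym tp.
have t01 : 0 < t <= 1 by apply/andP; split; lra.
have [s [s0 /andP[ps st] _ xs]] := left_lim_approx x t01 a0 pt'.
have psq : p <= s <= q by apply/andP; split; lra.
have ths : th s < c.
  rewrite ltNge; apply/negP => cs.
  have : t <= s by apply: ge_inf; [case: infT|].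
  by rewrite leNgt st.
have [xsE _] := thE s psq.
have [xtE _] := thE t (introT andP (conj pt tq)).
have seg : segment (x s) (x t) (y k + c *: v).
  apply/segmentP; exists ((c - th s) / (th t - th s)).
    have den : 0 < th t - th s by lra.
    by rewrite divr_ge0 /= ?ler_pdivrMr ?mul1r//; lra.
  have -> : x t - x s = (th t - th s) *: v.
    by rewrite {1}xsE {1}xtE opprD addrACA subrr add0r -scalerBl.
  rewrite scalerA {1}xsE -addrA -scalerDl; congr (_ + _ *: _).
  by field; lra.
have xtt : `|x t - x t| <= a by rewrite subrr normr0 ltW.
have [z' z'seg zz'] := segment_shift seg xs xtt.
exists z', t; split=> //.
- by split=> //=; apply/andP; split; lra.
- by rewrite subrr normr0 ltW.
Qed.

(** A left limit of x is replaced by a value taken shortly before, which lies on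
the segment of the current time step; hence the error a. *)
Lemma M2_graph_segment a n y x z t : 0 < a -> (0 < n)%N -> is_embedding M2 n y x ->
  complete_graph x (z, t) -> exists k z', [/\ (k < n)%N,
    k%:R / n%:R <= t <= k.+1%:R / n%:R, segment (y k) (y k.+1) z' & `|z - z'| <= a].
Proof.
move=> a0 n0 Hx [/= t01 zs]; have [u0 un] := uniform_grid R n0.
have n0' : 0 < n%:R :> R by rewrite ltr0n.
have /andP[t0 t1] := t01.
move: t0; rewrite le_eqVlt => /predU1P[t0|t0].
  exists 0%N, z; split; rewrite ?subrr ?normr0 ?(ltW a0)//.
    by rewrite -t0 u0 lexx divr_ge0.
  move: zs; rewrite -t0 left_lim0 => /segmentP[c _ ->].
  rewrite subrr scaler0 addr0; have [] := Hx 0%N n0; rewrite u0 => -> _.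
  exact: segment_l.
have t01' : 0 < t <= 1 by rewrite t0.
have [k kn /andP[kt tk]] := grid_cell_left (tau := fun k => k%:R / n%:R) u0 un t01'.
have [s [s0 /andP[ks st] _ xs]] := left_lim_approx x t01' a0 kt.
have [z' z's zz'] : exists2 z', segment (x s) (x t) z' & `|z - z'| <= a.
  by apply: (segment_shift zs); rewrite ?subrr ?normr0 ?(ltW a0)// distrC.
have xsseg : segment (y k) (y k.+1) (x s).
  by apply: (M2_embeddingE Hx kn); rewrite (ltW ks) (lt_le_trans st).
have [t1'|t1'] := ltP t 1; last first.
  have tE : t = 1 by lra.
  exists k, (x s); split=> //; first by rewrite tk ltW.
  move: zs; rewrite tE left_lim1 => /segmentP[c _ ->].
  by rewrite subrr scaler0 addr0 distrC -left_lim1 -tE.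
exists k, z'; split=> //; first by rewrite tk ltW.
apply: segment_convex z's => //.
move: tk; rewrite le_eqVlt => /predU1P[tE|tk]; last first.
  by apply: (M2_embeddingE Hx kn); rewrite (ltW kt).
have k1n : (k.+1 < n)%N.
  by move: t1'; rewrite tE ltr_pdivrMr// mul1r ltr_nat.
by rewrite tE; have [-> _] := Hx _ k1n; exact: segment_r.
Qed.

(** When f jumps at tau (k + 1), its completed graph contains a segment that
nearly joins y k to y (k + 1); the completed graph of x crosses the same segment
during the k-th time step. Between the times tau k, f is near one state. *)
Lemma distM2_embedding_le a n y f g x : (0 < n)%N -> n%:R^-1 <= a ->
  `|y n - y n.-1| <= a -> J1near a f g ->
  is_embedding J1 n y g -> is_embedding M2 n y x ->
  (distM2 f x <= (d.+1%:R * (4 * a))%:E)%E.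
Proof.
move=> n0 na ya fg Hg Hx.
have n0' : 0 < n%:R :> R by rewrite ltr0n.
have a0 : 0 < a by apply: lt_le_trans na; rewrite invr_gt0.
have [tau [tau0 taun tau_lt tau_near Hf]] := J1near_grid n0 Hg fg.
have [u0 un] := uniform_grid R n0.
have us := uniform_grid_step R n.
have tau01 := grid01 tau0 taun tau_lt.
have tau_ge0 k : (k <= n)%N -> 0 <= tau k by move=> /tau01/andP[].
have k01 k : (k < n)%N -> 0 <= (k%:R / n%:R : R) < 1.
  by move=> kn; rewrite divr_ge0//= ltr_pdivrMr// mul1r ltr_nat.
have xk k : (k < n)%N -> x (k%:R / n%:R) = y k by move=> /Hx[].
have time k t : (k < n)%N -> tau k <= t <= tau k.+1 -> `|t - k%:R / n%:R| <= 2 * a.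
  move=> kn /andP[? ?].
  have := tau_near k (ltnW kn); have := tau_near k.+1 kn; rewrite us.
  rewrite !ler_norml => /andP[? ?] /andP[? ?]; apply/andP; split; lra.
have leftf k t : (k < n)%N -> tau k < t <= tau k.+1 -> `|left_lim f t - y k| <= a.
  move=> kn tk; have /andP[_ ?] := tau01 _ kn; have /andP[_ ?] := tk.
  by apply: (grid_left_lim (tau := tau) (tau_ge0 k (ltnW kn)) _ tk) => [s|]; [exact: Hf|lra].
apply: hausdorff_dist_le; first by lra.
  move=> z t [/= t01 zs]; split=> //; have /andP[t0 t1] := t01.
  have atk k : (k < n)%N -> `|z - y k| <= a -> tau k <= t <= tau k.+1 ->
      close_to (4 * a) (complete_graph x) z t.
    move=> kn zk tk; exists (y k), (k%:R / n%:R); split.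
    - rewrite -xk//; apply: complete_graph_path.
      by have /andP[-> /ltW] := k01 k kn.
    - lra.
    - by have := time _ _ kn tk; lra.
  move: t1; rewrite le_eqVlt => /predU1P[t1|t1].
    have t01' : 0 < t <= 1 by rewrite t1 lexx ltr01.
    have [k kn tk] := grid_cell_left tau0 taun t01'.
    apply: (atk k kn); last by case/andP: tk => /ltW -> ->.
    apply: (segment_dist_le zs); first exact: leftf.
    by rewrite {1}t1 -left_lim1 -t1; exact: leftf.
  have t01' : 0 <= t < 1 by rewrite t0.
  have [k kn tk] := grid_cell_right tau0 taun t01'.
  have /andP[tk1 tk2] := tk.
  move: tk1; rewrite le_eqVlt => /predU1P[tE|tk1]; last first.
    apply: (atk k kn); last by rewrite (ltW tk1) ltW.
    apply: (segment_dist_le zs); last exact: Hf.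
    by apply: leftf => //; rewrite tk1 ltW.
  case: k kn tk tk2 tE => [|k] kn tk tk2 tE.
    have t00 : t = 0 by rewrite -tE tau0.
    apply: (atk 0%N kn); last by rewrite tE lexx ltW.
    move: zs; rewrite {1}t00 left_lim0 -t00 => /segmentP[c _ ->].
    by rewrite subrr scaler0 addr0; exact: Hf.
  have kn' := ltnW kn.
  have [||z' z's zz'] := segment_shift (u' := y k) (v' := y k.+1) (a := a) zs.
  - by apply: leftf => //; rewrite -tE lexx tau_lt.
  - exact: Hf.
  have [t' /andP[t'1 t'2] close] := segment_crossing a0 kn Hx z's.
  have -> : 4 * a = a + 3 * a by lra.
  apply: (close_to_trans close); first by lra.
  rewrite us in t'2; have := time k t kn'; rewrite -tE lexx.
  rewrite (ltW (tau_lt _ _ _ _))// => /(_ isT).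
  by rewrite !ler_norml => /andP[? ?]; apply/andP; split; lra.
move=> z t Hz; split; first by case: Hz.
have [k [z' [kn /andP[tk1 tk2] z's zz']]] := M2_graph_segment a0 n0 Hx Hz.
rewrite us in tk2.
have [k1n|nk1] := ltnP k.+1 n; last first.
  have nE : n = k.+1 by apply/eqP; rewrite eqn_leq nk1 kn.
  exists (f (tau k)), (tau k); split.
  - by apply: complete_graph_path; rewrite tau01// ltnW.
  - have h1 : `|f (tau k) - y k| <= a by apply: Hf; rewrite // lexx tau_lt.
    have h2 : `|z' - y k| <= a.
      apply: (segment_dist_le z's); first by rewrite subrr normr0 ltW.
      by move: ya; rewrite nE.
    have -> : z - f (tau k) = (z - z') + (z' - y k) - (f (tau k) - y k).
      by rewrite addrA subrK opprB addrA subrK.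
    apply: (le_trans (ler_normB _ _)).
    by have := ler_normD (z - z') (z' - y k); lra.
  - have := tau_near k (ltnW kn); rewrite !ler_norml => /andP[? ?].
    by apply/andP; split; lra.
have [||w ws zw] := segment_shift (u' := left_lim f (tau k.+1)) (v' := f (tau k.+1)) (a := a) z's.
- by rewrite distrC; apply: leftf => //; rewrite lexx tau_lt.
- by rewrite distrC; apply: Hf => //; rewrite lexx tau_lt.
exists w, (tau k.+1); split.
- by split=> //=; rewrite tau01// ltnW.
- have -> : z - w = (z - z') + (z' - w) by rewrite addrA subrK.
  by apply: (le_trans (ler_normD _ _)); lra.
- have := tau_near k.+1 kn; rewrite us !ler_norml => /andP[? ?].
  by apply/andP; split; lra.
Qed.

Lemma J1_embedding_inj n y g x : (0 < n)%N -> is_embedding J1 n y g ->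
  is_embedding J1 n y x -> forall t, 0 <= t <= 1 -> x t = g t.
Proof.
move=> n0 Hg Hx.
have main t : 0 <= t < 1 -> x t = g t.
  move=> t01; have [k kn tk] := grid_index n0 t01.
  by rewrite (J1_embeddingE Hg kn tk) (J1_embeddingE Hx kn tk).
move=> t /andP[t0]; rewrite le_eqVlt => /predU1P[->|t1]; last by apply: main; rewrite t0.
apply/eqP; rewrite -subr_eq0 -normr_le0 -left_lim1; apply/ler_addgt0Pl => e e0.
rewrite addr0.
have [h h0 Hh] := @skorokhod_near_left _ _ g 1 e (introT andP (conj ler01 (lexx _))) e0.
apply: (@left_lim_dist_le _ _ x 1 _ _ (Num.min h 1)).
- by rewrite ltr01 lexx.
- by rewrite lt_min h0 ltr01.
- move=> s /andP[s1 s2]; have : 1 - h < s.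
    by apply: le_lt_trans s1; rewrite lerD2l lerN2 ge_min lexx.
  have s0 : 0 <= s.
    apply: le_trans (ltW s1); rewrite subr_ge0 ge_min lexx orbT//.
  by rewrite main ?s0// -left_lim1 => s3; apply: Hh; rewrite s3.
Qed.

Lemma distJ1_embedding_le a n y f g x : (0 < n)%N -> J1near a f g ->
  is_embedding J1 n y g -> is_embedding J1 n y x ->
  (distJ1 f x <= (d.+1%:R * a)%:E)%E.
Proof.
move=> n0 [l [m [lm H]]] Hg Hx; apply: J1near_dist; exists l, m; split=> // t t01.
by rewrite (J1_embedding_inj n0 Hg Hx t01); exact: H.
Qed.

End EmbeddingsM2.

(** * Clocks that stop at countably many instants *)

Section Mass.
Variable R : realType.
Implicit Types (b c : nat -> bool) (N j : nat).

Definition weight j : R := 2^-1 ^+ j.+1.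

Definition partial_mass b N : R := \sum_(j < N) weight j * (b j)%:R.

(** The total weight of the indices selected by b. The series is handled through
its partial sums, with the explicit remainder 2 ^ - N of mass_bracket. *)
Definition mass b : R := sup [set partial_mass b N | N in [set: nat]].

Lemma weight_gt0 j : 0 < weight j.
Proof. by rewrite exprn_gt0// invr_gt0. Qed.

Lemma partial_mass_tail b N M : (N <= M)%N ->
  partial_mass b N <= partial_mass b M <= partial_mass b N + (2^-1 ^+ N - 2^-1 ^+ M).
Proof.
move=> NM; rewrite -(subnKC NM); elim: (M - N)%N => [|k /andP[IH1 IH2]].
  by rewrite addn0 subrr addr0 lexx.
rewrite addnS /partial_mass big_ord_recr /= -!/(partial_mass b _).
have e : (2^-1 : R) ^+ (N + k) = weight (N + k) + weight (N + k).
  by rewrite /weight exprS; set z := _ ^+ (N + k); lra.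
have h : 0 <= weight (N + k) * (b (N + k)%N)%:R <= weight (N + k).
  by case: (b _); rewrite /= ?mulr1 ?mulr0 ?lexx ltW ?weight_gt0.
have e' : (2^-1 : R) ^+ (N + k).+1 = weight (N + k) by [].
rewrite e'; move: e h IH1 IH2 => -> /andP[? ?] ? ?; apply/andP; split; lra.
Qed.

Lemma mass_bracket b N : partial_mass b N <= mass b <= partial_mass b N + 2^-1 ^+ N.
Proof.
have ub M : partial_mass b M <= partial_mass b N + 2^-1 ^+ N.
  have [MN|/ltnW NM] := leqP M N.
    have /andP[h _] := partial_mass_tail b MN; apply: (le_trans h).
    by rewrite lerDl exprn_ge0// invr_ge0.
  have /andP[_ h] := partial_mass_tail b NM; apply: (le_trans h).
  have : 0 <= (2^-1 : R) ^+ M by rewrite exprn_ge0// invr_ge0.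
  lra.
apply/andP; split.
  apply: ub_le_sup; last by exists N.
  by exists (partial_mass b N + 2^-1 ^+ N) => _ [M _ <-].
apply: ge_sup; first by exists (partial_mass b 0%N); exists 0%N.
by move=> _ [M _ <-].
Qed.

Lemma half_small (e : R) : 0 < e -> exists N, 2^-1 ^+ N < e.
Proof.
move=> e0; have := @cvg_geometric R 1 2^-1.
rewrite ger0_norm ?invr_ge0// invf_lt1 ?ltr1n// => /(_ isT).
move=> /cvgrPdist_lt /(_ e e0)[N _ /(_ N (leqnn N))].
by rewrite /= /geometric /= mul1r sub0r normrN ger0_norm ?exprn_ge0 ?invr_ge0//; exists N.
Qed.

Lemma le_half (x z : R) : (forall N, x <= z + 2^-1 ^+ N) -> x <= z.
Proof.
move=> H; apply/ler_addgt0Pl => e /half_small[N hN].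
by apply: (le_trans (H N)); rewrite addrC lerD2r ltW.
Qed.

Lemma mass_add b c j : (forall i, b i -> c i) -> ~~ b j -> c j ->
  mass b + weight j <= mass c.
Proof.
move=> bc nbj cj; apply: le_half => N; pose M := maxn N j.+1.
have jM : (j < M)%N by rewrite leq_max leqnn orbT.
have /andP[_ h1] := mass_bracket b M; have /andP[h2 _] := mass_bracket c M.
have h3 : partial_mass b M + weight j <= partial_mass c M.
  rewrite /partial_mass (bigD1 (Ordinal jM))//= (negbTE nbj) mulr0 add0r.
  rewrite [leRHS](bigD1 (Ordinal jM))//= cj mulr1 addrC lerD2r.
  apply: ler_sum => i _; rewrite ler_pM2l ?weight_gt0// ler_nat.
  by case: (b i) (bc i) => // ->.
have h4 : (2^-1 : R) ^+ M <= 2^-1 ^+ N.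
  by rewrite ler_wiXn2l ?invr_ge0// ?invf_le1// ?ler1n// leq_max leqnn.
lra.
Qed.

Lemma mass_agree b c N : (forall j, (j < N)%N -> b j -> c j) ->
  mass b <= mass c + 2^-1 ^+ N.
Proof.
move=> bc; have /andP[_ h1] := mass_bracket b N; have /andP[h2 _] := mass_bracket c N.
apply: (le_trans h1); rewrite lerD2r; apply: le_trans h2.
apply: ler_sum => i _; rewrite ler_pM2l ?weight_gt0// ler_nat.
by case: (b i) (bc i (ltn_ord i)) => // ->.
Qed.

Lemma mass_le b c : (forall j, b j -> c j) -> mass b <= mass c.
Proof. by move=> bc; apply: le_half => N; apply: mass_agree => j _; exact: bc. Qed.

Lemma mass_ge0 b : 0 <= mass b.
Proof. by have /andP[+ _] := mass_bracket b 0; rewrite /partial_mass big_ord0. Qed.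

Lemma mass_pred0 b : (forall j, ~~ b j) -> mass b = 0.
Proof.
move=> b0; apply/eqP; rewrite eq_le mass_ge0 andbT; apply: le_half => N.
have /andP[_ h] := mass_bracket b N; apply: (le_trans h); rewrite lerD2r.
by rewrite /partial_mass big1// => i _; rewrite (negbTE (b0 i)) mulr0.
Qed.

(** The left and right values of a strictly increasing function of time: while
the parameter runs through [lo t, hi t] the clock rests at t. By the last
condition the parameters skip nothing, so that the inverse of the clock is
defined everywhere. *)
Definition split_clock (lo hi : R -> R) :=
  [/\ lo 0 = 0, forall t, lo t <= hi t,
      forall s t, s < t -> hi s + (t - s) <= lo t &
      forall s, 0 <= s <= hi 1 -> exists2 t, 0 <= t <= 1 & lo t <= s <= hi t].

(** Add to t the total weight of the listed instants before t, respectively up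
to t, the j-th one having weight 2 ^ - (j + 1). Each listed instant then
occupies an interval of positive length. The time of a given parameter s is the
supremum of the times t with lo t <= s; that it works follows from the fact that
up to 2 ^ - N only finitely many instants count. *)
Lemma split_clock_exists (p : nat -> R) : (forall j, 0 <= p j) ->
  exists lo hi, split_clock lo hi /\ forall j, lo (p j) < hi (p j).
Proof.
move=> p0; pose lo t := t + mass (fun j => p j < t).
pose hi t := t + mass (fun j => p j <= t).
have lohi t : lo t <= hi t by rewrite lerD2l; apply: mass_le => j /ltW.
have hilo s t : s < t -> hi s + (t - s) <= lo t.
  move=> st; rewrite /hi addrAC [s + _]addrC subrK lerD2l.
  by apply: mass_le => j /le_lt_trans; apply.
have lo0 : lo 0 = 0.
  by rewrite /lo add0r mass_pred0// => j; rewrite -leNgt.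
have gap N t : exists2 h, 0 < h & forall j, (j < N)%N -> p j != t -> h <= `|p j - t|.
  elim: N => [|N [h h0 H]]; first by exists 1.
  have [pt|pt] := eqVneq (p N) t.
    exists h => // j; rewrite ltnS leq_eqVlt => /predU1P[->|/H//].
    by rewrite pt eqxx.
  exists (Num.min h `|p N - t|); first by rewrite lt_min h0 normr_gt0 subr_eq0.
  move=> j; rewrite ltnS leq_eqVlt ge_min => /predU1P[->|/H jN /jN ->//].
  by rewrite lexx orbT.
exists lo, hi; split; last first.
  move=> j; rewrite ltrD2l.
  have := @mass_add (fun i => p i < p j) (fun i => p i <= p j) j.
  rewrite ltxx lexx => /(_ (fun i => @ltW _ _ _ _) isT isT).
  by apply: lt_le_trans; rewrite ltrDl; exact: weight_gt0.
split=> // s /andP[s0 s1].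
pose T := [set t | 0 <= t <= 1 /\ lo t <= s].
have T0 : T 0 by split; rewrite ?lexx ?ler01// lo0.
have supT : has_sup T by split; [exists 0|exists 1 => t [/andP[]]].
pose t := sup T.
have t0 : 0 <= t by apply: ub_le_sup => //; case: supT.
have t1 : t <= 1 by apply: ge_sup; [exists 0|move=> u [/andP[]]].
have lomono u v : u <= v -> lo u <= lo v.
  rewrite le_eqVlt => /predU1P[->//|uv].
  by have := hilo _ _ uv; have := lohi u; lra.
exists t; first by rewrite t0.
apply/andP; split.
  rewrite leNgt; apply/negP => st.
  have e0 : 0 < (lo t - s) / 2 by lra.
  have [N hN] := half_small e0.
  have [h h0 Hh] := gap N t.
  have m0 : 0 < Num.min h ((lo t - s) / 2) by rewrite lt_min h0.
  have [u [u01 us] ut] := sup_adherent m0 supT.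
  have uh : t - h < u by apply: le_lt_trans ut; rewrite lerD2l lerN2 ge_min lexx.
  have ue : t - (lo t - s) / 2 < u.
    by apply: le_lt_trans ut; rewrite lerD2l lerN2 ge_min lexx orbT.
  have agree : mass (fun j => p j < t) <= mass (fun j => p j < u) + 2^-1 ^+ N.
    apply: mass_agree => j jN pt; have := Hh j jN; rewrite lt_eqF// => /(_ isT).
    by rewrite ltr0_norm ?subr_lt0//; lra.
  by move: us e0; rewrite /lo in ue hN st * => *; lra.
rewrite leNgt; apply/negP => ts.
have tlt1 : t < 1.
  by rewrite lt_neqAle t1 andbT; apply/eqP => tE; move: ts; rewrite tE ltNge s1.
have e0 : 0 < (s - hi t) / 2 by lra.
have [N hN] := half_small e0.
have [h h0 Hh] := gap N t.
pose e := Num.min (Num.min h ((s - hi t) / 2)) (1 - t).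
have e'0 : 0 < e by rewrite /e !lt_min h0 e0 subr_gt0 tlt1.
have [eh es et] : [/\ e <= h, e <= (s - hi t) / 2 & e <= 1 - t].
  by rewrite /e !ge_min !lexx !orbT.
pose u := t + e / 2.
have : T u.
  split; first by rewrite /u; apply/andP; split; lra.
  have agree : mass (fun j => p j < u) <= mass (fun j => p j <= t) + 2^-1 ^+ N.
    apply: mass_agree => j jN pu; rewrite leNgt; apply/negP => tp.
    have := Hh j jN; rewrite gt_eqF// gtr0_norm ?subr_gt0// => /(_ isT).
    by move: pu; rewrite /u; lra.
  by move: es hN; rewrite /hi /lo {1}/u => *; lra.
have tu : t < u by rewrite /u; lra.
by move=> Tu; have := ub_le_sup (proj2 supT) Tu; rewrite leNgt tu.
Qed.

End Mass.

(** * Parametrization of a completed graph by a clock *)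

Section UnitContinuity.
Variable R : realType.
Implicit Types (s t e h : R).

Definition unit_continuous (V : normedModType R) (u : R -> V) := forall s e,
  0 <= s <= 1 -> 0 < e -> exists2 h, 0 < h &
    forall t, 0 <= t <= 1 -> `|s - t| < h -> `|u s - u t| <= e.

Lemma unit_continuous_within (V : normedModType R) (u : R -> V) :
  unit_continuous u -> {within `[0, 1], continuous u}.
Proof.
move=> H; apply/subspace_continuousP => s; rewrite /= in_itv /= => s01.
apply/cvgrPdist_le => e e0; have [h h0 Hh] := H s e s01 e0.
rewrite near_withinE; apply: filterS (nbhsx_ballx s h h0) => t.
by rewrite /ball /= in_itv /= => st t01; exact: Hh.
Qed.

Lemma unit_continuous_sum (V : normedModType R) n (u : nat -> R -> V) :
  (forall i, (i < n)%N -> unit_continuous (u i)) ->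
  unit_continuous (fun s => \sum_(i < n) u i s).
Proof.
elim: n => [|n IH] H s e s01 e0.
  by exists 1 => // t _ _; rewrite !big_ord0 subrr normr0 ltW.
have e2 : 0 < e / 2 by lra.
have [h h0 Hh] := IH (fun i ni => H i (ltnW ni)) s _ s01 e2.
have [k k0 Hk] := H n (leqnn _) s _ s01 e2.
exists (Num.min h k); first by rewrite lt_min h0.
move=> t t01; rewrite lt_min => /andP[sh sk]; rewrite !big_ord_recr /= opprD addrACA.
apply: (le_trans (ler_normD _ _)).
by have := Hh t t01 sh; have := Hk t t01 sk; lra.
Qed.

Lemma unit_lipschitz (V : normedModType R) (u : R -> V) (c : R) : 0 <= c ->
  (forall s t, 0 <= s <= 1 -> 0 <= t <= 1 -> `|u s - u t| <= c * `|s - t|) ->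
  unit_continuous u.
Proof.
move=> c0 H s e s01 e0; exists (e / (c + 1)); first by rewrite divr_gt0//; lra.
move=> t t01; rewrite ltr_pdivlMr; last lra.
by have := H s t s01 t01; have : 0 <= `|s - t| by []; lra.
Qed.

Lemma unit_continuous_comp (V : normedModType R) (u : R -> V) (r : R -> R) :
  (forall t, 0 <= t <= 1 -> 0 <= r t <= 1) ->
  unit_continuous r -> unit_continuous u -> unit_continuous (u \o r).
Proof.
move=> r1 Hr Hu s e s01 e0; have [h h0 Hh] := Hu _ _ (r1 s s01) e0.
have [k k0 Hk] := Hr s (h / 2) s01 (divr_gt0 h0 (ltr0Sn _ _)).
exists k => // t t01 st; apply: Hh; first exact: r1.
by have := Hk t t01 st; lra.
Qed.

Definition ramp (lo hi s : R) := Num.max 0 (Num.min 1 ((s - lo) / (hi - lo))).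

Lemma ramp01 lo hi s : 0 <= ramp lo hi s <= 1.
Proof. by rewrite /ramp le_max lexx ge_max ler01 ge_min lexx. Qed.

Lemma ramp_le lo hi s : lo < hi -> s <= lo -> ramp lo hi s = 0.
Proof.
move=> lh sl; have h : (s - lo) / (hi - lo) <= 0.
  by rewrite ler_pdivrMr ?subr_gt0// mul0r subr_le0.
by rewrite /ramp (min_idPr _) ?(max_idPl _)//; lra.
Qed.

Lemma ramp_ge lo hi s : lo < hi -> hi <= s -> ramp lo hi s = 1.
Proof.
move=> lh sl; have h : 1 <= (s - lo) / (hi - lo).
  by rewrite ler_pdivlMr ?subr_gt0// mul1r; lra.
by rewrite /ramp (min_idPl _) ?(max_idPr _)//; lra.
Qed.

Lemma ramp_mid lo hi s : lo < hi -> lo <= s <= hi ->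
  ramp lo hi s = (s - lo) / (hi - lo).
Proof.
move=> lh /andP[ls sh].
have h : (s - lo) / (hi - lo) <= 1 by rewrite ler_pdivrMr ?subr_gt0// mul1r; lra.
have h' : 0 <= (s - lo) / (hi - lo) by rewrite divr_ge0; lra.
by rewrite /ramp (min_idPr _) ?(max_idPr _).
Qed.

Lemma ramp_mono lo hi s t : lo < hi -> s <= t -> ramp lo hi s <= ramp lo hi t.
Proof.
move=> lh st; have h : (s - lo) / (hi - lo) <= (t - lo) / (hi - lo).
  by rewrite ler_pM2r ?invr_gt0 ?subr_gt0//; lra.
rewrite /ramp; move: h; set a := _ / _; set b := _ / _ => h.
by rewrite /Num.max /Num.min; do 4 case: ifPn => //; rewrite -?leNgt => *; lra.
Qed.

Lemma ramp_lip lo hi s t : lo < hi ->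
  `|ramp lo hi s - ramp lo hi t| <= (hi - lo)^-1 * `|s - t|.
Proof.
move=> lh; wlog st : s t / s <= t.
  by move=> H; have [/H//|/ltW/H] := leP s t; rewrite distrC (distrC t).
have h : (t - lo) / (hi - lo) = (s - lo) / (hi - lo) + (hi - lo)^-1 * (t - s).
  by field; lra.
have h0 : 0 <= (hi - lo)^-1 * (t - s) by rewrite mulr_ge0 ?invr_ge0; lra.
have := ramp_mono lh st; rewrite distrC => m.
rewrite ger0_norm ?subr_ge0// distrC ger0_norm ?subr_ge0//.
rewrite /ramp h; move: h0; set a := _ / _; set b := _ * _ => b0.
by rewrite /Num.max /Num.min; do 4 case: ifPn => //; rewrite -?leNgt => *; lra.
Qed.

End UnitContinuity.

Section Parametrize.
Variables (R : realType) (d : nat).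
Implicit Types (f g x : skorokhod R d) (t s e c : R) (lo hi r : R -> R).

(** The fraction of the rest of the clock at time t that has elapsed at
parameter s; this is 0 if there is no rest, division by 0 giving 0. *)
Definition jump_frac lo hi t s := (s - lo t) / (hi t - lo t).

(** An increasing bijection l of [0, 1], given together with its inverse m,
which makes symmetry and composition immediate. *)
Definition clock_inverse lo hi r := forall s, 0 <= s <= 1 ->
  0 <= r s <= 1 /\ lo (r s) <= hi 1 * s <= hi (r s).

Definition resolves_jumps f lo hi := forall t, 0 <= t <= 1 ->
  left_lim f t != f t -> lo t < hi t.

(** An increasing bijection l of [0, 1], given together with its inverse m,
which makes symmetry and composition immediate. *)
(** The parametrization follows f and, while the clock rests at a jump, runs
along the segment of the jump at constant speed. *)
Definition clock_path f lo hi r s := left_lim f (r s) +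
  jump_frac lo hi (r s) (hi 1 * s) *: (f (r s) - left_lim f (r s)).

Lemma clock_length_gt0 lo hi : split_clock lo hi -> 0 < hi 1.
Proof.
move=> clk.
have [lo0 lohi hilo _] := clk.
by have := hilo _ _ ltr01; have := lohi 1; have := lohi 0; lra.
Qed.

Lemma clock_frac01 lo hi r s : split_clock lo hi -> clock_inverse lo hi r ->
  0 <= s <= 1 -> 0 <= jump_frac lo hi (r s) (hi 1 * s) <= 1.
Proof.
move=> clk Hr.
have [lo0 lohi hilo _] := clk.
move=> s01; have [_ /andP[h1 h2]] := Hr _ s01; rewrite /jump_frac.
have [E|NE] := eqVneq (hi (r s) - lo (r s)) 0; first by rewrite E invr0 mulr0 lexx ler01.
have h : 0 < hi (r s) - lo (r s) by rewrite lt_neqAle eq_sym NE subr_ge0 lohi.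
by rewrite divr_ge0 ?ler_pdivrMr ?mul1r; lra.
Qed.

Lemma clock_path_segment f lo hi r s : split_clock lo hi -> clock_inverse lo hi r ->
  0 <= s <= 1 -> segment (left_lim f (r s)) (f (r s)) (clock_path f lo hi r s).
Proof.
move=> clk Hr s01; apply/segmentP; exists (jump_frac lo hi (r s) (hi 1 * s)) => //.
exact: clock_frac01.
Qed.

Lemma clock_inverse_mono lo hi r s s' : split_clock lo hi -> clock_inverse lo hi r ->
  0 <= s <= 1 -> 0 <= s' <= 1 -> s <= s' -> r s <= r s'.
Proof.
move=> clk Hr; have [lo0 lohi hilo _] := clk; have W0 := clock_length_gt0 clk.
move=> s01 s'01 ss; rewrite leNgt; apply/negP => lt.
have := hilo _ _ lt; have := ler_wpM2l (ltW W0) ss.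
by have [_ /andP[h1 _]] := Hr _ s01; have [_ /andP[_ h2]] := Hr _ s'01; lra.
Qed.

Lemma clock_inverse_lip lo hi r s s' : split_clock lo hi -> clock_inverse lo hi r ->
  0 <= s <= 1 -> 0 <= s' <= 1 ->
  `|r s - r s'| <= hi 1 * `|s - s'|.
Proof.
move=> clk Hr; have [lo0 lohi hilo _] := clk; have W0 := clock_length_gt0 clk.
move=> s01 s'01; wlog ss : s s' s01 s'01 / s <= s'.
  by move=> H; have [/H->//|/ltW/H] := leP s s'; rewrite distrC (distrC s') => ->.
have rm := clock_inverse_mono clk Hr s01 s'01 ss.
rewrite distrC ger0_norm ?subr_ge0// distrC ger0_norm ?subr_ge0//.
move: rm; rewrite le_eqVlt => /predU1P[->|/hilo].
  by rewrite subrr mulr_ge0 ?(ltW W0)// subr_ge0.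
have [_ /andP[_ h1]] := Hr _ s01; have [_ /andP[h2 _]] := Hr _ s'01.
by rewrite mulrBr; lra.
Qed.

Lemma dist_le_halves (u v w : 'rV[R]_d) e :
  `|u - w| <= e / 2 -> `|v - w| <= e / 2 -> `|u - v| <= e.
Proof.
by move=> uw vw; have := ler_distD w u v; rewrite (distrC w); lra.
Qed.

Lemma enorm_ray_le (p v : 'rV[R]_d) c e : 0 <= c -> c <= e ->
  enorm (p - (p + c *: v)) <= enorm (p - (p + e *: v)).
Proof.
move=> c0 ce; rewrite !opprD !addrA !subrr !sub0r -!scaleNr !enormZ !normrN.
by rewrite ler_wpM2r ?enorm_ge0// !ger0_norm//; lra.
Qed.

(** The length D of the rest at a time is known to be positive only if f jumps
by v != 0 there. *)
Lemma linear_modulus (v : 'rV[R]_d) (D W e : R) : 0 < W -> 0 < e ->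
  (v != 0 -> 0 < D) -> exists2 q, 0 < q &
    forall c, (v != 0 -> `|c * D| <= W * q) -> `|c *: v| <= e.
Proof.
move=> W0 e0 HD; have [->|v0] := eqVneq v 0.
  by exists 1 => // c _; rewrite scaler0 normr0 ltW.
have D0 := HD v0; have N0 : 0 < `|v| by rewrite normr_gt0.
exists (e * D / (W * `|v|)); first by rewrite divr_gt0 ?mulr_gt0.
move=> c /(_ isT); rewrite normrM (gtr0_norm D0) normrZ => H.
have : `|c| * D <= e / `|v| * D.
  apply: (le_trans H); rewrite le_eqVlt; apply/orP; left; apply/eqP.
  by field; rewrite !gt_eqF.
by rewrite ler_pM2r// ler_pdivlMr.
Qed.

Lemma graph_near_right f t t' z h e : 0 <= t ->
  (forall s, t <= s < t + h -> `|f s - f t| <= e) ->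
  t < t' < t + h -> t' <= 1 -> segment (left_lim f t') (f t') z -> `|z - f t| <= e.
Proof.
move=> t0 H /andP[tt' t'h] t'1 /segment_dist_le; apply.
  apply: (@left_lim_dist_le _ _ f t' _ _ (t' - t)).
  - by rewrite t'1 andbT; lra.
  - by lra.
  - by move=> s /andP[s1 s2]; apply: H; apply/andP; split; lra.
by apply: H; apply/andP; split; lra.
Qed.

Lemma graph_near_left f t t' z (v : 'rV[R]_d) h e : 0 <= t' ->
  (forall s, t - h < s < t -> `|f s - v| <= e) ->
  t - h < t' < t -> t' <= 1 -> segment (left_lim f t') (f t') z -> `|z - v| <= e.
Proof.
move=> t'0 H /andP[ht' t't] t'1 /segment_dist_le; apply; last first.
  by apply: H; rewrite ht'.
move: t'0; rewrite le_eqVlt => /predU1P[t'0|t'0].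
  by rewrite -t'0 left_lim0 t'0; apply: H; rewrite ht'.
apply: (@left_lim_dist_le _ _ f t' _ _ (h - (t - t'))).
- by rewrite t'1 andbT; lra.
- by lra.
- by move=> s /andP[s1 s2]; apply: H; apply/andP; split; lra.
Qed.

(** If the clock shows a later time at s', it has finished its rest at r s in
between, so that the path is near f (r s) at s as well as at s'; if it shows an
earlier time, the path is near the left limit at r s at both parameters; and
during a rest the path is linear. *)
Lemma clock_path_continuous f lo hi r : split_clock lo hi -> resolves_jumps f lo hi ->
  clock_inverse lo hi r -> unit_continuous (clock_path f lo hi r).
Proof.
move=> clk jumps Hr s e s01 e0.
have [_ _ hilo _] := clk; have W0 := clock_length_gt0 clk.
have e2 : 0 < e / 2 by lra.
have [t01 /andP[s1 s2]] := Hr _ s01; have /andP[t0 t1] := t01.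
have [h h0 Hh] := skorokhod_near_left f t01 e2.
have [k k0 Hk] := skorokhod_near_right f t0 e2.
have den : f (r s) - left_lim f (r s) != 0 -> 0 < hi (r s) - lo (r s).
  by move=> Jt; rewrite subr_gt0 jumps// eq_sym -subr_eq0.
have [q q0 Hq] := linear_modulus W0 e2 den.
exists (Num.min (Num.min h k / hi 1) q).
  by rewrite lt_min q0 divr_gt0// lt_min h0.
move=> s' s'01; rewrite lt_min ltr_pdivlMr// mulrC lt_min => /andP[/andP[sh sk] sq].
have [t'01 /andP[s'1 s'2]] := Hr _ s'01; have /andP[t'0 t'1] := t'01.
have rr := clock_inverse_lip clk Hr s01 s'01.
have u's := clock_path_segment f clk Hr s'01.
have {}sq : `|hi 1 * s - hi 1 * s'| <= hi 1 * q.
  by rewrite -mulrBr normrM gtr0_norm// ler_pM2l// ltW.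
have [tt|tt|tt] := ltgtP (r s) (r s').
- move: rr; rewrite ltr0_norm ?subr_lt0// => rr.
  have h1 : `|clock_path f lo hi r s' - f (r s)| <= e / 2.
    by apply: (graph_near_right t0 Hk _ t'1 u's); apply/andP; split; lra.
  have h2 : `|clock_path f lo hi r s - f (r s)| <= e / 2.
    rewrite distrC; have -> : f (r s) - clock_path f lo hi r s =
        (1 - jump_frac lo hi (r s) (hi 1 * s)) *: (f (r s) - left_lim f (r s)).
      by rewrite scalerBl scale1r opprD addrA.
    apply: Hq => Jt; have D := den Jt; have hl := hilo _ _ tt.
    rewrite mulrBl mul1r /jump_frac mulfVK ?gt_eqF//.
    move: sq; rewrite ltr0_norm; [|lra]; rewrite ger0_norm; lra.
  exact: dist_le_halves h2 h1.
- move: rr; rewrite gtr0_norm ?subr_gt0// => rr.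
  have h1 : `|clock_path f lo hi r s' - left_lim f (r s)| <= e / 2.
    by apply: (graph_near_left t'0 Hh _ t'1 u's); apply/andP; split; lra.
  have h2 : `|clock_path f lo hi r s - left_lim f (r s)| <= e / 2.
    rewrite /clock_path addrAC subrr add0r.
    apply: Hq => Jt; have D := den Jt; have hl := hilo _ _ tt.
    rewrite /jump_frac mulfVK ?gt_eqF//.
    move: sq; rewrite gtr0_norm; [|lra]; rewrite ger0_norm; lra.
  exact: dist_le_halves h2 h1.
- apply: (@le_trans _ _ (e / 2)); last by lra.
  rewrite /clock_path -tt opprD addrACA subrr add0r -scalerBl.
  apply: Hq => Jt; have D := den Jt.
  by rewrite /jump_frac -mulrBl mulfVK ?gt_eqF// opprB addrA subrK.
Qed.

Lemma clock_inverse_hits lo hi r t c : split_clock lo hi -> clock_inverse lo hi r ->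
  0 <= t <= 1 -> 0 <= c <= 1 -> exists2 s, 0 <= s <= 1 &
    r s = t /\ (lo t < hi t -> jump_frac lo hi t (hi 1 * s) = c).
Proof.
move=> clk Hr t01 /andP[c0 c1]; have [lo0 lohi hilo _] := clk.
have W0 := clock_length_gt0 clk.
have [lot0 hitW] : 0 <= lo t /\ hi t <= hi 1.
  have /andP[t0 t1] := t01; split.
    move: t0; rewrite le_eqVlt => /predU1P[<-|t0]; first by rewrite lo0.
    by have := hilo _ _ t0; have := lohi 0; lra.
  move: t1; rewrite le_eqVlt => /predU1P[->//|t1].
  by have := hilo _ _ t1; have := lohi 1; lra.
have D0 : 0 <= hi t - lo t by rewrite subr_ge0.
pose s := (lo t + c * (hi t - lo t)) / hi 1.
have WsE : hi 1 * s = lo t + c * (hi t - lo t) by rewrite mulrC mulfVK// gt_eqF.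
have cD0 : 0 <= c * (hi t - lo t) by rewrite mulr_ge0.
have cD1 : c * (hi t - lo t) <= hi t - lo t by rewrite -[leRHS]mul1r ler_wpM2r.
have s01 : 0 <= s <= 1.
  by rewrite -(@ler_pM2l _ (hi 1))// mulr0 -[X in _ && X](@ler_pM2l _ (hi 1))// mulr1 WsE; lra.
exists s => //; split; last first.
  by move=> lh; rewrite /jump_frac WsE addrAC subrr add0r mulfK// gt_eqF// subr_gt0.
have [_ /andP[h1 h2]] := Hr _ s01; rewrite WsE in h1 h2.
by case: (ltgtP (r s) t) => // lt; have := hilo _ _ lt; lra.
Qed.

Lemma clock_path_ray f lo hi r s s' : split_clock lo hi -> clock_inverse lo hi r ->
  0 <= s <= 1 -> s <= s' -> r s = r s' ->
  enorm (left_lim f (r s) - clock_path f lo hi r s) <=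
  enorm (left_lim f (r s') - clock_path f lo hi r s').
Proof.
move=> clk Hr s01 ss E; have [_ lohi _ _] := clk; have W0 := clock_length_gt0 clk.
rewrite /clock_path -E; apply: enorm_ray_le.
  by have /andP[] := clock_frac01 clk Hr s01.
by rewrite /jump_frac ler_wpM2r ?invr_ge0 ?subr_ge0// lerD2r ler_pM2l.
Qed.

Lemma clock_path_eq f lo hi r s t c (z : 'rV[R]_d) : resolves_jumps f lo hi ->
  0 <= t <= 1 -> r s = t -> (lo t < hi t -> jump_frac lo hi t (hi 1 * s) = c) ->
  z = left_lim f t + c *: (f t - left_lim f t) -> clock_path f lo hi r s = z.
Proof.
move=> jumps t01 rst sc ->; rewrite /clock_path rst; congr (_ + _).
have [->|Jt] := eqVneq (left_lim f t) (f t); first by rewrite subrr !scaler0.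
by rewrite sc// jumps.
Qed.

Lemma clock_parametrization f lo hi r : split_clock lo hi -> resolves_jumps f lo hi ->
  clock_inverse lo hi r -> parametrization f (clock_path f lo hi r) r.
Proof.
move=> clk jumps Hr; have [lo0 lohi hilo _] := clk; have W0 := clock_length_gt0 clk.
have r01 s : 0 <= s <= 1 -> 0 <= r s <= 1 by move=> /Hr[].
split.
- apply: unit_continuous_within; exact: clock_path_continuous.
- apply: (@unit_continuous_within _ R^o).
  apply: unit_lipschitz (ltW W0) _ => s t.
  exact: clock_inverse_lip clk Hr.
- move=> s s' s0 ss s'1.
  have s01 : 0 <= s <= 1 by apply/andP; split; lra.
  have s'01 : 0 <= s' <= 1 by apply/andP; split; lra.
  have := clock_inverse_mono clk Hr s01 s'01 ss; rewrite le_eqVlt => /predU1P[E|]; last by left.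
  by right; split; [exact: E|exact: clock_path_ray].
- apply/seteqP; split=> [_ [s + <-]|[z t] [/= t01 zs]].
    by rewrite /= in_itv /= => s01; split=> /=; [exact: r01|exact: clock_path_segment].
  have [c c01 zE] := (segmentP _ _ _).1 zs.
  have [s s01 [rst sc]] := clock_inverse_hits clk Hr t01 c01.
  exists s; first by rewrite /= in_itv.
  by rewrite (clock_path_eq jumps t01 rst sc zE) rst.
Qed.

Lemma clock_inverse_exists lo hi : split_clock lo hi -> exists r, clock_inverse lo hi r.
Proof.
move=> clk; have W0 := clock_length_gt0 clk; have [_ _ _ surj] := clk.
have /choice[r Hr] : forall s, exists t, 0 <= s <= 1 ->
    0 <= t <= 1 /\ lo t <= hi 1 * s <= hi t.
  move=> s; have [/andP[s0 s1]|sn] := boolP (0 <= s <= 1); last by exists 0.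
  have [|t t01 ts] := surj (hi 1 * s); last by exists t.
  by rewrite mulr_ge0 ?(ltW W0)//= -[leRHS]mulr1 ler_pM2l.
by exists r.
Qed.

End Parametrize.

(** * From the step embedding to the M1 embedding *)

Section EmbeddingsM1.
Variables (R : realType) (d : nat).
Implicit Types (f g x : skorokhod R d) (t s a b e c : R).
Implicit Types (n k : nat) (y : nat -> 'rV[R]_d).

Lemma M1_embeddingE n y x k t : is_embedding M1 n y x -> (k < n)%N ->
  k%:R / n%:R <= t <= k.+1%:R / n%:R ->
  x t = y k + (n%:R * t - k%:R) *: (y k.+1 - y k).
Proof.
move=> Hx kn /andP[t1 t2].
have n0 : 0 < n%:R :> R by rewrite ltr0n; case: (n) kn.
have nE : n%:R * (k%:R / n%:R) = k%:R :> R by rewrite mulrC mulfVK// gt_eqF.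
have [xk xt] := Hx k kn.
have inner s : k%:R / n%:R <= s < k.+1%:R / n%:R ->
    x s = y k + (n%:R * s - k%:R) *: (y k.+1 - y k).
  move=> /andP[s1 s2]; move: s1; rewrite le_eqVlt => /predU1P[<-|s1].
    by rewrite nE subrr scale0r addr0.
  by rewrite xt ?s1// mulrBr nE.
move: t2; rewrite le_eqVlt => /predU1P[tE|t2]; last by apply: inner; rewrite t1.
have nE' : n%:R * (k.+1%:R / n%:R) = k.+1%:R :> R by rewrite mulrC mulfVK// gt_eqF.
rewrite tE nE'; have -> : k.+1%:R - k%:R = 1 :> R by rewrite -natr1; ring.
rewrite scale1r [RHS]addrC subrK.
have [k1n|nk1] := ltnP k.+1 n; first by have [->] := Hx _ k1n.
have nk : n = k.+1 by apply/eqP; rewrite eqn_leq nk1 kn.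
rewrite -nk divff ?gt_eqF//.
apply/eqP; rewrite -subr_eq0 -normr_le0 -left_lim1; apply/ler_addgt0Pl => e e0.
rewrite addr0; pose D := `|y k.+1 - y k|.
have D0 : 0 <= D by exact: normr_ge0.
have nD0 : 0 < n%:R * (D + 1) by rewrite mulr_gt0//; lra.
pose h := Num.min (e / (n%:R * (D + 1))) (1 - k%:R / n%:R).
have k1 : k%:R / n%:R < 1 :> R by rewrite ltr_pdivrMr// mul1r ltr_nat.
apply: (@left_lim_dist_le _ _ x 1 _ _ h); first by rewrite ltr01 lexx.
  by rewrite lt_min divr_gt0// subr_gt0.
move=> s /andP[s1 s2].
have hs1 : k%:R / n%:R <= s.
  apply/ltW/(le_lt_trans _ s1); rewrite lerBrDr -lerBrDl.
  by rewrite ge_min lexx orbT.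
have hs2 : 1 - s < e / (n%:R * (D + 1)).
  have : h <= e / (n%:R * (D + 1)) by rewrite ge_min lexx.
  lra.
rewrite inner; last by rewrite hs1 -nk divff// gt_eqF.
rewrite nk.
have -> : y k + (k.+1%:R * s - k%:R) *: (y k.+1 - y k) - y k.+1 =
  - ((n%:R * (1 - s)) *: (y k.+1 - y k)).
  rewrite addrAC -[y k - y k.+1]opprB -scaleN1r -scalerDl -scaleNr.
  by congr (_ *: _); rewrite nk -natr1; ring.
rewrite normrN normrZ ger0_norm; last by rewrite mulr_ge0; lra.
move: hs2; rewrite ltr_pdivlMr// -/D => hs2.
have : n%:R * (1 - s) * D <= n%:R * (1 - s) * (D + 1).
  by apply: ler_wpM2l; [rewrite mulr_ge0; lra|lra].
lra.
Qed.

Lemma M1_embedding_left_lim n y x t : (0 < n)%N -> is_embedding M1 n y x ->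
  0 <= t <= 1 -> left_lim x t = x t.
Proof.
move=> n0 Hx /andP[t0 t1]; have [u0 un] := uniform_grid R n0.
move: t0; rewrite le_eqVlt => /predU1P[<-|t0]; first exact: left_lim0.
have t01 : 0 < t <= 1 by rewrite t0.
have [k kn /andP[kt tk]] := grid_cell_left (tau := fun k => k%:R / n%:R) u0 un t01.
apply/eqP; rewrite -subr_eq0 -normr_le0; apply/ler_addgt0Pl => e e0; rewrite addr0.
pose D := `|y k.+1 - y k|; have D0 : 0 <= D by exact: normr_ge0.
have n0' : 0 < n%:R :> R by rewrite ltr0n.
have nD0 : 0 < n%:R * (D + 1) by rewrite mulr_gt0//; lra.
pose h := Num.min (e / (n%:R * (D + 1))) (t - k%:R / n%:R).
apply: (@left_lim_dist_le _ _ x t _ _ h) => //.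
  by rewrite lt_min divr_gt0// subr_gt0.
move=> s /andP[s1 s2].
have hs1 : k%:R / n%:R < s.
  by apply/(le_lt_trans _ s1); rewrite lerBrDr -lerBrDl ge_min lexx orbT.
have hs2 : t - s < e / (n%:R * (D + 1)).
  have : h <= e / (n%:R * (D + 1)) by rewrite ge_min lexx.
  lra.
rewrite (M1_embeddingE Hx kn (t := s)); last by apply/andP; split; lra.
rewrite (M1_embeddingE Hx kn (t := t)); last by apply/andP; split; lra.
rewrite opprD addrACA subrr add0r -scalerBl normrZ -/D.
have -> : n%:R * s - k%:R - (n%:R * t - k%:R) = - (n%:R * (t - s)) by ring.
rewrite normrN ger0_norm; last by rewrite mulr_ge0; lra.
move: hs2; rewrite ltr_pdivlMr// => hs2.
have : n%:R * (t - s) * D <= n%:R * (t - s) * (D + 1).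
  by apply: ler_wpM2l; [rewrite mulr_ge0; lra|lra].
lra.
Qed.

Lemma M1_embedding_unit_continuous n y x : (0 < n)%N -> is_embedding M1 n y x ->
  unit_continuous (x : R -> 'rV[R]_d).
Proof.
move=> n0 Hx s e s01 e0; have /andP[s0 s1] := s01.
have [h h0 Hh] := skorokhod_near_left x s01 e0.
have [k k0 Hk] := skorokhod_near_right x s0 e0.
rewrite (M1_embedding_left_lim n0 Hx s01) in Hh.
exists (Num.min h k); first by rewrite lt_min h0.
move=> t t01; rewrite lt_min distrC => /andP[].
rewrite !ltr_norml => /andP[? ?] /andP[? ?]; rewrite distrC.
have [ts|st] := ltP t s; first by apply: Hh; apply/andP; split; lra.
by apply: Hk; apply/andP; split; lra.
Qed.

(** The completed graph of a continuous path is its graph, and r is onto by the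
intermediate value theorem. *)
Lemma continuous_parametrization x (r : R -> R) :
  (forall t, 0 <= t <= 1 -> left_lim x t = x t) ->
  unit_continuous (x : R -> 'rV[R]_d) -> unit_continuous (r : R -> R^o) ->
  r 0 = 0 -> r 1 = 1 ->
  (forall s t, 0 <= s -> s <= t -> t <= 1 -> r s <= r t) ->
  parametrization x (x \o r) r.
Proof.
move=> xleft xc rc r0 r1 rmono.
have r01 t : 0 <= t <= 1 -> 0 <= r t <= 1.
  by move=> /andP[t0 t1]; rewrite -{1}r0 -r1 !rmono.
have rc' := @unit_continuous_within _ R^o _ rc.
split=> //.
- by apply: unit_continuous_within; exact: unit_continuous_comp.
- move=> s t s0 st t1; have := rmono _ _ s0 st t1.
  by rewrite le_eqVlt => /predU1P[E|]; [right; rewrite /= E|left].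
- apply/seteqP; split=> [_ [s + <-]|[z t] [/= t01 zs]].
    rewrite /= in_itv /= => s01; apply: complete_graph_path; exact: r01.
  have [|s s01 rs] := @IVT R r 0 1 t ler01 rc'.
    by rewrite r0 r1 (min_idPl _)// (max_idPr _).
  exists s; first by [].
  rewrite /= rs; congr pair; move: zs; rewrite xleft// => /segmentP[c _ ->].
  by rewrite subrr scaler0 addr0.
Qed.

End EmbeddingsM1.

Section DistanceM1.
Variables (R : realType) (d : nat).
Implicit Types (f g x : skorokhod R d) (t s a b e c : R) (S : seq R).
Implicit Types (n k : nat) (y : nat -> 'rV[R]_d).

Lemma jump_le_off_partition f a e S t : separated_partition a S ->
  small_osc e S f -> 0 < t < 1 -> t \notin S -> `|left_lim f t - f t| <= e.
Proof.
move=> PS HS /andP[t0 t1] tS.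
have [p [q [pS qS /andP[pt tq] Spq]]] := cell_ends PS (introT andP (conj (ltW t0) t1)).
have [_ _ S01 _] := PS; have /andP[p0 _] := S01 _ pS; have /andP[_ q1] := S01 _ qS.
have pt' : p < t by rewrite lt_neqAle pt andbT; apply: contraNneq tS => <-.
apply: (@left_lim_dist_le _ _ f t _ _ (t - p)).
- by rewrite t0 ltW.
- by rewrite subr_gt0.
- move=> s /andP[s1 s2]; apply: (small_osc_cell HS p0 q1 Spq); apply/andP; split; lra.
Qed.

(** A jump of size larger than 1 / (i + 1) occurs at a cutting point of a
partition with oscillation at most 1 / (i + 1), so that the jumps are countably
many. *)
Lemma jump_times f (E : seq R) : {in E, forall u, 0 <= u} -> exists p : nat -> R,
  [/\ forall j, 0 <= p j, forall u, u \in E -> exists j, p j = u &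
      forall t, 0 <= t <= 1 -> left_lim f t != f t -> exists j, p j = t].
Proof.
move=> E0.
have /choice[S HS] : forall i, exists S, exists2 a, separated_partition a S &
    small_osc (i.+1%:R^-1) S f.
  move=> i; have i0 : 0 < i.+1%:R^-1 :> R by rewrite invr_gt0.
  by have [a [S [_ PS HS]]] := rcll_partition f i0; exists S, a.
pose L i := if i is i'.+1 then S i' else E.
have L0 i u : u \in L i -> 0 <= u.
  case: i => [/E0//|i] /= uS; have [a [_ _ S01 _] _] := HS i.
  by have /andP[] := S01 _ uS.
pose p j := if unpickle j is Some (i, l) then nth 0 (L i) l else 0.
have pE i u : u \in L i -> exists j, p j = u.
  move=> uL; exists (pickle (i, index u (L i))).
  by rewrite /p pickleK nth_index.
exists p; split.
- move=> j; rewrite /p; case: (unpickle j) => [[i l]|//].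
  by have [lL|Ll] := ltnP l (size (L i)); [apply: (L0 i); exact: mem_nth|rewrite nth_default].
- by move=> u; exact: (pE 0%N).
- move=> t t01 jump; have /andP[t0 t1] := t01.
  have tlt1 : t < 1.
    by rewrite lt_neqAle t1 andbT; apply: contraNneq jump => ->; rewrite left_lim1.
  have tgt0 : 0 < t.
    by rewrite lt_neqAle t0 andbT; apply: contraNneq jump => <-; rewrite left_lim0.
  have J0 : 0 < `|left_lim f t - f t| by rewrite normr_gt0 subr_eq0.
  pose i := Num.truncn (`|left_lim f t - f t|^-1).
  have iJ : i.+1%:R^-1 < `|left_lim f t - f t|.
    rewrite -[ltRHS]invrK ltf_pV2 ?posrE ?invr_gt0//; exact: truncnS_gt.
  have [tS|tS] := boolP (t \in S i); first exact: (pE i.+1).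
  have [a PS Hosc] := HS i.
  have := jump_le_off_partition PS Hosc (introT andP (conj tgt0 tlt1)) tS.
  by rewrite leNgt iJ.
Qed.

Lemma staircase_sum (V : nmodType) n k (F : nat -> V) : (k < n)%N ->
  (forall i, (k < i)%N -> (i < n)%N -> F i = 0) ->
  \sum_(i < n) F i = \sum_(i < k) F i + F k.
Proof.
move=> kn F0; rewrite -!(big_mkord xpredT) (big_cat_nat (n := k.+1))//=.
have -> : \sum_(k.+1 <= i < n) F i = 0.
  by rewrite big_nat_cond big1// => i; rewrite andbT => /andP[? ?]; exact: F0.
by rewrite addr0 big_nat_recr.
Qed.

Lemma segment_point_dist_le (u v u' v' : 'rV[R]_d) c a : 0 <= c <= 1 ->
  `|u - u'| <= a -> `|v - v'| <= a ->
  `|u + c *: (v - u) - (u' + c *: (v' - u'))| <= a.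
Proof.
move=> /andP[c0 c1] uu vv.
have -> : u + c *: (v - u) - (u' + c *: (v' - u')) =
    (1 - c) *: (u - u') + c *: (v - v').
  by apply/rowP => i; rewrite !mxE; ring.
apply: (le_trans (ler_normD _ _)); rewrite !normrZ [`|c|]ger0_norm// ger0_norm; last by lra.
have h1 := ler_wpM2l c0 vv.
have h2 : (1 - c) * `|u - u'| <= (1 - c) * a by apply: ler_wpM2l => //; lra.
lra.
Qed.

(** Both paths are parametrized with one clock, which rests at the jumps of f
and at the times tau k. While it rests at tau (k + 1), where f passes from near
y k to near y (k + 1), the embedding x runs through its k-th step at the same
speed; for the remaining parameters x rests. The last step of x has no
counterpart in f: x makes it while f is near y (n - 1), and it is short by the
assumption on the last increment. *)
Lemma distM1_embedding_le a n y f g x : (0 < n)%N -> n%:R^-1 <= a ->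
  `|y n - y n.-1| <= a -> J1near a f g ->
  is_embedding J1 n y g -> is_embedding M1 n y x ->
  (distM1 f x <= (d.+1%:R * (4 * a))%:E)%E.
Proof.
move=> n0 na ya fg Hg Hx.
have n0' : 0 < n%:R :> R by rewrite ltr0n.
have a0 : 0 < a by apply: lt_le_trans na; rewrite invr_gt0.
have [tau [tau0 taun tau_lt tau_near Hf]] := J1near_grid n0 Hg fg.
have us := uniform_grid_step R n.
have tau01 := grid01 tau0 taun tau_lt.
have tau_ge0 k : (k <= n)%N -> 0 <= tau k by move=> /tau01/andP[].
have tau_le i j : (i <= j)%N -> (j <= n)%N -> tau i <= tau j.
  by rewrite leq_eqVlt => /predU1P[->//|ij jn]; apply/ltW/tau_lt.
have [|p [p0 pE pjump]] := jump_times f (E := [seq tau k | k <- iota 0 n.+1]).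
  by move=> u /mapP[k]; rewrite mem_iota ltnS => /andP[_ kn] ->; exact: tau_ge0.
have [lo [hi [clk pj]]] := split_clock_exists p0.
have jumps : resolves_jumps f lo hi.
  by move=> t t01 /(pjump t t01)[j <-].
have gridjump k : (k <= n)%N -> lo (tau k) < hi (tau k).
  move=> kn; have [|j <-] := pE (tau k); last exact: pj.
  by apply: map_f; rewrite mem_iota ltnS.
have [r Hr] := clock_inverse_exists clk.
have [lo0 lohi hilo _] := clk; have W0 := clock_length_gt0 clk.
(* the i-th step of x is made while the parameter hi 1 * s is in [L i, H i]; C i
s is the part of it made at s, and rho s the resulting time of x *)
pose L i := if (i.+1 < n)%N then lo (tau i.+1) else hi (tau i).
pose H i := hi (tau i.+1).
have LH i : (i < n)%N -> L i < H i.
  move=> ni; rewrite /L /H; case: ifP => _; first exact: gridjump.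
  have lt := tau_lt i i.+1 (leqnn _) ni.
  by have := hilo _ _ lt; have := lohi (tau i.+1); lra.
pose C i s := ramp (L i) (H i) (hi 1 * s).
pose rho s := \sum_(i < n) C i s / n%:R.
have C01 i s : 0 <= C i s <= 1 by exact: ramp01.
have rho_cont : unit_continuous (rho : R -> R^o).
  apply: (@unit_continuous_sum _ R^o n (fun i s => C i s / n%:R)) => i ni.
  have c0 : 0 <= (H i - L i)^-1 * hi 1 / n%:R.
    by rewrite !mulr_ge0 ?invr_ge0 ?(ltW W0) ?(ltW n0')// subr_ge0 ltW// LH.
  apply: (unit_lipschitz c0) => s t _ _.
  rewrite -mulrBl normrM (ger0_norm (ltW (_ : 0 < n%:R^-1))) ?invr_gt0//.
  rewrite mulrAC ler_pM2r ?invr_gt0//.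
  apply: (le_trans (ramp_lip _ _ (LH i ni))).
  by rewrite -mulrBr normrM (gtr0_norm W0) mulrA.
have rho_mono s t : 0 <= s -> s <= t -> t <= 1 -> rho s <= rho t.
  move=> _ st _; apply: ler_sum => i _; rewrite ler_pM2r ?invr_gt0//.
  by apply: ramp_mono; [exact: LH|rewrite ler_pM2l].
have L0 i : (i < n)%N -> 0 <= L i.
  move=> ni; rewrite /L; case: ifP => [i1n|_].
    have t0 : 0 < tau i.+1 by rewrite -tau0; exact: tau_lt.
    by have := hilo _ _ t0; have := lohi 0; lra.
  have := tau_ge0 i (ltnW ni); rewrite le_eqVlt => /predU1P[<-|t0].
    by have := lohi 0; lra.
  by have := hilo _ _ t0; have := lohi 0; have := lohi (tau i); lra.
have Hn i : (i < n)%N -> H i <= hi 1.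
  move=> ni; have := tau_le i.+1 n ni (leqnn _); rewrite taun le_eqVlt.
  move=> /predU1P[E|t1]; first by rewrite /H E.
  by have := hilo _ _ t1; have := lohi 1; rewrite /H; lra.
have rho0 : rho 0 = 0.
  rewrite /rho big1// => i _; rewrite /C mulr0 ramp_le ?mul0r//; first exact: LH.
  exact: L0.
have rho1 : rho 1 = 1.
  rewrite /rho (eq_bigr (fun=> n%:R^-1)).
    by rewrite sumr_const card_ord -[_ *+ _]mulr_natl divff// gt_eqF.
  move=> i _; rewrite /C mulr1 ramp_ge ?mul1r//; [exact: LH|exact: Hn].
have Px := continuous_parametrization (fun t t01 => M1_embedding_left_lim n0 Hx t01)
  (M1_embedding_unit_continuous n0 Hx) rho_cont rho0 rho1 rho_mono.
have Pf := clock_parametrization clk jumps Hr.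
(* at each instant one single step k of the interpolation is in progress *)
have stair s k b : (k < n)%N -> C k s = b ->
    (forall i, (i < k)%N -> C i s = 1) ->
    (forall i, (k < i)%N -> (i < n)%N -> C i s = 0) ->
    rho s = (k%:R + b) / n%:R /\ x (rho s) = y k + b *: (y k.+1 - y k).
  move=> kn Ck C1 C0.
  have rhoE : rho s = (k%:R + b) / n%:R.
    rewrite /rho (staircase_sum (F := fun i => C i s / n%:R) kn) => [|i ki ni]; last by rewrite C0 ?mul0r.
    rewrite (eq_bigr (fun=> n%:R^-1)) => [|i _]; last by rewrite C1 ?mul1r.
    by rewrite sumr_const card_ord -[_ *+ _]mulr_natl Ck mulrDl.
  split=> //; rewrite rhoE (M1_embeddingE Hx kn).
    by rewrite mulrC divfK ?gt_eqF// addrAC subrr add0r.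
  have /andP[b0 b1] : 0 <= b <= 1 by rewrite -Ck.
  by rewrite !ler_pM2r ?invr_gt0// -natr1 lerD2l b1 lerDl b0.
have leftf k t : (k < n)%N -> tau k < t <= tau k.+1 -> `|left_lim f t - y k| <= a.
  move=> kn tk; have /andP[_ ?] := tau01 _ kn; have /andP[_ ?] := tk.
  by apply: (grid_left_lim (tau := tau) (tau_ge0 k (ltnW kn)) _ tk) => [s|]; [exact: Hf|lra].
have C_past s i : 0 <= s <= 1 -> (i < n)%N -> tau i.+1 < r s -> C i s = 1.
  move=> s01 ni lt; have hl := hilo _ _ lt; apply: ramp_ge; first exact: LH.
  by have [_ /andP[h _]] := Hr _ s01; rewrite /H; lra.
have C_future s i : 0 <= s <= 1 -> (i.+1 < n)%N -> r s < tau i.+1 -> C i s = 0.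
  move=> s01 ni lt; apply: ramp_le; first exact/LH/ltnW.
  by have [_ /andP[_ h]] := Hr _ s01; have hl := hilo _ _ lt; rewrite /L ni; lra.
have C_last s i : 0 <= s <= 1 -> i.+1 = n -> r s <= tau i -> C i s = 0.
  move=> s01 ni le; apply: ramp_le; first by apply: LH; rewrite -ni.
  have [_ /andP[_ h]] := Hr _ s01; rewrite /L ni ltnn.
  move: le; rewrite le_eqVlt => /predU1P[<-//|lt].
  by have hl := hilo _ _ lt; have := lohi (tau i); lra.
have C_done s i k : 0 <= s <= 1 -> (i < k)%N -> (k < n)%N -> tau k < r s -> C i s = 1.
  move=> s01 ik kn lt; apply: (C_past s i s01 (ltn_trans ik kn)).
  by apply: le_lt_trans lt; apply: tau_le; rewrite // ltnW.
have C_todo s i k : 0 <= s <= 1 -> (k < i)%N -> (i < n)%N -> r s < tau k.+1 -> C i s = 0.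
  move=> s01 ki ni lt.
  have lt' : r s < tau i by apply: (lt_le_trans lt); apply: tau_le => //; exact: ltnW.
  have [i1n|ni1] := ltnP i.+1 n.
    by apply: (C_future s i s01 i1n); apply: (lt_trans lt'); exact: tau_lt.
  by apply: (C_last s i s01 _ (ltW lt')); apply/eqP; rewrite eqn_leq ni.
have time s k b : (k < n)%N -> 0 <= b <= 1 -> tau k <= r s <= tau k.+1 ->
    rho s = (k%:R + b) / n%:R -> `|r s - rho s| <= 4 * a.
  move=> kn /andP[b0 b1] /andP[? ?] ->.
  have := tau_near k (ltnW kn); have := tau_near k.+1 kn; rewrite us mulrDl.
  have h1 : 0 <= b / n%:R by rewrite divr_ge0// ltW.
  have h2 : b / n%:R <= n%:R^-1 by rewrite ler_pdivrMr// mulVf// gt_eqF.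
  by rewrite !ler_norml => /andP[? ?] /andP[? ?]; apply/andP; split; lra.
have main s : 0 <= s <= 1 -> `|clock_path f lo hi r s - x (rho s)| <= 4 * a /\
    `|r s - rho s| <= 4 * a.
  move=> s01; have [rs01 rsW] := Hr _ s01; have /andP[rs0 rs1] := rs01.
  have seg := clock_path_segment f clk Hr s01.
  (* inside the k-th cell both paths stay near y k *)
  have inside k b : (k < n)%N -> tau k <= r s <= tau k.+1 ->
      `|left_lim f (r s) - y k| <= a -> `|f (r s) - y k| <= a ->
      (forall i, (i < k)%N -> C i s = 1) ->
      (forall i, (k < i)%N -> (i < n)%N -> C i s = 0) -> C k s = b ->
      (b = 0 \/ k.+1 = n) -> 
      `|clock_path f lo hi r s - x (rho s)| <= 4 * a /\ `|r s - rho s| <= 4 * a.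
    move=> kn tk lk rk C1 C0 Ck bk; have [rhoE xE] := stair s k b kn Ck C1 C0.
    have b01 : 0 <= b <= 1 by rewrite -Ck.
    split; last exact: (time s k b).
    have h1 := segment_dist_le seg lk rk.
    have h2 : `|x (rho s) - y k| <= a.
      rewrite xE addrAC subrr add0r normrZ.
      case: bk => [->|nE]; first by rewrite normr0 mul0r ltW.
      move: ya; rewrite -nE /= => ya; have /andP[b0 b1] := b01.
      rewrite ger0_norm//; apply: le_trans ya.
      by rewrite -[leRHS]mul1r ler_wpM2r.
    apply: (@le_trans _ _ (2 * a)); last by lra.
    by apply: (@dist_le_halves _ _ _ _ (y k)); rewrite mulrAC divff ?mul1r// pnatr_eq0.
  move: (rs1); rewrite le_eqVlt => /predU1P[r1|r1].
    have [k kn tk] := grid_cell_left tau0 taun (introT andP (conj ltr01 (lexx _))).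
    have /andP[tk1 tk2] := tk.
    have kE : k.+1 = n.
      apply/eqP; rewrite eqn_leq kn leqNgt; apply/negP => k1n.
      by have := tau_lt _ _ k1n (leqnn _); rewrite taun; lra.
    have lk : `|left_lim f (r s) - y k| <= a by rewrite r1; exact: leftf.
    apply: (inside k (C k s)) => //.
    - by rewrite r1 tk2 ltW.
    - by rewrite r1 -left_lim1 -r1.
    - by move=> i ik; apply: (C_done s i k) => //; rewrite r1.
    - by move=> i ki; rewrite -kE ltnS leqNgt ki.
    - by right.
  have [k kn tk] := grid_cell_right tau0 taun (introT andP (conj rs0 r1)).
  have /andP[tk1 tk2] := tk.
  move: tk1; rewrite le_eqVlt => /predU1P[tE|tk1]; last first.
    have lk : `|left_lim f (r s) - y k| <= a by apply: leftf; rewrite // tk1 ltW.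
    have [k1n|nk1] := ltnP k.+1 n.
      apply: (inside k 0) => //.
      - by rewrite !ltW.
      - exact: Hf.
      - by move=> i ik; exact: (C_done s i k).
      - by move=> i ki ni; exact: (C_todo s i k).
      - exact: C_future.
      - by left.
    apply: (inside k (C k s)) => //.
    - by rewrite !ltW.
    - exact: Hf.
    - by move=> i ik; exact: (C_done s i k).
    - by move=> i ki ni; exact: (C_todo s i k).
    - by right; apply/eqP; rewrite eqn_leq kn.
  case: k kn tk tk2 tE => [|k] kn tk tk2 tE.
    have r0 : r s = 0 by rewrite -tE tau0.
    have f0 : `|f (r s) - y 0%N| <= a by exact: Hf.
    have C00 i : (i < n)%N -> C i s = 0.
      move=> ni; case: i ni => [|i] ni; last by apply: (C_todo s i.+1 0%N).
      have [i1n|ni1] := ltnP 1 n; first exact: C_future.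
      apply: C_last => //; last by rewrite -tE.
      by apply/eqP; rewrite eqn_leq ni.
    apply: (inside 0%N 0) => //.
    - by rewrite tE lexx ltW.
    - by rewrite r0 left_lim0 -r0.
    - by move=> i _ ni; exact: C00.
    - exact: C00.
    - by left.
  have kn' : (k < n)%N := ltnW kn.
  have Ck : C k s = jump_frac lo hi (r s) (hi 1 * s).
    rewrite /C /L /H kn tE /jump_frac ramp_mid//.
    by rewrite -tE; exact/gridjump/ltnW.
  have b01 : 0 <= C k s <= 1 by [].
  have [rhoE xE] : rho s = (k%:R + C k s) / n%:R /\
      x (rho s) = y k + C k s *: (y k.+1 - y k).
    apply: stair => //.
    - move=> i ik; apply: (C_past s i s01 (ltn_trans ik kn')).
      by rewrite -tE; apply: tau_lt => //; exact: ltnW.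
    - move=> i ki ni; have [i1n|ni1] := ltnP i.+1 n.
        by apply: (C_future s i s01 i1n); rewrite -tE; apply: tau_lt.
      apply: (C_last s i s01); first by apply/eqP; rewrite eqn_leq ni.
      by rewrite -tE; apply: tau_le => //; exact: ltnW.
  split; last first.
    apply: (time s k (C k s)) => //.
    by rewrite -tE lexx andbT ltW// tau_lt// ltnW.
  have lk : `|left_lim f (r s) - y k| <= a.
    by apply: leftf => //; rewrite -tE lexx andbT tau_lt// ltnW.
  have rk : `|f (r s) - y k.+1| <= a by exact: Hf.
  apply: (@le_trans _ _ a); last by lra.
  rewrite xE /clock_path -Ck.
  exact: segment_point_dist_le.
apply: (le_trans (ereal_inf_lbound _)).
  exists (clock_path f lo hi r), r, (x \o rho), rho; split; [exact: Pf|exact: Px|].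
  reflexivity.
rewrite ge_max; apply/andP; split; apply: sup01_le => s /main[h1 h2].
  apply: (le_trans (enorm_le_norm _)); apply: ler_pM => //.
  by rewrite ler_nat.
by apply: (le_trans h2); rewrite ler_peMl ?mulr_ge0 ?(ltW a0)// ler1n.
Qed.

End DistanceM1.

(** * Existence of embeddings *)

Section BuildEmbeddings.
Variables (R : realType) (d : nat).
Implicit Types (f g x : skorokhod R d) (t s a b e c : R) (S : seq R).
Implicit Types (n k : nat) (y : nat -> 'rV[R]_d).

Lemma skorokhod_of_lipschitz (u : R -> 'rV[R]_d) c : 0 <= c ->
  (forall s t, `|u s - u t| <= c * `|s - t|) ->
  (forall t, t <= 0 -> u t = u 0) -> (forall t, 1 <= t -> u t = u 1) ->
  exists x : skorokhod R d, skpath x = u.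
Proof.
move=> c0 Hu u0 u1.
have cont t : u s @[s --> t] --> u t.
  apply/cvgrPdist_le => e e0; have h0 : 0 < e / (c + 1) by rewrite divr_gt0//; lra.
  apply: filterS (nbhsx_ballx t _ h0) => s; rewrite /ball /= ltr_pdivlMr; last lra.
  by have := Hu t s; have := normr_ge0 (t - s); lra.
have right t : 0 <= t < 1 -> u s @[s --> t^'+] --> u t.
  by move=> _; apply: cvg_at_right_filter; exact: cont.
have left t : u s @[s --> t^'-] --> u t by apply: cvg_at_left_filter; exact: cont.
exists (Skorokhod u0 u1 right (fun t _ => cvgP _ (left t)) (left 1)).
by [].
Qed.

Lemma near_const_right (u : R -> 'rV[R]_d) (v : 'rV[R]_d) t h : 0 < h ->
  (forall s, t < s < t + h -> u s = v) -> u s @[s --> t^'+] --> v.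
Proof.
move=> h0 H; apply: cvg_near_cst; near=> s; apply: H.
apply/andP; split; first by near: s; exact: nbhs_right_gt.
by near: s; apply: nbhs_right_lt; rewrite ltrDl.
Unshelve. all: by end_near. Qed.

Lemma near_const_left (u : R -> 'rV[R]_d) (v : 'rV[R]_d) t h : 0 < h ->
  (forall s, t - h < s < t -> u s = v) -> u s @[s --> t^'-] --> v.
Proof.
move=> h0 H; apply: cvg_near_cst; near=> s; apply: H.
apply/andP; split; last by near: s; exact: nbhs_left_lt.
by near: s; apply: nbhs_left_gt; rewrite ltrBlDr ltrDl.
Unshelve. all: by end_near. Qed.

Lemma J1_embedding_exists n y : (0 < n)%N -> exists x, is_embedding J1 n y x.
Proof.
move=> n0; have n0' : 0 < n%:R :> R by rewrite ltr0n.
have [g0 gn] := uniform_grid R n0.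
pose u t := y (minn (Num.truncn (t * n%:R)) n.-1).
have uE k t : (k < n)%N -> k%:R / n%:R <= t < k.+1%:R / n%:R -> u t = y k.
  move=> kn; rewrite ler_pdivrMr// ltr_pdivlMr// => tk; rewrite /u.
  have t0 : 0 <= t * n%:R by case/andP: tk; have := ler0n R k; lra.
  rewrite (truncn_def (n := k))//.
  by congr y; apply/minn_idPl; rewrite -ltnS prednK.
have u0 t : t <= 0 -> u t = u 0.
  move=> t0; rewrite (uE 0%N 0)//; last by rewrite mul0r lexx divr_gt0.
  rewrite /u; have -> : Num.truncn (t * n%:R) = 0%N; last by rewrite min0n.
  apply/eqP; rewrite -leqn0 truncn_le_nat; apply: le_lt_trans ltr01.
  by rewrite mulr_le0_ge0// ltW.
have u1 t : 1 <= t -> u t = u 1.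
  move=> t1; rewrite /u; congr y.
  have big s : 1 <= s -> minn (Num.truncn (s * n%:R)) n.-1 = n.-1.
    move=> s1; apply/minn_idPr; apply: (leq_trans (leq_pred n)).
    rewrite -ltnS -(ltr_nat R); apply: le_lt_trans (truncnS_gt _).
    by rewrite ler_peMl// ltW.
  by rewrite !big.
have right t : 0 <= t < 1 -> u s @[s --> t^'+] --> u t.
  move=> t01; have [k kn tk] := grid_index n0 t01.
  have /andP[tk1 tk2] := tk; rewrite (uE k t kn tk).
  apply: (near_const_right (h := k.+1%:R / n%:R - t)); first by rewrite subr_gt0.
  by move=> s /andP[s1 s2]; apply: uE => //; apply/andP; split; lra.
have left t : 0 < t <= 1 -> exists2 k, (k < n)%N & u s @[s --> t^'-] --> y k.
  move=> t01; have [k kn /andP[tk1 tk2]] := grid_cell_left (tau := fun k => k%:R / n%:R) g0 gn t01.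
  exists k => //; apply: (near_const_left (h := t - k%:R / n%:R)); first by rewrite subr_gt0.
  by move=> s /andP[s1 s2]; apply: uE => //; apply/andP; split; lra.
have left' t : 0 < t <= 1 -> cvg (u s @[s --> t^'-]).
  by move=> /left[k _ h]; apply: cvgP h.
have left1 : u s @[s --> 1^'-] --> u 1.
  have nE : n.-1.+1 = n by rewrite prednK.
  have -> : u 1 = y n.-1.
    rewrite /u mul1r; congr y; apply/minn_idPr; apply: (leq_trans (leq_pred n)).
    by rewrite natrK.
  apply: (near_const_left (h := 1 - n.-1%:R / n%:R)).
    by rewrite subr_gt0 ltr_pdivrMr// mul1r ltr_nat ltn_predL.
  move=> s /andP[s1 s2]; apply: uE; rewrite nE ?leqnn// gn s2 andbT; lra.
exists (Skorokhod u0 u1 right left' left1) => k kn; split.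
  by apply: uE; rewrite // lexx ltr_pM2r ?invr_gt0// ltr_nat /= ltnS leqnn.
by move=> t /andP[t1 t2]; apply: uE => //; rewrite (ltW t1).
Qed.

Lemma M1_embedding_exists n y : (0 < n)%N -> exists x, is_embedding M1 n y x.
Proof.
move=> n0; have n0' : 0 < n%:R :> R by rewrite ltr0n.
pose D i := y i.+1 - y i.
pose r i t := ramp (i%:R / n%:R) (i.+1%:R / n%:R) t : R.
pose u t := y 0%N + \sum_(i < n) r i t *: D i.
have step i : i%:R / n%:R < i.+1%:R / n%:R :> R.
  by rewrite ltr_pM2r ?invr_gt0// ltr_nat.
have us := uniform_grid_step R n.
have ulip s t : `|u s - u t| <= (\sum_(i < n) n%:R * `|D i|) * `|s - t|.
  rewrite /u opprD addrACA subrr add0r -sumrB mulr_suml.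
  apply: (le_trans (ler_norm_sum _ _ _)); apply: ler_sum => i _.
  rewrite -scalerBl normrZ mulrAC ler_wpM2r//.
  apply: (le_trans (ramp_lip _ _ (step i))).
  by rewrite us addrAC subrr add0r invrK.
have u0 t : t <= 0 -> u t = u 0.
  move=> t0; congr (_ + _); apply: eq_bigr => i _.
  have i0 : 0 <= i%:R / n%:R :> R by rewrite divr_ge0.
  by rewrite /r !ramp_le//; exact: le_trans i0.
have u1 t : 1 <= t -> u t = u 1.
  move=> t1; congr (_ + _); apply: eq_bigr => i _.
  have i1 : i.+1%:R / n%:R <= 1 :> R by rewrite ler_pdivrMr// mul1r ler_nat.
  by rewrite /r !ramp_ge//; exact: le_trans t1.
have c0 : 0 <= \sum_(i < n) n%:R * `|D i|.
  by apply: sumr_ge0 => i _; rewrite mulr_ge0.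
have [x xE] := skorokhod_of_lipschitz c0 ulip u0 u1.
have uE k t : (k < n)%N -> k%:R / n%:R <= t < k.+1%:R / n%:R ->
    u t = y k + (n%:R * (t - k%:R / n%:R)) *: (y k.+1 - y k).
  move=> kn /andP[t1 t2]; rewrite /u.
  rewrite (staircase_sum (F := fun i => r i t *: D i) kn); last first.
    move=> i ki _; rewrite /r ramp_le ?scale0r//; apply: (le_trans (ltW t2)).
    by rewrite ler_pM2r ?invr_gt0// ler_nat.
  rewrite (eq_bigr (fun i : 'I_k => D i)); last first.
    move=> i _; rewrite /r ramp_ge ?scale1r//; apply: le_trans t1.
    by rewrite ler_pM2r ?invr_gt0// ler_nat.
  rewrite -(big_mkord xpredT D) telescope_sumr// addrA [y 0%N + _]addrC subrK.
  congr (_ + _ *: _); rewrite /r ramp_mid ?t1 ?(ltW t2)// us addrAC subrr add0r invrK.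
  exact: mulrC.
exists x => k kn; rewrite xE; split.
  by rewrite (uE k)// ?lexx ?step// subrr mulr0 scale0r addr0.
by move=> t /andP[t1 t2]; rewrite (uE k)// t2 ltW.
Qed.

(** The J1 embedding is also a J2 embedding and an M2 embedding. *)
Lemma embedding_exists T n y : (0 < n)%N -> exists x, is_embedding T n y x.
Proof.
case: T => n0; try exact: J1_embedding_exists; try exact: M1_embedding_exists.
  have [x Hx] := J1_embedding_exists y n0; exists x => k kn.
  by have [? H] := Hx k kn; split=> // t /H; left.
by have [x Hx] := J1_embedding_exists y n0; exists x; exact: embedding_M2 Hx.
Qed.

Lemma sk_dist_embedding_le T a n y f g x : (0 < n)%N -> n%:R^-1 <= a ->
  `|y n - y n.-1| <= a -> J1near a f g ->
  is_embedding J1 n y g -> is_embedding T n y x ->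
  (sk_dist T f x <= (d.+1%:R * (4 * a))%:E)%E.
Proof.
case: T => n0 na ya fg Hg Hx /=.
- apply: le_trans (distJ1_embedding_le n0 fg Hg Hx) _.
  have a0 : 0 <= a by apply: le_trans na; rewrite invr_ge0.
  rewrite lee_fin ler_wpM2l//; lra.
- exact: distJ2_embedding_le fg Hg Hx.
- exact: distM1_embedding_le fg Hg Hx.
- exact: distM2_embedding_le fg Hg Hx.
Qed.

End BuildEmbeddings.

(** * Continuous functions are measurable for the coordinates *)

Section Measurability.
Variables (R : realType) (d : nat).
Implicit Types (f g x : skorokhod R d) (t s a b e c : R) (S : seq R).
Implicit Types (n k : nat) (y : nat -> 'rV[R]_d).

Lemma borel_coord_ge i c : measurable ([set v | c <= v ord0 i] : set (borelRV R d)).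
Proof.
rewrite -[X in measurable X]setCK; apply: measurableC; apply: sub_sigma_algebra.
rewrite /open_sets /=.
have -> : ~` [set v : 'rV[R]_d | c <= v ord0 i] =
    (fun v : 'rV[R]_d => v ord0 i) @^-1` [set z | z < c].
  by apply/seteqP; split=> v /=; rewrite ltNge => /negP.
apply: open_comp; last exact: open_lt.
by move=> v _; exact: coord_continuous.
Qed.

Lemma measurable_eval_coord t i c : 0 <= t <= 1 ->
  measurable ([set f | c <= (f t : 'rV[R]_d) ord0 i] : set (skorokhodM R d)).
Proof.
move=> t01; apply: sub_sigma_algebra; exists t; first by rewrite /= in_itv.
exists ([set v | c <= v ord0 i] : set (borelRV R d)); first exact: borel_coord_ge.
by [].
Qed.

(** A code of f in a countable set, read off the values at finitely many times:
all functions of the code are measurable. *)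
Definition grid_code m f : 'M[int]_(m.+1, d) :=
  \matrix_(k < m.+1, i < d) Num.floor (m.+1%:R * (f (k%:R / m.+1%:R) : 'rV[R]_d) ord0 i).

Definition decode m (A : 'M[int]_(m.+1, d)) k : 'rV[R]_d :=
  \row_i ((A (inord (minn k m)) i)%:~R / m.+1%:R).

Lemma grid_code_measurable m (U : set 'M[int]_(m.+1, d)) :
  measurable (grid_code m @^-1` U : set (skorokhodM R d)).
Proof.
have -> : grid_code m @^-1` U =
    \bigcup_(A in [set: 'M[int]_(m.+1, d)]) [set f | U A /\ grid_code m f = A].
  apply/seteqP; split=> [f Uf|f [A _ [UA fA]]].
    by exists (grid_code m f).
  by rewrite /preimage /= fA.
apply: countable_bigcupT_measurable; first exact: countableP.
move=> A; have [UA|nUA] := pselect (U A); last first.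
  rewrite (_ : [set _ | _] = set0); first exact: measurable0.
  by apply/seteqP; split=> f // [].
have -> : [set f | U A /\ grid_code m f = A] =
  \bigcap_(k in [set: 'I_m.+1]) \bigcap_(i in [set: 'I_d])
    ([set f | (A k i)%:~R / m.+1%:R <= (f (k%:R / m.+1%:R) : 'rV[R]_d) ord0 i] `\`
     [set f | (A k i + 1)%:~R / m.+1%:R <= (f (k%:R / m.+1%:R) : 'rV[R]_d) ord0 i]).
  apply/seteqP; split=> [f [_ fA] k _ i _|f Hf].
    have := floor_itv (m.+1%:R * (f (k%:R / m.+1%:R) : 'rV[R]_d) ord0 i).
    have E : A k i = Num.floor (m.+1%:R * (f (k%:R / m.+1%:R) : 'rV[R]_d) ord0 i).
      by rewrite -fA mxE.
    rewrite -E => /andP[h1 h2]; split=> /=.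
      by rewrite ler_pdivrMr// mulrC.
    by apply/negP; rewrite -ltNge ltr_pdivlMr// mulrC.
  split=> //; apply/matrixP => k i; rewrite mxE; apply: floor_def.
  have [/= h1 /negP h2] := Hf k I i I.
  by rewrite -ltNge ltr_pdivlMr// mulrC in h2; rewrite ler_pdivrMr// mulrC in h1; rewrite h1.
have k01 (k : 'I_m.+1) : 0 <= (k%:R / m.+1%:R : R) <= 1.
  by rewrite divr_ge0//= ler_pdivrMr// mul1r ler_nat ltnW.
apply: fin_bigcap_measurable; first exact: finite_finset.
move=> k _; apply: fin_bigcap_measurable; first exact: finite_finset.
by move=> i _; apply: measurableD; apply: measurable_eval_coord.
Qed.

Lemma decode_near m f k : (k < m.+1)%N ->
  `|f (k%:R / m.+1%:R) - decode (grid_code m f) k| <= m.+1%:R^-1.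
Proof.
move=> km; apply: norm_le_coord; first by rewrite invr_ge0.
move=> i; rewrite !mxE inordK; last by rewrite ltnS geq_minr.
rewrite (minn_idPl _); last by rewrite -ltnS.
set c : R := f _ ord0 i; have /andP[h1 h2] := floor_itv (m.+1%:R * c).
have m0 : 0 < m.+1%:R :> R by [].
rewrite [leRHS]mulrC -ler_pdivrMr// in h1.
rewrite [ltLHS]mulrC -ltr_pdivlMr// intrD mulrDl mul1r in h2.
have c1 : 0 <= c - (Num.floor (m.+1%:R * c))%:~R / m.+1%:R by rewrite subr_ge0.
by rewrite (ger0_norm c1) lerBlDl ltW.
Qed.

(** The cutting points of f, moved to the next grid point by q, are cutting
points of the decoded step path, and at a grid point the two paths differ by the
rounding error only; matching_J1near applies. *)
Lemma decode_J1near f b : 0 < b -> exists N, forall m g, (N <= m)%N ->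
  is_embedding J1 m.+1 (decode (grid_code m f)) g -> J1near b f g.
Proof.
(* 5 * (3 * e) and a / 16 will have to be at most b *)
move=> b0; pose e := b / 20; have e0 : 0 < e by rewrite /e; lra.
have [a0 [S [a00 PS0 HS]]] := rcll_partition f e0.
pose a := Num.min a0 b; have a_gt0 : 0 < a by rewrite lt_min a00.
have [aa0 ab] : a <= a0 /\ a <= b by rewrite !ge_min !lexx orbT.
have PS := separated_partition_le aa0 PS0.
pose c := Num.min (a / 32) e; have c0 : 0 < c by rewrite lt_min e0 andbT; lra.
have [ca ce] : c <= a / 32 /\ c <= e by rewrite !ge_min !lexx orbT.
exists (Num.truncn c^-1) => m g cm Hg.
set M : R := m.+1%:R; have M0 : 0 < M by [].
have Mc : M^-1 <= c.
  rewrite -[leRHS]invrK lef_pV2 ?posrE ?invr_gt0//; apply/ltW.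
  by apply: lt_le_trans (truncnS_gt _) _; rewrite ler_nat.
pose q u : R := (Num.ceil (M * u))%:~R / M.
have qu u : u <= q u < u + M^-1.
  have /andP[h1 h2] := ceil_itv (M * u).
  rewrite /q ler_pdivlMr// mulrC h2 /= ltr_pdivrMr// mulrDl mulVf ?gt_eqF// mulrC.
  by rewrite intrB ltrBlDr in h1; rewrite (mulrC u); exact: h1.
have [S0 S1 S01 Sgap] := PS.
have PQ : separated_partition (a / 2) [seq q u | u <- S].
  split.
  - by apply/mapP; exists 0 => //; rewrite /q mulr0 ceil0 mul0r.
  - apply/mapP; exists 1 => //; rewrite /q mulr1 /M -[m.+1%:R]/((m.+1%:Z)%:~R) intrKceil.
    by rewrite divff// gt_eqF.
  - move=> _ /mapP[u /S01/andP[u0 u1] ->]; have /andP[qu0 _] := qu u.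
    rewrite (le_trans u0 qu0) /= /q ler_pdivrMr// mul1r.
    rewrite -[M]/((m.+1%:Z)%:~R) ler_int ceil_le_int.
    by rewrite -[leRHS]mulr1 ler_pM2l.
  - move=> _ _ /mapP[u uS ->] /mapP[v vS ->] quv.
    have /andP[u1 u2] := qu u; have /andP[v1 v2] := qu v.
    have [uv|vu|uv] := ltgtP u v; last by rewrite uv ltxx in quv.
      have uv_gap := Sgap u v uS vS uv.
      by move: (q u) (q v) (M^-1) u2 v1 Mc => p r w ? ? ?; lra.
    have vu_gap := Sgap v u vS uS vu.
    by move: (q u) (q v) (M^-1) u1 v2 quv Mc => p r w ? ? ? ?; lra.
have HQ : small_osc (3 * e) [seq q u | u <- S] g.
  move=> s t s0 st t1 H.
  have [i iN si] := grid_index (ltn0Sn m) (introT andP (conj s0 (le_lt_trans st t1))).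
  have [j jN tj] := grid_index (ltn0Sn m) (introT andP (conj (le_trans s0 st) t1)).
  rewrite (J1_embeddingE Hg iN si) (J1_embeddingE Hg jN tj).
  have di := decode_near f iN; have dj := decode_near f jN.
  move: si tj; rewrite -/M => /andP[si1 si2] /andP[tj1 tj2].
  have ij : (i <= j)%N.
    rewrite -ltnS -(ltr_nat R) -(@ltr_pM2r _ M^-1) ?invr_gt0//.
    by apply: (le_lt_trans si1); exact: le_lt_trans tj2.
  have fij : `|f (i%:R / M) - f (j%:R / M)| <= e.
    apply: HS; first by rewrite divr_ge0// ltW.
    - by rewrite ler_pM2r ?invr_gt0// ler_nat.
    - by rewrite ltr_pdivrMr// mul1r ltr_nat.
    move=> u uS; apply: contra (H _ (map_f _ uS)) => /andP[iu uj].
    rewrite ltr_pdivrMr// mulrC in iu; rewrite ler_pdivlMr// mulrC in uj.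
    apply/andP; split.
      apply: (lt_le_trans si2); rewrite ler_pM2r ?invr_gt0//.
      rewrite -[i.+1%:R]/((i.+1%:Z)%:~R) ler_int.
      by rewrite -addn1 PoszD lezD1 ceil_gt_int.
    apply: le_trans tj1; rewrite ler_pM2r ?invr_gt0//.
    by rewrite -[j%:R]/((j%:Z)%:~R) ler_int ceil_le_int.
  rewrite distrC in di.
  apply: le_trans (dist_le3 di fij dj) _; rewrite -/M.
  by move: (M^-1) Mc => w ?; lra.
have a2 : 0 < a / 2 by lra.
have e3 : 0 < 3 * e by lra.
have HS' : small_osc (3 * e) S f by move=> s t s0 st t1 /(HS _ _ s0 st t1); lra.
have a2a : a / 2 <= a by lra.
have := matching_J1near a2 e3 (separated_partition_le a2a PS) HS' PQ HQ.
move=> /(_ _) near; apply: J1near_le (near _); first by rewrite ge_max /e; apply/andP; split; lra.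
move=> x z x0 z1 xz; have x01 : 0 <= x < 1 by apply/andP; split; lra.
have [k kN /andP[k1 k2]] := grid_index (ltn0Sn m) x01.
have kM : k.+1%:R / M = k%:R / M + M^-1 by rewrite -natr1 mulrDl mul1r.
rewrite -/M in k1 k2; rewrite kM in k2.
have k1N : (k.+1 < m.+1)%N.
  rewrite -(ltr_nat R) -/M -(@ltr_pM2r _ M^-1) ?invr_gt0// divff ?gt_eqF// kM.
  by move: (k%:R / M) (M^-1) k1 Mc => u w ? ?; lra.
exists (k.+1%:R / M); first by rewrite kM; move: (k%:R / M) (M^-1) k1 k2 Mc => u w ? ? ?; apply/andP; split; lra.
have [-> _] := Hg _ k1N.
by apply: le_trans (decode_near f k1N) _; rewrite -/M; move: (M^-1) Mc => w ?; lra.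
Qed.

(** By decode_J1near and sk_dist_embedding_le the embeddings of the decoded
codes of f converge to f, so that G is a limit of functions of codes. *)
Lemma sk_continuous_measurable T (G : skorokhod R d -> R) : sk_continuous T G ->
  measurable_fun [set: skorokhodM R d] (G : skorokhodM R d -> R).
Proof.
move=> GT.
pose E m (A : 'M[int]_(m.+1, d)) : skorokhod R d :=
  projT1 (cid (embedding_exists T (decode A) (ltn0Sn m))).
have HE m (A : 'M[int]_(m.+1, d)) : is_embedding T m.+1 (decode A) (E m A).
  by rewrite /E; case: cid.
apply: (@measurable_realfun.measurable_fun_cvg _ _ _ _
    (fun m (f : skorokhodM R d) => G (E m (grid_code m f)))).
  move=> m _ B _; rewrite setTI.
  exact: (@grid_code_measurable m [set A | B (G (E m A))]).
move=> f _; apply/cvgrPdist_lt => e e0; have [b b0 Hb] := GT f e e0.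
pose c := b / (8 * d.+1%:R).
have c0 : 0 < c by rewrite divr_gt0// mulr_gt0.
have [N HN] := decode_J1near f c0.
exists (maxn N (Num.truncn c^-1)) => // m; rewrite /= geq_max => /andP[Nm cm].
have [g Hg] := J1_embedding_exists (decode (grid_code m f) : nat -> 'rV[R]_d) (ltn0Sn m).
apply: Hb; apply: le_lt_trans (sk_dist_embedding_le (ltn0Sn m) _ _ (HN _ _ Nm Hg) Hg (HE m _)) _.
- rewrite -[leRHS]invrK lef_pV2 ?posrE ?invr_gt0//; apply/ltW.
  apply: lt_le_trans (truncnS_gt _) _.
  by rewrite ler_nat.
- rewrite /decode /= (minn_idPr (leqnSn m)) minnn subrr normr0; exact: ltW.
- rewrite lte_fin /c; have d0 : 0 < d.+1%:R :> R by [].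
  have -> : d.+1%:R * (4 * (b / (8 * d.+1%:R))) = b / 2 by field; rewrite gt_eqF.
  by lra.
Qed.

End Measurability.

(** * Markov property over several steps *)

Section Markov.
Variables (R : realType) (d : nat) (dO : measure_display).
Variables (Omega : measurableType dO) (P : probability Omega R).
Variables (K : R.-pker borelRV R d ~> borelRV R d).
Variables (Y : nat -> {RV P >-> borelRV R d}).
Hypothesis HY : markov_chain K Y.
Implicit Types (A : set Omega) (B : set (borelRV R d)).

Let pastY := past (fun i => Y i : Omega -> 'rV[R]_d).

Local Open Scope ereal_scope.

Lemma past_mono i j A : (i <= j)%N -> pastY i A -> pastY j A.
Proof.
move=> ij; move: A; apply: smallest_sub; first exact: smallest_sigma_algebra.
move=> _ [l li [B mB ->]]; apply: sub_sigma_algebra.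
by exists l; [exact: leq_trans ij|exists B].
Qed.

Lemma past_measurable i A : pastY i A -> measurable A.
Proof.
move: A; apply: smallest_sub; first exact: sigma_algebra_measurable.
move=> _ [l li [B mB ->]]; rewrite -[X in measurable X]setTI.
exact: measurable_funPT.
Qed.

Lemma past_preimage i j B : (i <= j)%N -> measurable B -> pastY j (Y i @^-1` B).
Proof. by move=> ij mB; apply: sub_sigma_algebra; exists i => //; exists B. Qed.

Lemma pastC i A : pastY i A -> pastY i (~` A).
Proof. by move=> pA; rewrite -setTD; exact: sigma_algebraCD. Qed.

Lemma pastI i A A' : pastY i A -> pastY i A' -> pastY i (A `&` A').
Proof.
move=> pA pA'; rewrite -[_ `&` _]setCK setCI; apply: pastC.
rewrite -bigcup2E; apply: sigma_algebra_bigcup => -[|[|l]] /=.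
- exact: pastC.
- exact: pastC.
- exact: sigma_algebra0.
Qed.

Lemma past_bigcap i (F : nat -> set Omega) n : (forall j, (j < n)%N -> pastY i (F j)) ->
  pastY i [set w | forall j, (j < n)%N -> F j w].
Proof.
elim: n => [|n IH] H.
  have -> : [set w | forall j, (j < 0)%N -> F j w] = ~` set0.
    by apply/seteqP; split=> [w _ []|w _ j].
  by apply: pastC; exact: sigma_algebra0.
have -> : [set w | forall j, (j < n.+1)%N -> F j w] =
    [set w | forall j, (j < n)%N -> F j w] `&` F n.
  apply/seteqP; split=> [w Hw|w [Hw Fn] j].
    by split=> [j jn|]; apply: Hw => //; exact: ltnW.
  by rewrite ltnS leq_eqVlt => /predU1P[->//|]; exact: Hw.
by apply: pastI; [apply: IH => j jn; apply: H; exact: ltnW|exact: H].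
Qed.

Lemma measurable_kernel_state k B : measurable B ->
  measurable_fun setT ((fun w => K (Y k w) B) : Omega -> \bar R).
Proof. by move=> mB; exact: measurableT_comp (measurable_kernel K _ mB) _. Qed.

(** The defining property of a Markov chain is the case of an indicator
function; nonnegative functions are increasing limits of simple functions. *)
Lemma integral_next_indic k A B : pastY k A -> measurable B ->
  \int[P]_(w in A) (\1_B (Y k.+1 w))%:E = \int[P]_(w in A) (\int[K (Y k w)]_z (\1_B z)%:E).
Proof.
move=> pA mB; have mA := past_measurable pA.
have mYB : measurable (Y k.+1 @^-1` B).
  by rewrite -[X in measurable X]setTI; exact: measurable_funPT.
rewrite (eq_integral (fun w => (\1_(Y k.+1 @^-1` B) w)%:E)) => [|w _]; last first.
  by rewrite !indicE; congr (_%:R%:E); apply/idP/idP; rewrite !inE.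
rewrite integral_indic//; transitivity (P (A `&` Y k.+1 @^-1` B)); first by rewrite setIC.
rewrite HY//; apply: eq_integral => w _.
by rewrite integral_indic// setIT.
Qed.

Import HBNNSimple.

(** The defining property of a Markov chain is the case of an indicator
function; nonnegative functions are increasing limits of simple functions. *)
Lemma integral_next_nnsfun k A (f : {nnsfun borelRV R d >-> R}) : pastY k A ->
  \int[P]_(w in A) (f (Y k.+1 w))%:E = \int[P]_(w in A) (\int[K (Y k w)]_z (f z)%:E).
Proof.
move=> pA; have mA := past_measurable pA.
under [in LHS]eq_integral do rewrite fimfunE -fsumEFin//.
rewrite ge0_integral_fsum//; last 2 first.
  - move=> r; apply/measurable_EFinP; apply: measurable_funTS.
    by apply: measurableT_comp => //; apply: measurableT_comp.
  - by move=> r z _; rewrite EFinM nnfun_muleindic_ge0.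
under [in RHS]eq_integral.
  move=> y _.
  under eq_integral.
    by move=> z _; rewrite fimfunE -fsumEFin//; over.
  rewrite /= ge0_integral_fsum//; last 2 first.
    - by move=> r; exact/measurable_EFinP/measurableT_comp.
    - by move=> r z _; rewrite EFinM nnfun_muleindic_ge0.
  under eq_fsbigr.
    move=> r _.
    rewrite (integralZl_indic _ (fun r => f @^-1` [set r]))//; last first.
      by move=> r0; rewrite preimage_nnfun0.
    rewrite integral_indic// setIT.
    over.
  over.
rewrite /= ge0_integral_fsum//; last 2 first.
  - move=> r; apply: measurable_funeM; apply: measurable_funTS.
    exact: measurable_kernel_state.
  - move=> n y _.
    have := mulemu_ge0 (fun n => f @^-1` [set n]).
    by apply; exact: preimage_nnfun0.
apply: eq_fsbigr => r _.
have [r0|r0] := leP 0%R r.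
  transitivity (\int[P]_(w in A) (r%:E * (\1_(f @^-1` [set r]) (Y k.+1 w))%:E)) => //.
  rewrite [RHS]ge0_integralZl//; last first.
    by apply: measurable_funTS; exact: measurable_kernel_state.
  rewrite [LHS]ge0_integralZl//; last first.
    apply/measurable_EFinP; apply: measurable_funTS.
    by apply: measurableT_comp.
  rewrite integral_next_indic//; congr (_ * _); apply: eq_integral => w _.
  by rewrite integral_indic// setIT.
rewrite [LHS]integral0_eq; last first.
  by move=> w _; rewrite preimage_nnfun0// indic0 mulr0.
by rewrite [RHS]integral0_eq// => w _; rewrite preimage_nnfun0// measure0 mule0.
Qed.

(** The defining property of a Markov chain is the case of an indicator
function; nonnegative functions are increasing limits of simple functions. *)
Lemma integral_next k A (f : borelRV R d -> \bar R) : pastY k A ->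
  (forall z, 0 <= f z) -> measurable_fun setT f ->
  \int[P]_(w in A) f (Y k.+1 w) = \int[P]_(w in A) (\int[K (Y k w)]_z f z).
Proof.
move=> pA f0 mf; have mA := past_measurable pA.
pose f_ := nnsfun_approx measurableT mf.
have fE z : f z = lim ((f_ n z)%:E @[n --> \oo]).
  by apply/esym/cvg_lim => //=; exact: cvg_nnsfun_approx.
transitivity (\int[P]_(w in A) lim ((f_ n (Y k.+1 w))%:E @[n --> \oo])).
  by apply: eq_integral => w _; exact: fE.
rewrite monotone_convergence//; last 3 first.
  - move=> n; apply/measurable_EFinP; apply: measurable_funTS.
    by apply: measurableT_comp.
  - by move=> n z _; rewrite lee_fin.
  - by move=> z _ a b ab; rewrite lee_fin; exact/lefP/nd_nnsfun_approx.
rewrite (_ : (fun _ => _) =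
    (fun n => \int[P]_(w in A) (\int[K (Y k w)]_z (f_ n z)%:E)))//; last first.
  by apply/funext => n; rewrite integral_next_nnsfun.
rewrite -monotone_convergence//; last 3 first.
- move=> n; apply: measurable_funTS.
  apply: (@measurable_fun_integral_kernel _ _ _ _ _ (fun w => K (Y k w))) => //.
  + by move=> U mU; exact: measurable_kernel_state.
  + by move=> z; rewrite lee_fin.
  + exact/measurable_EFinP.
- by move=> n y _; apply: integral_ge0 => // z _; rewrite lee_fin.
- move=> w _ a b ab; apply: ge0_le_integral => //.
  + by move=> z _; rewrite lee_fin.
  + exact/measurable_EFinP.
  + exact/measurable_EFinP.
  + by move=> z _; rewrite lee_fin; exact/lefP/nd_nnsfun_approx.
apply: eq_integral => w _; rewrite -monotone_convergence//; last 3 first.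
- by move=> n; exact/measurable_EFinP.
- by move=> n z _; rewrite lee_fin.
- by move=> z _ a b ab; rewrite lee_fin; exact/lefP/nd_nnsfun_approx.
by apply: eq_integral => z _; rewrite fE.
Qed.

Lemma chain_law_ge0 k x B : 0 <= chain_law K k x B.
Proof.
by elim: k x => [|k IH] x /=; [exact: measure_ge0|apply: integral_ge0].
Qed.

Lemma chain_law_measurable k B : measurable B ->
  measurable_fun setT ((fun x => chain_law K k x B) : borelRV R d -> \bar R).
Proof.
move=> mB; elim: k => [|k IH] /=.
  rewrite (_ : (fun _ => _) = (fun x : borelRV R d => (\1_B x : R)%:E)).
    exact/measurable_EFinP.
  by apply/funext => x; rewrite diracE indicE.
apply: (@measurable_fun_integral_kernel _ _ _ _ _ (fun x => K x)) => //.
- by move=> U mU; exact: measurable_kernel.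
- by move=> x; exact: chain_law_ge0.
Qed.

(** Induction on m with the one-step property at time k for the function
chain_law K m. *)
Lemma markov_law m k A B : pastY k A -> measurable B ->
  P (A `&` Y (k + m)%N @^-1` B) = \int[P]_(w in A) chain_law K m (Y k w) B.
Proof.
move=> pA mB; elim: m k A pA => [|m IH] k A pA; have mA := past_measurable pA.
  rewrite addn0 /=.
  have mYB : measurable (Y k @^-1` B).
    by rewrite -[X in measurable X]setTI; exact: measurable_funPT.
  rewrite (eq_integral (fun w => (\1_(Y k @^-1` B) w)%:E)) => [|w _]; last first.
    by rewrite diracE indicE; congr (_%:R%:E); apply/idP/idP; rewrite !inE.
  by rewrite integral_indic// setIC.
rewrite addnS -addSn IH; last exact: past_mono pA.
rewrite (integral_next (f := fun x => chain_law K m x B) pA)//; first exact: (chain_law_ge0 m ^~ B).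
exact: chain_law_measurable.
Qed.

(** Induction on m with the one-step property at time k for the function
chain_law K m. *)
Lemma markov_law_le m k A B (S : set (borelRV R d)) (a : R) : pastY k A -> measurable B ->
  (forall w, A w -> S (Y k w)) -> (forall x, S x -> chain_law K m x B <= a%:E) ->
  P (A `&` Y (k + m)%N @^-1` B) <= a%:E * P A.
Proof.
move=> pA mB AS Sa; have mA := past_measurable pA.
rewrite markov_law// -integral_cst//; apply: ge0_le_integral => //.
- by move=> w _; exact: chain_law_ge0.
- apply: measurable_funTS; exact: measurableT_comp (chain_law_measurable m mB) _.
- by move=> w Aw; apply: Sa; exact: AS.
Qed.

End Markov.

(** * Increments of the chain after an event of its past *)

Lemma measurable_ext dd (T : measurableType dd) (A B : set T) : measurable A ->
  (forall x, A x <-> B x) -> measurable B.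
Proof. by move=> mA AB; rewrite -(_ : A = B)//; apply/seteqP; split=> x /AB. Qed.

Section Increments.
Variables (R : realType) (d : nat).
Implicit Types (x z v : 'rV[R]_d) (e a c : R).

Lemma sum_sqr_coord_cvg (F : set_system 'rV[R]_d) x z : Filter F ->
  (forall i, (fun v : 'rV[R]_d => v ord0 i) @ F --> z ord0 i) ->
  (fun v : 'rV[R]_d => \sum_(i < d) (v - x) ord0 i ^+ 2) @ F -->
  \sum_(i < d) (z - x) ord0 i ^+ 2.
Proof.
move=> FF H; elim: (index_enum _) => [|i I IH].
  rewrite big_nil (_ : (fun _ => _) = (fun=> 0)); first exact: cvg_cst.
  by apply/funext => v; rewrite big_nil.
rewrite big_cons (_ : (fun _ => _) = (fun v : 'rV[R]_d => (v - x) ord0 i ^+ 2 +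
    \sum_(i <- I) (v - x) ord0 i ^+ 2)); last first.
  by apply/funext => v; rewrite big_cons.
apply: cvgD => //.
have c1 : (fun v : 'rV[R]_d => (v - x) ord0 i) @ F --> (z - x) ord0 i.
  rewrite (_ : (fun _ => _) = (fun v : 'rV[R]_d => v ord0 i - x ord0 i)); last first.
    by apply/funext => v; rewrite !mxE.
  by rewrite !mxE; apply: cvgB; [exact: H|exact: cvg_cst].
rewrite expr2 (_ : (fun _ => _) = (fun v : 'rV[R]_d => (v - x) ord0 i * (v - x) ord0 i)).
  exact: cvgM.
by apply/funext => v; rewrite expr2.
Qed.

Lemma measurable_enorm_gt e x : 0 <= e ->
  measurable ([set z | e < enorm (z - x)] : set (borelRV R d)).
Proof.
move=> e0; apply: sub_sigma_algebra; rewrite /open_sets /=.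
pose q (z : 'rV[R]_d) := \sum_(i < d) (z - x) ord0 i ^+ 2.
have -> : [set z | e < enorm (z - x)] = q @^-1` [set c | e ^+ 2 < c].
  apply/seteqP; split=> z /=; rewrite /enorm -/(q z) => h.
    have q0 : 0 < q z by rewrite -sqrtr_gt0; exact: le_lt_trans h.
    by move: h; rewrite -{1}(ger0_norm e0) -sqrtr_sqr ltr_sqrt.
  rewrite -(ger0_norm e0) -sqrtr_sqr ltr_sqrt//.
  by apply: le_lt_trans h; exact: sqr_ge0.
apply: open_comp; last exact: open_gt.
move=> z _; apply: (@sum_sqr_coord_cvg (nbhs z)) => i.
exact: coord_continuous.
Qed.

Lemma coord_measurable i :
  measurable_fun [set: borelRV R d] ((fun v => v ord0 i) : borelRV R d -> R).
Proof.
apply: (measurability _ (RGenCInfty.measurableE R)) => _ [_ [c ->] <-].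
apply: measurable_ext (borel_coord_ge i c) _ => v.
by rewrite setTI /= in_itv /= andbT.
Qed.

Lemma measurable_norm_gt c x : 0 <= c ->
  measurable ([set z | c < `|z - x|] : set (borelRV R d)).
Proof.
move=> c0; suff: measurable (\bigcup_(l in [set: 'I_d])
    ([set z | c < `|z ord0 l - x ord0 l|] : set (borelRV R d))).
  move/measurable_ext; apply=> z /=; split.
    move=> [l _ /= /lt_le_trans]; apply.
    by apply: le_trans (coord_le_norm _ l); rewrite !mxE.
  move=> h; apply: contrapT => none; move: h; rewrite ltNge => /negP; apply.
  apply: norm_le_coord => // l; rewrite !mxE leNgt; apply/negP => h.
  by apply: none; exists l.
apply: fin_bigcup_measurable; first exact: finite_finset.
move=> l _.
have m : measurable_fun [set: borelRV R d] ((fun z => `|z ord0 l - x ord0 l|) : borelRV R d -> R).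
  apply: measurableT_comp; first exact: normr_measurable.
  by apply: measurable_funB; [exact: coord_measurable|exact: measurable_cst].
have := m measurableT `]c, +oo[%classic (measurable_itv _).
by move/measurable_ext; apply=> z; rewrite setTI /= in_itv /= andbT.
Qed.

Lemma dist_far_close (u v x : 'rV[R]_d) e :
  3 * e < `|u - v| -> `|v - x| <= e -> 2 * e < `|u - x|.
Proof. by move=> uv vx; have := ler_distD x u v; rewrite (distrC x); lra. Qed.

Lemma dist_far_close2 (u v x : 'rV[R]_d) e :
  2 * e < `|u - x| -> `|v - x| <= e -> e < `|u - v|.
Proof. by move=> uv vx; have := ler_distD v u x; lra. Qed.

(** The cube with side e that contains v; there are countably many of these
cubes. *)
Definition cell_code e v : 'rV[int]_d := \row_i Num.floor (v ord0 i / e).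

Lemma cell_code_near e u v : 0 < e -> cell_code e u = cell_code e v -> `|u - v| <= e.
Proof.
move=> e0 uv; apply: norm_le_coord; first exact: ltW.
move=> i; rewrite !mxE.
have E : Num.floor (u ord0 i / e) = Num.floor (v ord0 i / e).
  by have := congr1 (fun A : 'rV[int]_d => A ord0 i) uv; rewrite !mxE.
have /andP[h1 h2] := floor_itv (u ord0 i / e); have /andP[h3 h4] := floor_itv (v ord0 i / e).
rewrite -E in h3 h4; rewrite intrD in h2 h4.
rewrite -[leRHS]mul1r -ler_pdivrMr// -[X in _ / X](gtr0_norm e0) -normfV -normrM mulrBl.
move: h1 h2 h3 h4; move: (u ord0 i / e) (v ord0 i / e) (_%:~R) => p q r *.
by rewrite ler_norml; apply/andP; split; lra.
Qed.

Lemma cell_code_measurable e (A : 'rV[int]_d) : 0 < e ->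
  measurable ([set v | cell_code e v = A] : set (borelRV R d)).
Proof.
move=> e0; have -> : [set v | cell_code e v = A] =
  \bigcap_(i in [set: 'I_d]) ([set v : 'rV[R]_d | (A ord0 i)%:~R * e <= v ord0 i] `\`
     [set v | (A ord0 i + 1)%:~R * e <= v ord0 i]).
  apply/seteqP; split=> [v <- i _|v Hv] /=.
    rewrite mxE; have /andP[h1 h2] := floor_itv (v ord0 i / e).
    split; first by rewrite -ler_pdivlMr.
    by apply/negP; rewrite -ltNge -ltr_pdivrMr.
  apply/rowP => i; rewrite mxE; apply: floor_def.
  have [/= h1 /negP h2] := Hv i I.
  by rewrite -ltNge -ltr_pdivrMr// in h2; rewrite ler_pdivlMr// h1.
apply: fin_bigcap_measurable; first exact: finite_finset.
by move=> i _; apply: measurableD; apply: borel_coord_ge.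
Qed.

End Increments.

Section ChainIncrements.
Variables (R : realType) (d : nat) (dO : measure_display).
Variables (Omega : measurableType dO) (P : probability Omega R).
Variables (K : R.-pker borelRV R d ~> borelRV R d).
Variables (Y : nat -> {RV P >-> borelRV R d}).
Hypothesis HY : markov_chain K Y.
Implicit Types (A E : set Omega) (e a c : R).

Let pastY := past (fun i => Y i : Omega -> 'rV[R]_d).

Lemma chain_law_le k x (B B' : set (borelRV R d)) : measurable B -> measurable B' ->
  B `<=` B' -> (chain_law K k x B <= chain_law K k x B')%E.
Proof.
move=> mB mB' BB'; elim: k x => [|k IH] x /=.
  by rewrite le_measure ?inE.
apply: ge0_le_integral => //.
- by move=> z _; exact: chain_law_ge0.
- exact: chain_law_measurable.
- exact: chain_law_measurable.
Qed.

Definition state k w : 'rV[R]_d := Y k w.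

Definition past_generators k : set (set Omega) :=
  [set A | exists2 j : nat, (j <= k)%N &
     exists2 B : set (borelRV R d), measurable B & A = Y j @^-1` B].

Local Notation past_space k := (g_sigma_algebraType (past_generators k)).

Lemma past_state_coord i k l : (i <= k)%N -> measurable_fun
  [set: past_space k]
  (fun w => state i w ord0 l).
Proof.
move=> ik; have mY : measurable_fun [set: past_space k] (Y i : Omega -> borelRV R d).
  by move=> _ B mB; rewrite setTI; exact: past_preimage.
exact: (measurableT_comp (@coord_measurable R d l) mY).
Qed.

Lemma past_state_dist i j k c : 0 <= c -> (i <= k)%N -> (j <= k)%N ->
  pastY k [set w | c < `|state i w - state j w|].
Proof.
move=> c0 ik jk.
have -> : [set w | c < `|state i w - state j w|] =
  \bigcup_(l in [set: 'I_d]) [set w | c < `|state i w ord0 l - state j w ord0 l|].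
  apply/seteqP; split=> w /=.
    move=> h; apply: contrapT => none; move: h; rewrite ltNge => /negP; apply.
    apply: norm_le_coord => // l; rewrite !mxE leNgt; apply/negP => h.
    by apply: none; exists l.
  move=> [l _ /= /lt_le_trans]; apply.
  by apply: le_trans (coord_le_norm _ l); rewrite !mxE.
suff: measurable (\bigcup_(l in [set: 'I_d])
    ([set w | c < `|state i w ord0 l - state j w ord0 l|] :
     set (past_space k))) by [].
apply: fin_bigcup_measurable; first exact: finite_finset.
move=> l _; rewrite -[X in measurable X]setTI.
have m : measurable_fun
  [set: past_space k]
  (fun w => `|state i w ord0 l - state j w ord0 l|).
  apply: measurableT_comp; first exact: normr_measurable.
  by apply: measurable_funB; exact: past_state_coord.
have := m measurableT `]c, +oo[%classic (measurable_itv _).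
by move/measurable_ext; apply=> w; rewrite /= in_itv /= andbT.
Qed.

Lemma past_state_bounded k c : 0 <= c -> pastY k [set w | enorm (state k w) <= c].
Proof.
move=> c0; have -> : [set w | enorm (state k w) <= c] =
    ~` (Y k @^-1` [set z | c < enorm (z - 0)%R]).
  apply/seteqP; split=> w /=; rewrite subr0 -/(state k w) => h; last by rewrite leNgt; apply/negP.
  by apply/negP; rewrite -leNgt.
by apply: pastC; apply: past_preimage => //; exact: measurable_enorm_gt.
Qed.

(** The assumption concerns chains that start from a fixed point, whereas Y k is
random. Cut A according to the cube of side e that contains Y k: on each piece
the starting point is known up to e, and the Markov property applies with a
fixed point. The inaccuracy e is paid at both ends of the increment, whence 3 *
e. *)
Lemma increment_le j e a rad : 0 < e ->
  (forall x : 'rV[R]_d, enorm x <= rad ->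
     (chain_law K j x [set z : 'rV[R]_d | (e < enorm (z - x))%R] <= a%:E)%E) ->
  forall k A, pastY k A -> (forall w, A w -> enorm (state k w) <= rad) ->
  (P (A `&` [set w | (3 * e < `|state (k + j) w - state k w|)%R]) <= a%:E * P A)%E.
Proof.
move=> e0 Ha k A pA Arad; have mA := past_measurable pA.
set E := [set w | _].
have e3 : 0 <= 3 * e by lra.
have pE : pastY (k + j) E by apply: past_state_dist; rewrite ?leq_addr.
have mE := past_measurable pE.
pose U i : set (borelRV R d) := [set v | pickle (cell_code e v) = i].
have mU i : measurable (U i).
  have -> : U i = \bigcup_(c in [set c | pickle c = i]) [set v | cell_code e v = c].
    by apply/seteqP; split=> [v vi|v [c <- <-]//]; exists (cell_code e v).
  have [[c ci]|none] := pselect (exists c : 'rV[int]_d, pickle c = i).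
    rewrite (_ : \bigcup_(_ in _) _ = [set v | cell_code e v = c]).
      exact: cell_code_measurable.
    apply/seteqP; split=> [v [c' /= c'i vc']|v vc]; last by exists c.
    by rewrite /= vc'; apply: (pcan_inj pickleK); rewrite c'i.
  rewrite (_ : \bigcup_(_ in _) _ = set0); first exact: measurable0.
  by apply/seteqP; split=> v // [c ci]; exfalso; apply: none; exists c.
pose F i := A `&` Y k @^-1` U i.
have pF i : pastY k (F i) by apply: pastI => //; exact: past_preimage.
have mF i : measurable (F i) := past_measurable (pF i).
have Ftriv : trivIset setT F.
  by apply/trivIsetP => i l _ _ il; apply/seteqP; split=> w // [[_ /= wi] [_ /= wl]];
    move/eqP: il; apply; rewrite -wi -wl.
have AE : A = \bigcup_i F i.
  by apply/seteqP; split=> [w Aw|w [i _ []//]]; exists (pickle (cell_code e (Y k w))).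
have step i : (P (F i `&` E) <= a%:E * P (F i))%E.
  have [[w0 Fw0]|F0] := pselect (exists w, F i w); last first.
    have -> : F i = set0 by apply/seteqP; split=> w // Fw; apply: F0; exists w.
    by rewrite set0I measure0 mule0.
  pose x0 := state k w0.
  have near w : F i w -> `|state k w - x0| <= e.
    move=> [_ /= wi]; apply: cell_code_near => //; apply: (pcan_inj pickleK).
    by have [_ /= w0i] := Fw0; rewrite wi w0i.
  have e2 : 0 <= 2 * e by lra.
  pose B : set (borelRV R d) := [set z | 2 * e < `|(z : 'rV[R]_d) - x0|].
  have mB : measurable B by exact: measurable_norm_gt.
  apply: (@le_trans _ _ (P (F i `&` Y (k + j)%N @^-1` B))).
    apply: le_measure; rewrite ?inE.
    - exact: measurableI.
    - apply: measurableI => //; rewrite -[X in measurable X]setTI.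
      exact: measurable_funPT.
    move=> w [Fw /= Ew]; split=> //; rewrite /B /= -/(state (k + j) w).
    exact: dist_far_close Ew (near w Fw).
  apply: (@markov_law_le _ _ _ _ P K Y HY j k (F i) B
    [set x | enorm (x : 'rV[R]_d) <= rad /\ `|(x : 'rV[R]_d) - x0| <= e]) => //.
  - exact: pF.
  - by move=> w Fw; split; [apply: Arad; case: Fw|exact: near].
  move=> x [xrad xx0]; apply: le_trans (Ha x xrad); apply: chain_law_le => //.
    exact: measurable_enorm_gt (ltW e0).
  move=> z; rewrite /B /= => Bz; apply: lt_le_trans (norm_le_enorm _).
  exact: dist_far_close2 Bz xx0.
rewrite {1}AE setI_bigcupl measure_bigcup//; last 2 first.
  - by move=> i _; apply: measurableI.
  - exact: trivIset_setIr.
rewrite {1}AE measure_bigcup// -nneseriesZl//.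
by apply: lee_nneseries => [i _ _|i _]; [exact: measure_ge0|exact: step].
Qed.

End ChainIncrements.

(** * Moves of a sequence of states *)

Section RealProbability.
Variables (R : realType) (dO : measure_display).
Variables (Omega : measurableType dO) (P : probability Omega R).
Implicit Types (A B E : set Omega).

Definition pr A : R := fine (P A).

Lemma prE A : measurable A -> P A = (pr A)%:E.
Proof. by move=> mA; rewrite fineK// fin_num_measure. Qed.

Lemma pr_ge0 A : 0 <= pr A.
Proof. by apply: fine_ge0; exact: measure_ge0. Qed.

Lemma pr_le A B : measurable A -> measurable B -> A `<=` B -> pr A <= pr B.
Proof.
by move=> mA mB AB; rewrite -lee_fin -!prE//; apply: le_measure; rewrite ?inE.
Qed.

Lemma pr_le1 A : measurable A -> pr A <= 1.
Proof. by move=> mA; rewrite -lee_fin -prE//; exact: probability_le1. Qed.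

Lemma pr_le_sum n (F : nat -> set Omega) E : (forall i, measurable (F i)) ->
  measurable E -> (forall w, E w -> exists2 i, (i < n)%N & F i w) ->
  pr E <= \sum_(i < n) pr (F i).
Proof.
move=> mF mE EF; rewrite -lee_fin -prE// -sumEFin.
apply: (@le_trans _ _ (P (\big[setU/set0]_(i < n) F i))).
  apply: le_measure; rewrite ?inE//; first exact: bigsetU_measurable.
  by move=> w /EF[i ni Fw]; rewrite -bigcup_mkord; exists i.
apply: le_trans (le_mu_bigsetU P (fun i _ => mF i)) _.
by apply: lee_sum => i _; rewrite -prE.
Qed.

Lemma sum_pr_le n (p : pred nat) (F : nat -> set Omega) E :
  (forall i, p i -> measurable (F i)) -> measurable E ->
  (forall i, p i -> F i `<=` E) ->
  (forall i j w, p i -> p j -> F i w -> F j w -> i = j) ->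
  \sum_(i < n | p i) pr (F i) <= pr E.
Proof.
move=> mF mE FE disj; pose F' i := if p i then F i else set0.
have mF' i : measurable (F' i).
  by rewrite /F'; case: ifP => [/mF//|_]; exact: measurable0.
have triv : trivIset setT F'.
  apply/trivIsetP => i j _ _ ij; apply/seteqP; split=> w // [].
  rewrite /F'; case: ifP => // pi; case: ifP => // pj Fi Fj.
  by move/eqP: ij; apply; exact: (disj i j w).
rewrite -lee_fin -prE// -sumEFin.
have -> : (\sum_(i < n | p i) (pr (F i))%:E = \sum_(i < n) P (F' i))%E.
  rewrite big_mkcond; apply: eq_bigr => i _; rewrite /F'.
  case: ifP => [pi|_]; last by rewrite measure0.
  by rewrite -prE//; exact: mF.
rewrite -measure_bigsetU//; apply: le_measure; rewrite ?inE//.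
  exact: bigsetU_measurable.
rewrite -bigcup_mkord => w [i _]; rewrite /F'; case: ifP => // pi.
exact: FE.
Qed.

End RealProbability.

Section PathMoves.
Variables (R : realType) (d : nat).
Implicit Types (y : nat -> 'rV[R]_d) (k i j n m N L : nat) (e rad : R).

(** The index k + i is the first one after k at which the sequence is further
than 2 * e from its value at k. The last condition keeps the next start in the
ball in which increments are controlled. *)
Definition first_move e rad y k i := [/\ 2 * e < `|y (k + i)%N - y k|,
  forall j, (j < i)%N -> `|y (k + j)%N - y k| <= 2 * e & enorm (y (k + i)%N) <= rad].

(** L successive first moves, each counted from the preceding one, during the N
steps after k. *)
Fixpoint many_moves e rad y L k N : Prop :=
  if L is L'.+1 then exists2 i, (i <= N)%N &
    first_move e rad y k i /\ many_moves e rad y L' (k + i) (N - i)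
  else True.

(** Among the first L successive moves after k, one comes at most m steps after
the preceding one. *)
Fixpoint close_moves e rad m y L k N : Prop :=
  if L is L'.+1 then exists2 i, (i <= N)%N &
    first_move e rad y k i /\
    ((i <= m)%N \/ close_moves e rad m y L' (k + i) (N - i))
  else False.

Lemma first_move_uniq e rad y k i j :
  first_move e rad y k i -> first_move e rad y k j -> i = j.
Proof.
move=> [i1 i2 _] [j1 j2 _]; case: (ltngtP i j) => // [/j2|/i2].
- by rewrite leNgt i1.
- by rewrite leNgt j1.
Qed.

Lemma first_move_exists e rad y k N : (forall i, (i <= N)%N -> enorm (y (k + i)%N) <= rad) ->
  (exists2 i, (i <= N)%N & first_move e rad y k i) \/
  (forall i, (i <= N)%N -> `|y (k + i)%N - y k| <= 2 * e).
Proof.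
move=> bd; have [ex|none] := pselect (exists i, (i <= N)%N && (2 * e < `|y (k + i)%N - y k|)).
  left; case: (ex_minnP ex) => i /andP[iN yi] imin; exists i => //; split=> //.
    move=> j ji; rewrite leNgt; apply/negP => yj.
    have := imin j; rewrite yj (leq_trans (ltnW ji) iN) => /(_ isT).
    by rewrite leqNgt ji.
  exact: bd.
right=> i iN; rewrite leNgt; apply/negP => yi; apply: none; exists i.
by rewrite iN.
Qed.

(** Cut the sequence at its successive first moves. By the first assumption
there are fewer than L of them, which ends the induction, and by the second one
they are more than m steps apart. *)
Lemma quiet_cells e rad m y L k N : 0 <= e ->
  (forall i, (i <= N)%N -> enorm (y (k + i)%N) <= rad) ->
  ~ many_moves e rad y L k N -> ~ close_moves e rad m y L k N ->
  exists Q : seq nat, [/\ k \in Q, {in Q, forall q, (k <= q <= k + N)%N},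
    {in Q &, forall p q, (p < q)%N -> (p + m < q)%N} &
    forall i j, (k <= i)%N -> (i <= j)%N -> (j <= k + N)%N ->
      {in Q, forall q, ~~ (i < q <= j)%N} -> `|y i - y j| <= 4 * e].
Proof.
move=> e0; elim: L k N => [|L IH] k N bd nmany nclose; first by case: nmany.
have tri i j : `|y i - y k| <= 2 * e -> `|y j - y k| <= 2 * e -> `|y i - y j| <= 4 * e.
  by move=> ? ?; have := ler_distD (y k) (y i) (y j); rewrite (distrC (y k)); lra.
have [[i iN fi]|quiet] := first_move_exists e bd; last first.
  exists [:: k]; split.
  - exact: mem_head.
  - by move=> q; rewrite inE => /eqP ->; rewrite leqnn leq_addr.
  - by move=> p q; rewrite !inE => /eqP -> /eqP ->; rewrite ltnn.
  - move=> i j ki ij jN _; apply: tri.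
      by rewrite -(subnKC ki); apply: quiet; lia.
    by rewrite -(subnKC (leq_trans ki ij)); apply: quiet; lia.
have kiN : (k + i + (N - i))%N = (k + N)%N by lia.
have [|||Q [kQ Qin Qgap Qosc]] := IH (k + i)%N (N - i)%N.
- by move=> j jN; rewrite -addnA; apply: bd; lia.
- by move=> h; apply: nmany; exists i.
- by move=> h; apply: nclose; exists i => //; split=> //; right.
have im : (m < i)%N.
  by rewrite ltnNge; apply/negP => h; apply: nclose; exists i => //; split=> //; left.
exists (k :: Q); split.
- exact: mem_head.
- move=> q; rewrite inE => /predU1P[->|/Qin]; last by lia.
  by rewrite leqnn leq_addr.
- move=> p q; rewrite !inE => /predU1P[->|pQ] /predU1P[->|qQ].
  + by rewrite ltnn.
  + by have := Qin q qQ; lia.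
  + by have := Qin p pQ; lia.
  + exact: Qgap.
- move=> a b ka ab bN H.
  have [kia|aki] := leqP (k + i) a.
    by apply: Qosc => // [|q qQ]; [rewrite kiN|apply: H; rewrite inE qQ orbT].
  have [kib|bki] := leqP (k + i) b.
    by have := H (k + i)%N; rewrite inE kQ orbT aki kib => /(_ isT).
  have [_ quiet _] := fi; apply: tri.
    by rewrite -(subnKC ka); apply: quiet; lia.
  by rewrite -(subnKC (leq_trans ka ab)); apply: quiet; lia.
Qed.

(** From the cutting indices of quiet_cells drop those less than m steps before
n, and add n. This merges at most two cells, since the sequence is quiet during
its last m steps. *)
Lemma quiet_regular e rad m y L n : 0 <= e -> (0 < m)%N -> (m <= n)%N ->
  (forall i, (i <= n)%N -> enorm (y i) <= rad) ->
  ~ many_moves e rad y L 0 n -> ~ close_moves e rad m y L 0 n ->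
  (forall i, (i <= m)%N -> `|y (n - m + i)%N - y (n - m)%N| <= 2 * e) ->
  (forall a, a * n%:R <= m%:R -> regular_sequence (8 * e) a n y) /\
  `|y n - y n.-1| <= 4 * e.
Proof.
move=> e0 m0 mn bd nmany nclose quiet.
have [Q [kQ Qin Qgap Qosc]] := quiet_cells e0 bd nmany nclose.
have late i j : (n - m <= i)%N -> (i <= n)%N -> (n - m <= j)%N -> (j <= n)%N ->
    `|y i - y j| <= 4 * e.
  move=> i1 i2 j1 j2.
  have := quiet (i - (n - m))%N; have := quiet (j - (n - m))%N.
  rewrite !subnKC// => hj hi; have {}hi : `|y i - y (n - m)%N| <= 2 * e by apply: hi; lia.
  have {}hj : `|y j - y (n - m)%N| <= 2 * e by apply: hj; lia.
  have := ler_distD (y (n - m)%N) (y i) (y j); rewrite (distrC (y (n - m)%N)); lra.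
split; last by apply: late; lia.
move=> a am; exists (n :: [seq q <- Q | (q + m <= n)%N]); split.
- by rewrite inE mem_filter kQ add0n mn orbT.
- exact: mem_head.
- by move=> q; rewrite inE mem_filter => /predU1P[->//|/andP[_ /Qin]]; lia.
- move=> i j; rewrite !inE !mem_filter.
  move=> /predU1P[->|/andP[im iQ]] /predU1P[->|/andP[jm jQ]] ij.
  + by rewrite ltnn in ij.
  + by lia.
  + by apply: (@le_trans _ _ (i%:R + m%:R)); rewrite ?lerD2l// -natrD ler_nat.
  + apply: (@le_trans _ _ (i%:R + m%:R)); rewrite ?lerD2l// -natrD ler_nat ltnW//.
    exact: Qgap.
move=> i j ij jn H.
have [ex|none] := pselect (exists q, (q \in Q) && (i < q <= j)%N); last first.
  apply: (@le_trans _ _ (4 * e)); last lra.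
  apply: Qosc => //; first by lia.
  by move=> q qQ; apply/negP => h; apply: none; exists q; rewrite qQ.
case: (ex_minnP ex) => q /andP[qQ /andP[iq qj]] qmin.
have qm : (n < q + m)%N.
  rewrite ltnNge; apply/negP => h; have := H q; rewrite iq qj inE mem_filter h qQ orbT.
  by move=> /(_ isT).
have h1 : `|y i - y q.-1| <= 4 * e.
  apply: Qosc; try lia.
  move=> p pQ; apply/negP => /andP[ip pq].
  by have := qmin p; rewrite pQ ip /=; lia.
have h2 : `|y q.-1 - y j| <= 4 * e by apply: late; lia.
have := ler_distD (y q.-1) (y i) (y j); lra.
Qed.

End PathMoves.

(** * Probability of many moves and of close moves *)

Section ChainMoves.
Variables (R : realType) (d : nat) (dO : measure_display).
Variables (Omega : measurableType dO) (P : probability Omega R).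
Variables (K : R.-pker borelRV R d ~> borelRV R d).
Variables (Y : nat -> {RV P >-> borelRV R d}).
Hypothesis HY : markov_chain K Y.
Implicit Types (A E : set Omega) (e a c rad : R) (k i j n m N L : nat).

Let pastY := past (fun i => Y i : Omega -> 'rV[R]_d).
Local Notation pr := (pr P).
Local Notation path w := (fun i => state Y i w).

Definition bounded_past rad k A :=
  pastY k A /\ (forall w, A w -> enorm (state Y k w) <= rad).

Definition moves_at e rad k i := [set w | first_move e rad (path w) k i].

Lemma past_moves_at e rad k i : 0 <= e -> 0 <= rad -> pastY (k + i) (moves_at e rad k i).
Proof.
move=> e0 rad0; have e2 : 0 <= 2 * e by rewrite mulr_ge0.
have -> : moves_at e rad k i =
  [set w | 2 * e < `|state Y (k + i) w - state Y k w|] `&`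
  ([set w | forall j, (j < i)%N -> (~` [set w | 2 * e < `|state Y (k + j) w - state Y k w|]) w]
   `&` [set w | enorm (state Y (k + i) w) <= rad]).
  apply/seteqP; split=> w.
    move=> [h1 h2 h3]; split=> //; split=> // j /h2; rewrite leNgt => /negP.
    exact.
  by move=> [h1 [h2 h3]]; split=> // j /h2 /= /negP; rewrite -leNgt.
apply: pastI; first by apply: past_state_dist; rewrite ?leq_addr.
apply: pastI; last exact: past_state_bounded.
apply: past_bigcap => j ji; apply: pastC.
by apply: past_state_dist; rewrite ?leq_add2l ?leq_addr// ltnW.
Qed.

Lemma bounded_past_moves e rad k i A : 0 <= e -> 0 <= rad -> bounded_past rad k A ->
  bounded_past rad (k + i) (A `&` moves_at e rad k i).
Proof.
move=> e0 rad0 [pA _]; split; last by move=> w [_ []].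
by apply: pastI; [apply: past_mono pA; exact: leq_addr|exact: past_moves_at].
Qed.

Definition small_increments e a rad m := forall j k A, (j <= m)%N -> bounded_past rad k A ->
  pr (A `&` [set w | e < `|state Y (k + j) w - state Y k w|]) <= a * pr A.

Lemma bounded_past_measurable rad k A : bounded_past rad k A -> measurable A.
Proof. by move=> [/past_measurable]. Qed.

Lemma measurable_state_dist i j c : 0 <= c ->
  measurable [set w | c < `|state Y i w - state Y j w|].
Proof.
move=> c0; apply: (@past_measurable _ _ _ _ P Y (maxn i j)).
by apply: past_state_dist; rewrite ?leq_maxl ?leq_maxr.
Qed.

Lemma sum_moves_le e rad k A n : 0 <= e -> 0 <= rad -> bounded_past rad k A ->
  \sum_(i < n) pr (A `&` moves_at e rad k i) <= pr A.
Proof.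
move=> e0 rad0 HA; have mA := bounded_past_measurable HA.
apply: (@sum_pr_le _ _ _ P n xpredT (fun i => A `&` moves_at e rad k i)) => //.
- by move=> i _; exact: bounded_past_measurable (bounded_past_moves i e0 rad0 HA).
- by move=> i j w _ _ [_ wi] [_ wj]; exact: first_move_uniq wi wj.
Qed.

(** This is the argument of Ottaviani. If the first move happens at k + i with i
<= m, then at time k + m the sequence is further than e from its value at k or
from its value at k + i. The first case has probability at most a by assumption,
and so has the second one by the assumption applied to the event that the first
move happens at k + i. *)
Lemma early_moves_le e a rad m k A n : 0 <= e -> 0 <= rad -> 0 <= a ->
  small_increments e a rad m -> bounded_past rad k A ->
  \sum_(i < n | (i <= m)%N) pr (A `&` moves_at e rad k i) <= 2 * a * pr A.
Proof.
move=> e0 rad0 a0 inc HA; have mA := bounded_past_measurable HA.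
pose G i := A `&` moves_at e rad k i.
have HG i : bounded_past rad (k + i) (G i) := bounded_past_moves i e0 rad0 HA.
have mG i := bounded_past_measurable (HG i).
pose E1 := [set w | e < `|state Y (k + m) w - state Y k w|].
pose E2 i := [set w | e < `|state Y (k + m) w - state Y (k + i) w|].
have mE1 : measurable E1 by exact: measurable_state_dist.
have mE2 i : measurable (E2 i) by exact: measurable_state_dist.
have split i : pr (G i) <= pr (G i `&` E1) + pr (G i `&` E2 i).
  pose F l := if l == 0%N then G i `&` E1 else G i `&` E2 i.
  have -> : pr (G i `&` E1) + pr (G i `&` E2 i) = \sum_(l < 2) pr (F l).
    by rewrite !big_ord_recr big_ord0 /= add0r.
  apply: pr_le_sum => //.
    by move=> l; rewrite /F; case: ifP => _; apply: measurableI.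
  move=> w Gw; have [_ [far _ _]] := Gw.
  have [h|h] := ltP e `|state Y (k + m) w - state Y k w|; first by exists 0%N.
  exists 1%N => //; split=> //=; rewrite /E2 /=.
  have := ler_distD (state Y (k + m) w) (state Y (k + i) w) (state Y k w).
  by rewrite (distrC (state Y (k + i) w) (state Y (k + m) w)); lra.
have sum1 : \sum_(i < n | (i <= m)%N) pr (G i `&` E1) <= a * pr A.
  apply: le_trans (inc m k A (leqnn m) HA); apply: (@sum_pr_le _ _ _ P n (fun i => (i <= m)%N) (fun i => G i `&` E1)).
  - by move=> i _; apply: measurableI.
  - by apply: measurableI.
  - by move=> i _ w [[Aw _] Ew].
  - by move=> i j w _ _ [[_ wi] _] [[_ wj] _]; exact: first_move_uniq wi wj.
have sum2 : \sum_(i < n | (i <= m)%N) pr (G i `&` E2 i) <= a * pr A.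
  apply: (@le_trans _ _ (\sum_(i < n | (i <= m)%N) a * pr (G i))).
    apply: ler_sum => i im; have := inc (m - i)%N (k + i)%N (G i) (leq_subr _ _) (HG i).
    by rewrite -addnA subnKC.
  rewrite -mulr_sumr ler_wpM2l//; apply: (@sum_pr_le _ _ _ P n (fun i => (i <= m)%N) G) => //.
  - by move=> i _ w [].
  - by move=> i j w _ _ [_ wi] [_ wj]; exact: first_move_uniq wi wj.
apply: (@le_trans _ _ (\sum_(i < n | (i <= m)%N) (pr (G i `&` E1) + pr (G i `&` E2 i)))).
  by apply: ler_sum => i _; exact: split.
by rewrite big_split /=; lra.
Qed.

Definition many_moves_event e rad L k N := [set w | many_moves e rad (path w) L k N].

Definition close_moves_event e rad m L k N := [set w | close_moves e rad m (path w) L k N].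

Lemma moves_at_measurable e rad k i : 0 <= e -> 0 <= rad -> measurable (moves_at e rad k i).
Proof. by move=> e0 rad0; apply: past_measurable; exact: past_moves_at. Qed.

Lemma many_moves_measurable e rad L k N : 0 <= e -> 0 <= rad ->
  measurable (many_moves_event e rad L k N).
Proof.
move=> e0 rad0; elim: L k N => [|L IH] k N.
  rewrite (_ : many_moves_event _ _ _ _ _ = setT) //.
rewrite (_ : many_moves_event _ _ _ _ _ = \bigcup_(i in [set i | (i <= N)%N])
    (moves_at e rad k i `&` many_moves_event e rad L (k + i) (N - i)))//.
apply: bigcup_measurable => i _; apply: measurableI => //.
exact: moves_at_measurable.
Qed.

Lemma close_moves_measurable e rad m L k N : 0 <= e -> 0 <= rad ->
  measurable (close_moves_event e rad m L k N).
Proof.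
move=> e0 rad0; elim: L k N => [|L IH] k N.
  rewrite (_ : close_moves_event _ _ _ _ _ _ = set0) //.
rewrite (_ : close_moves_event _ _ _ _ _ _ = \bigcup_(i in [set i | (i <= N)%N])
    (moves_at e rad k i `&`
     ([set w | (i <= m)%N] `|` close_moves_event e rad m L (k + i) (N - i))))//.
apply: bigcup_measurable => i _; apply: measurableI; first exact: moves_at_measurable.
apply: measurableU => //; case: (i <= m)%N.
  by rewrite (_ : [set _ | _] = setT)//; apply/seteqP; split.
by rewrite (_ : [set _ | _] = set0)//; apply/seteqP; split.
Qed.

(** Induction on L. A first move within m steps has probability at most 1 / 4; a
later one uses up m of the N steps, which lowers the exponent of 4 by one. In
both cases the bound for L - 1 moves is multiplied by 1 / 4, and the two cases
add up to a factor 1 / 2. *)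
Lemma many_moves_pr e rad m L k N A : 0 <= e -> 0 <= rad -> (0 < m)%N ->
  small_increments e (8^-1) rad m -> bounded_past rad k A ->
  pr (A `&` many_moves_event e rad L k N) <= 4 ^+ (N %/ m) / 2 ^+ L * pr A.
Proof.
move=> e0 rad0 m0 inc; elim: L k N A => [|L IH] k N A HA.
  have mA := bounded_past_measurable HA.
  rewrite expr0 divr1 -[leLHS]mul1r; apply: ler_pM => //; first exact: pr_ge0.
    by rewrite exprn_ege1// ler1n.
  by apply: pr_le; [apply: measurableI => //; exact: many_moves_measurable|by []|move=> w []].
have mA := bounded_past_measurable HA.
pose G i := A `&` moves_at e rad k i.
have HG i : bounded_past rad (k + i) (G i) := bounded_past_moves i e0 rad0 HA.
have mG i := bounded_past_measurable (HG i).
pose F i := G i `&` many_moves_event e rad L (k + i) (N - i).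
have mF i : measurable (F i) by apply: measurableI => //; exact: many_moves_measurable.
pose c : R := 4 ^+ (N %/ m) / 2 ^+ L.
have c0 : 0 <= c by rewrite divr_ge0// exprn_ge0.
apply: (@le_trans _ _ (\sum_(i < N.+1) pr (F i))).
  apply: pr_le_sum => //.
    by apply: measurableI => //; exact: many_moves_measurable.
  by move=> w [Aw [i iN [wi wL]]]; exists i.
apply: (@le_trans _ _ (\sum_(i < N.+1) (c * (if (i <= m)%N then pr (G i) else 0) + c / 4 * pr (G i)))).
  apply: ler_sum => i _; have g0 : 0 <= pr (G i) := pr_ge0 _ _.
  apply: (le_trans (IH _ _ _ (HG i))); case: ifP => im.
    have h : 4 ^+ ((N - i) %/ m) / 2 ^+ L * pr (G i) <= c * pr (G i).
      apply: ler_wpM2r => //; apply: ler_wpM2r; first by rewrite invr_ge0 exprn_ge0.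
      by rewrite ler_eXn2l ?ltr1n// leq_div2r// leq_subr.
    apply: (le_trans h); rewrite lerDl mulr_ge0// divr_ge0//.
  rewrite mulr0 add0r; apply: ler_wpM2r => //; rewrite /c mulrAC.
  apply: ler_wpM2r; first by rewrite invr_ge0 exprn_ge0.
  rewrite ler_pdivlMr// -exprSr ler_eXn2l ?ltr1n//.
  have mi : (m < i)%N by rewrite ltnNge im.
  have iN : (i <= N)%N by rewrite -ltnS.
  have -> : (N %/ m)%N = ((N - m) %/ m).+1.
    have mN : (m <= N)%N by apply: leq_trans iN; exact: ltnW.
    by rewrite -{1}(subnKC mN) -{1}[m]mul1n divnMDl// add1n.
  by rewrite ltnS leq_div2r// leq_sub2l// ltnW.
rewrite big_split /= -!mulr_sumr -big_mkcond.
have h1 := early_moves_le N.+1 e0 rad0 (_ : 0 <= 8^-1) inc HA.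
have {}h1 : \sum_(i < N.+1 | (i <= m)%N) pr (G i) <= 4^-1 * pr A.
  apply: le_trans (h1 _) _; first by rewrite invr_ge0.
  by rewrite le_eqVlt; apply/orP; left; apply/eqP; field.
have h2 : \sum_(i < N.+1) pr (G i) <= pr A := sum_moves_le N.+1 e0 rad0 HA.
apply: (@le_trans _ _ (c * (4^-1 * pr A) + c / 4 * pr A)).
  by apply: lerD; apply: ler_wpM2l => //; rewrite divr_ge0.
rewrite le_eqVlt; apply/orP; left; apply/eqP; rewrite /c exprS.
by field; rewrite expf_neq0.
Qed.

(** Each of the L moves is followed within m steps with probability at most 2 *
a, by early_moves_le. *)
Lemma close_moves_pr e a rad m L k N A : 0 <= e -> 0 <= rad -> 0 <= a ->
  small_increments e a rad m -> bounded_past rad k A ->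
  pr (A `&` close_moves_event e rad m L k N) <= L%:R * (2 * a) * pr A.
Proof.
move=> e0 rad0 a0 inc; elim: L k N A => [|L IH] k N A HA; have mA := bounded_past_measurable HA.
  rewrite (_ : close_moves_event _ _ _ _ _ _ = set0)// setI0 mul0r mul0r.
  by rewrite /pr measure0.
pose G i := A `&` moves_at e rad k i.
have HG i : bounded_past rad (k + i) (G i) := bounded_past_moves i e0 rad0 HA.
have mG i := bounded_past_measurable (HG i).
pose T i := [set w : Omega | (i <= m)%N] `|` close_moves_event e rad m L (k + i) (N - i).
have mT i : measurable (T i).
  apply: measurableU; last exact: close_moves_measurable.
  case: (i <= m)%N.
    by rewrite (_ : [set _ | _] = setT)//; apply/seteqP; split.
  by rewrite (_ : [set _ | _] = set0)//; apply/seteqP; split.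
pose F i := G i `&` T i.
have mF i : measurable (F i) by apply: measurableI.
have b0 : 0 <= L%:R * (2 * a) by rewrite !mulr_ge0.
apply: (@le_trans _ _ (\sum_(i < N.+1) pr (F i))).
  apply: pr_le_sum => //.
    by apply: measurableI => //; exact: close_moves_measurable.
  by move=> w [Aw [i iN [wi wL]]]; exists i.
apply: (@le_trans _ _ (\sum_(i < N.+1) ((if (i <= m)%N then pr (G i) else 0) +
    L%:R * (2 * a) * pr (G i)))).
  apply: ler_sum => i _; have g0 : 0 <= pr (G i) := pr_ge0 _ _.
  case: ifP => im.
    apply: (@le_trans _ _ (pr (G i))); last by rewrite lerDl mulr_ge0.
    by apply: pr_le => // w [].
  rewrite add0r; apply: le_trans (IH _ (N - i)%N _ (HG i)); apply: pr_le => //.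
    by apply: measurableI => //; exact: close_moves_measurable.
  by move=> w [Gw [|]] //=; rewrite im.
rewrite big_split /= -mulr_sumr -big_mkcond.
have h1 : \sum_(i < N.+1 | (i <= m)%N) pr (G i) <= 2 * a * pr A :=
  early_moves_le N.+1 e0 rad0 a0 inc HA.
have h2 : \sum_(i < N.+1) pr (G i) <= pr A := sum_moves_le N.+1 e0 rad0 HA.
apply: (@le_trans _ _ (2 * a * pr A + L%:R * (2 * a) * pr A)).
  by apply: lerD => //; apply: ler_wpM2l.
by rewrite -natr1 le_eqVlt; apply/orP; left; apply/eqP; ring.
Qed.

End ChainMoves.

(** * Regularity of the chain off a small event *)

Lemma limn_esup_lt (R : realType) (u : (\bar R)^nat) (a : \bar R) : (limn_esup u < a)%E ->
  exists N, forall n, (N <= n)%N -> (u n <= a)%E.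
Proof.
move=> /ereal_inf_lt[_ [V [N _ NV] <-] /ltW ua]; exists N => n Nn.
by apply: le_trans ua; apply: ereal_sup_ubound; exists n => //; exact: NV.
Qed.

Section Tightness.
Variables (R : realType) (d : nat) (dO : measure_display).
Variables (Omega : measurableType dO) (P : probability Omega R).
Variables (K : nat -> R.-pker borelRV R d ~> borelRV R d).
Variables (Y : nat -> nat -> {RV P >-> borelRV R d}).
Implicit Types (e a c h rad eta : R).
Local Notation pr := (pr P).

Lemma small_time_law e rad a c : small_time_condition K -> 0 < e -> 0 < rad -> 0 < a -> 0 < c ->
  exists2 h, 0 < h <= c & exists N, forall n, (N <= n)%N ->
    forall j (x : 'rV[R]_d), j%:R <= h * n%:R -> enorm x <= rad ->
      (chain_law (K n) j x [set z : 'rV[R]_d | (e < enorm (z - x))%R] <= a%:E)%E.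
Proof.
move=> hi e0 rad0 a0 c0; have rad1 : 0 < rad + 1 by rewrite addr_gt0.
have := hi e (rad + 1) e0 rad1; set F := fun _ => _ => hF.
have Fa : \forall h \near (0 : R)^'+, (F h < a%:E)%E.
  have : nbhs (0 : \bar R) [set v | (v < a%:E)%E] by apply: open_ereal_lt'; rewrite lte_fin.
  by move/hF.
have near_h : \forall h \near (0 : R)^'+, 0 < h <= c.
  by near=> h; apply/andP; split; near: h; [exact: nbhs_right_gt|exact: nbhs_right_le].
have [h [hc /limn_esup_lt[N HN]]] := filter_ex (filterI near_h Fa).
have h0 : 0 <= h by case/andP: hc => /ltW.
exists h => //; exists N => n Nn j x jh xrad; apply: le_trans (HN n Nn).
apply: ereal_sup_ubound; exists x, (j%:R / n%:R).
have [n0|n0] := posnP n.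
  have j0 : j = 0%N by move: jh; rewrite n0 mulr0 lern0 => /eqP.
  rewrite j0 n0 mul0r mul0r truncn0; split=> //; first by lra.
  by rewrite lexx.
have n0' : (0 : R) < n%:R by rewrite ltr0n.
rewrite divfK ?gt_eqF// natrK; split=> //; first by lra.
by rewrite divr_ge0//= ler_pdivrMr.
Unshelve. all: by end_near.
Qed.

Lemma law_small_increments n e a rad m : markov_chain (K n) (Y n) -> 0 < e ->
  (forall j (x : 'rV[R]_d), (j <= m)%N -> enorm x <= rad ->
     (chain_law (K n) j x [set z : 'rV[R]_d | (e < enorm (z - x))%R] <= a%:E)%E) ->
  small_increments (Y n) (3 * e) a rad m.
Proof.
move=> HY e0 Ha j k A jm HA; have mA := bounded_past_measurable HA.
have [pA Arad] := HA.
have mE := measurable_state_dist (Y n) (k + j) k (ltW (_ : 0 < 3 * e)).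
have e3 : 0 < 3 * e by rewrite mulr_gt0.
have := increment_le HY e0 (fun x => Ha j x jm) pA Arad.
by rewrite prE ?[P A]prE// -?EFinM ?lee_fin//; apply: measurableI => //; exact: mE.
Qed.

Definition exceeds rad n := [set w | exists2 i, (i <= n)%N & rad < enorm (state (Y n) i w)].

(** The integer parts of t * n for t in [0, 1] are the integers from 0 to n. *)
Lemma exceeds_sup01 rad n : (0 < n)%N -> exceeds rad n =
  [set w | (rad%:E < sup01 (fun t : R =>
     enorm (Y n (Num.truncn (t * n%:R * 1%:R)) w : 'rV[R]_d)))%E].
Proof.
move=> n0; have n0' : (0 : R) < n%:R by rewrite ltr0n.
apply/seteqP; split=> w /=.
  move=> [i i_n wi]; apply: (@lt_le_trans _ _ (enorm (state (Y n) i w))%:E).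
    by rewrite lte_fin.
  apply: ereal_sup_ubound; exists (i%:R / n%:R).
    by rewrite /= in_itv /= divr_ge0//= ler_pdivrMr// mul1r ler_nat.
  by rewrite mulr1 divfK ?gt_eqF// natrK.
move=> /ereal_sup_gt[_ [t + <-]]; rewrite lte_fin /= in_itv /= mulr1 => /andP[t0 t1] rt.
exists (Num.truncn (t * n%:R)) => //; rewrite -ltnS truncn_lt_nat ?mulr_ge0//.
apply: (@le_lt_trans _ _ n%:R); last by rewrite ltr_nat.
by rewrite -[leRHS]mul1r ler_wpM2r.
Qed.

Lemma exceeds_measurable rad n : 0 <= rad -> measurable (exceeds rad n).
Proof.
move=> rad0; apply: (@past_measurable _ _ _ _ P (Y n) n).
have -> : exceeds rad n = ~` [set w | forall i, (i < n.+1)%N ->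
    [set w | enorm (state (Y n) i w) <= rad] w].
  apply/seteqP; split=> w.
    by move=> [i i_n wi] /(_ i i_n) /=; rewrite leNgt wi.
  move=> /= H; apply: contrapT => none; apply: H => i i_n; rewrite leNgt.
  by apply/negP => wi; apply: none; exists i.
apply: pastC; apply: past_bigcap => i i_n.
apply: (@past_mono _ _ _ _ P (Y n) i n) => //.
exact: past_state_bounded.
Qed.

Lemma compact_containment_exceeds eta : compact_containment_condition Y -> 0 < eta ->
  exists2 rad, 0 < rad & forall n, (0 < n)%N -> pr (exceeds rad n) <= eta.
Proof.
move=> hii eta0; have [rad rad0 H] := hii eta 1%N eta0 isT.
exists rad => // n n0; rewrite -lee_fin -prE; last exact: exceeds_measurable (ltW rad0).
rewrite exceeds_sup01//; apply/ltW; apply: le_lt_trans H.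
by apply: ereal_sup_ubound; exists n.
Qed.

Lemma pr_leU A B : measurable A -> measurable B -> pr (A `|` B) <= pr A + pr B.
Proof.
move=> mA mB; rewrite -lee_fin EFinD -!prE//; last exact: measurableU.
exact: measureU2.
Qed.

Lemma scaled_truncn h n m : 0 < h -> h <= 1 -> h^-1 <= n%:R -> m = Num.truncn (h * n%:R) ->
  [/\ (0 < m)%N, (m <= n)%N, m%:R <= h * n%:R & h / 2 * n%:R <= m%:R].
Proof.
move=> h0 h1 hn ->.
have hn1 : 1 <= h * n%:R by rewrite mulrC -ler_pdivrMr// div1r.
have hn0 : 0 <= h * n%:R by apply: le_trans hn1.
have /andP[l u] := truncn_itv hn0.
have m1 : (1 : R) <= (Num.truncn (h * n%:R))%:R by rewrite ler1n truncn_gt0.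
split=> //; first by rewrite truncn_gt0.
  rewrite -(ler_nat R); apply: le_trans l _; rewrite -[leRHS]mul1r.
  exact: ler_wpM2r.
have -> : h / 2 * n%:R = h * n%:R / 2 by rewrite mulrAC.
by move: u m1; rewrite -natr1; move: (h * n%:R) => q; move: (Num.truncn q)%:R => p; lra.
Qed.

(** The constants are chosen in this order. Compact containment gives the radius
rad. The small time condition with probability 1 / 8 gives a block length h1 *
n; as there are at most q blocks, some L makes L moves unlikely. Only then the
small time condition is used with a probability a2 small compared with 1 / L,
which gives the length m2 of the blocks that contain at most one move. The
exceptional event consists of the paths that leave the ball, make L moves, make
two moves within m2 steps, or move during the last m2 steps; each part has
probability at most eta / 4. *)
Lemma tightness e eta c : (forall n, (0 < n)%N -> markov_chain (K n) (Y n)) ->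
  small_time_condition K -> compact_containment_condition Y ->
  0 < e -> 0 < eta -> 0 < c -> exists2 a, 0 < a <= c & exists N, forall n, (N <= n)%N ->
  exists2 B : set Omega, measurable B /\ pr B <= eta & forall w, ~ B w ->
    regular_sequence e a n (fun i => state (Y n) i w) /\
    `|state (Y n) n w - state (Y n) n.-1 w| <= e.
Proof.
move=> hY hi hii e0 eta0 c0.
have [rad rad0 Hrad] : exists2 rad, 0 < rad & forall n, (0 < n)%N -> pr (exceeds rad n) <= eta / 4.
  by apply: compact_containment_exceeds => //; rewrite divr_gt0.
(* quiet_regular turns the threshold b into the oscillation 8 * b, and
increment_le bounds increments larger than three times its threshold *)
pose b := e / 8; have b0 : 0 < b by rewrite divr_gt0.
have b30 : 0 < b / 3 by rewrite divr_gt0.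
have bE : 3 * (b / 3) = b by rewrite mulrC divfK.
have v8 : (0 : R) < 8^-1 by rewrite invr_gt0.
have [h1 /andP[h10 h11] [N1 HN1]] := small_time_law hi b30 rad0 v8 ltr01.
(* a bound on the number of blocks of length m1 in n steps, since m1 is at least
h1 * n / 2 *)
pose q := (Num.truncn (2 / h1)).+1.
pose L := (Num.truncn (4 ^+ q * 4 / eta)).+1.
have L0 : (0 : R) < L%:R by rewrite ltr0n.
have qL : 4 ^+ q / 2 ^+ L <= eta / 4.
  have hL : 4 ^+ q * 4 / eta <= L%:R by rewrite ltW// real_truncnS_gt ?num_real.
  have hL2 : (L%:R : R) <= 2 ^+ L by rewrite -natrX ler_nat ltnW// ltn_expl.
  rewrite ler_pdivrMr ?exprn_gt0// mulrAC ler_pdivlMr// -ler_pdivrMl//.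
  by rewrite mulrC; exact: le_trans hL2.
pose a2 := eta / (8 * L%:R); have a20 : 0 < a2 by rewrite divr_gt0 ?mulr_gt0.
have a2E : L%:R * (2 * a2) = eta / 4.
  by rewrite /a2; field; rewrite gt_eqF.
have a2le : 2 * a2 <= eta / 4.
  by rewrite -a2E; apply: ler_peMl; [rewrite mulr_ge0// ltW|rewrite ler1n].
have cc : 0 < Num.min 1 c by rewrite lt_min ltr01.
have [h2 /andP[h20 h2c] [N2 HN2]] := small_time_law hi b30 rad0 a20 cc.
have /andP[h21 h2c'] : (h2 <= 1) && (h2 <= c) by rewrite -le_min.
exists (h2 / 2); first by rewrite divr_gt0//=; apply: le_trans h2c'; lra.
exists (maxn (maxn N1 N2) (maxn (Num.truncn h1^-1).+1 (Num.truncn h2^-1).+1)) => n.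
rewrite !geq_max => /andP[/andP[nN1 nN2] /andP[nh1 nh2]].
have n0 : (0 < n)%N by apply: leq_trans nh1.
have inv_le h : (Num.truncn h^-1 < n)%N -> h^-1 <= n%:R.
  move=> hn; apply: (@le_trans _ _ (Num.truncn h^-1).+1%:R); last by rewrite ler_nat.
  by rewrite ltW// real_truncnS_gt ?num_real.
have HY := hY n n0.
pose m1 := Num.truncn (h1 * n%:R); pose m2 := Num.truncn (h2 * n%:R).
have [m10 m1n m1h m1l] := scaled_truncn h10 h11 (inv_le _ nh1) (erefl m1).
have [m20 m2n m2h m2l] := scaled_truncn h20 h21 (inv_le _ nh2) (erefl m2).
have inc1 : small_increments (Y n) b 8^-1 rad m1.
  rewrite -bE; apply: law_small_increments => // j x jm; apply: HN1 => //.
  by apply: le_trans m1h; rewrite ler_nat.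
have inc2 : small_increments (Y n) b a2 rad m2.
  rewrite -bE; apply: law_small_increments => // j x jm; apply: HN2 => //.
  by apply: le_trans m2h; rewrite ler_nat.
have HA k : bounded_past (Y n) rad k [set w | enorm (state (Y n) k w) <= rad].
  by split=> //; exact: past_state_bounded (ltW rad0).
have pA k : pr [set w | enorm (state (Y n) k w) <= rad] <= 1.
  exact: pr_le1 (bounded_past_measurable (HA k)).
have rad0' := ltW rad0; have b0' := ltW b0.
pose B1 := exceeds rad n.
pose B2 := [set w | enorm (state (Y n) 0 w) <= rad] `&` many_moves_event (Y n) b rad L 0 n.
pose B3 := [set w | enorm (state (Y n) 0 w) <= rad] `&` close_moves_event (Y n) b rad m2 L 0 n.
pose B4 := \big[setU/set0]_(i < m2.+1)
  ([set w | enorm (state (Y n) (n - m2) w) <= rad] `&` moves_at (Y n) b rad (n - m2) i).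
have mB1 : measurable B1 by exact: exceeds_measurable.
have mB2 : measurable B2.
  by apply: measurableI; [exact: bounded_past_measurable (HA _)|exact: many_moves_measurable].
have mB3 : measurable B3.
  by apply: measurableI; [exact: bounded_past_measurable (HA _)|exact: close_moves_measurable].
have mM i : measurable ([set w | enorm (state (Y n) (n - m2) w) <= rad] `&`
    moves_at (Y n) b rad (n - m2) i).
  by apply: measurableI; [exact: bounded_past_measurable (HA _)|exact: moves_at_measurable].
have mB4 : measurable B4 by apply: bigsetU_measurable.
have p2 : pr B2 <= eta / 4.
  apply: (le_trans (many_moves_pr L n b0' rad0' m10 inc1 (HA 0%N))).
  rewrite -[leRHS]mulr1; apply: ler_pM; [|exact: pr_ge0| |exact: pA].
    by rewrite divr_ge0// exprn_ge0.
  apply: le_trans qL; rewrite ler_pM2r ?invr_gt0 ?exprn_gt0//.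
  rewrite ler_eXn2l ?ltr1n//; rewrite -ltnS ltn_divLR//.
  rewrite -(ltr_nat R) natrM; apply: (@le_lt_trans _ _ (2 / h1 * m1%:R)).
    rewrite -ler_pdivrMl ?divr_gt0//; apply: le_trans m1l.
    by rewrite invf_div.
  rewrite ltr_pM2r ?ltr0n//; apply: (@lt_le_trans _ _ q%:R); last by rewrite ler_nat.
  by rewrite real_truncnS_gt ?num_real.
have p3 : pr B3 <= eta / 4.
  apply: (le_trans (close_moves_pr L n b0' rad0' (ltW a20) inc2 (HA 0%N))).
  by rewrite a2E -[leRHS]mulr1; apply: ler_wpM2l => //; rewrite divr_ge0// ltW.
have p4 : pr B4 <= eta / 4.
  apply: (@le_trans _ _ (\sum_(i < m2.+1 | (i <= m2)%N)
    pr ([set w | enorm (state (Y n) (n - m2) w) <= rad] `&` moves_at (Y n) b rad (n - m2) i))).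
    rewrite (eq_bigl xpredT) => [|i]; last by rewrite -ltnS ltn_ord.
    rewrite -lee_fin -prE// -sumEFin; apply: le_trans (le_mu_bigsetU P (fun i _ => mM i)) _.
    by apply: lee_sum => i _; rewrite -prE.
  apply: (le_trans (early_moves_le m2.+1 b0' rad0' (ltW a20) inc2 (HA _))).
  apply: (@le_trans _ _ (2 * a2)) => //.
  by rewrite -[leRHS]mulr1; apply: ler_wpM2l => //; rewrite mulr_ge0// ltW.
exists (B1 `|` B2 `|` (B3 `|` B4)); first split.
- by apply: measurableU; apply: measurableU.
- apply: le_trans (pr_leU _ _) _; try by apply: measurableU.
  have u1 := pr_leU mB1 mB2; have u2 := pr_leU mB3 mB4.
  have p1 : pr B1 <= eta / 4 := Hrad n n0.
  move: (pr (B1 `|` B2)) (pr (B3 `|` B4)) u1 u2 => v1 v2.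
  move: (pr B1) (pr B2) (pr B3) (pr B4) p1 p2 p3 p4 => x1 x2 x3 x4.
  by clear; lra.
move=> w nB; pose y i := state (Y n) i w.
have bd i : (i <= n)%N -> enorm (y i) <= rad.
  move=> i_n; rewrite leNgt; apply/negP => h; apply: nB; left; left; by exists i.
have [|||reg close] := @quiet_regular R d b rad m2 y L n b0' m20 m2n bd.
- by move=> h; apply: nB; left; right; split=> //; exact: bd.
- by move=> h; apply: nB; right; left; split=> //; exact: bd.
- have bd' i : (i <= m2)%N -> enorm (y (n - m2 + i)%N) <= rad by move=> im; apply: bd; rewrite -[leqRHS](subnK m2n) leq_add2l.
  have [[i im fi]|//] := first_move_exists b bd'.
  exfalso; apply: nB; right; right; rewrite /B4 -(bigcup_mkord _ (fun i =>
    [set w | enorm (state (Y n) (n - m2) w) <= rad] `&` moves_at (Y n) b rad (n - m2) i)).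
  exists i => //.
  by split=> //; apply: bd; exact: leq_subr.
split; last by apply: le_trans close _; rewrite /b; lra.
rewrite (_ : e = 8 * b); last by rewrite mulrC divfK.
exact: reg.
Qed.
End Tightness.

(** * Means of bounded random variables *)

Section Mean.
Variables (R : realType) (dO : measure_display).
Variables (Omega : measurableType dO) (P : probability Omega R).
Implicit Types (Z : Omega -> R) (M e eta : R).
Local Notation mean Z := (\int[P]_w Z w).

Lemma bounded_rv_integrable Z M : measurable_fun setT Z -> (forall w, `|Z w| <= M) ->
  P.-integrable setT (EFin \o Z).
Proof.
move=> mZ ZM; apply: measurable_bounded_integrable => //.
  by have := probability_le1 P measurableT; move/le_lt_trans; apply; rewrite ltry.
exists M; split; first exact: num_real.
by move=> x Mx w _ /=; apply: le_trans (ZM w) (ltW Mx).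
Qed.

Lemma expectation_mean Z M : measurable_fun setT Z -> (forall w, `|Z w| <= M) ->
  ('E_P[Z] = (mean Z)%:E)%E.
Proof.
move=> mZ ZM; rewrite unlock /Rintegral fineK//.
by apply: integrable_fin_num => //; exact: bounded_rv_integrable ZM.
Qed.

Lemma mean_le_off B Z Z' M eta : measurable_fun setT Z -> (forall w, `|Z w| <= M) ->
  measurable_fun setT Z' -> (forall w, `|Z' w| <= M) -> measurable B -> pr P B <= eta ->
  (forall w, ~ B w -> Z w <= Z' w) -> mean Z <= mean Z' + 2 * M * eta.
Proof.
move=> mZ ZM mZ' Z'M mB Beta ZZ'.
have iZ := bounded_rv_integrable mZ ZM; have iZ' := bounded_rv_integrable mZ' Z'M.
have m1 : measurable_fun setT (\1_B : Omega -> R) by exact: measurable_indic.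
have i1 : P.-integrable setT (EFin \o (\1_B : Omega -> R)).
  by apply: (@bounded_rv_integrable _ 1) => // w; rewrite indicE normr_nat lern1 leq_b1.
have mean1 : mean (\1_B : Omega -> R) = pr P B.
  by rewrite /Rintegral integral_indic// setIT.
have i2 : P.-integrable setT (EFin \o (fun w => 2 * M * \1_B w)).
  apply: eq_integrable (integrableZl measurableT (2 * M) i1) => //.
have M0 : 0 <= M by have := ZM point; apply: le_trans.
apply: (@le_trans _ _ (mean (fun w => Z' w + 2 * M * \1_B w))).
  apply: le_Rintegral => //.
    by apply: eq_integrable (integrableD measurableT iZ' i2).
  move=> w _; have := ZM w; have := Z'M w; rewrite !ler_norml.
  rewrite indicE; have [/set_mem Bw|/negP nB] := boolP (w \in B).
    by rewrite mulr1 => /andP[? ?] /andP[? ?]; lra.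
  move=> _ _; rewrite mulr0 addr0; apply: ZZ' => Bw; apply: nB; exact: mem_set.
rewrite RintegralD// RintegralZl// mean1 lerD2l ler_wpM2l//.
by rewrite mulr_ge0.
Qed.

(** Dominated convergence applied to the minimum of F k and Z, which converges
to Z. *)
Lemma mean_liminf (F : nat -> Omega -> R) Z M e : (forall k, measurable_fun setT (F k)) ->
  (forall k w, `|F k w| <= M) -> measurable_fun setT Z -> (forall w, `|Z w| <= M) ->
  (forall w b, 0 < b -> exists k0, forall k, (k0 <= k)%N -> Z w - b <= F k w) ->
  0 < e -> exists k0, forall k, (k0 <= k)%N -> mean Z - e <= mean (F k).
Proof.
move=> mF FM mZ ZM H e0.
pose m k w := Num.min (F k w) (Z w).
have mm k : measurable_fun setT (m k) by exact: measurable_minr.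
have mM k w : `|m k w| <= M by rewrite /m minEle; case: ifP.
have iM : P.-integrable setT (EFin \o (cst M)).
  by apply: (@bounded_rv_integrable _ `|M|).
have lim w : m ^~ w @ \oo --> Z w.
  apply/cvgrPdist_le => b b0; have [k0 Hk0] := H w b b0.
  exists k0 => // k /Hk0; rewrite /m distrC ler_distl => hk.
  by case: (leP (F k w) (Z w)) => h; apply/andP; split; lra.
have ae1 : {ae P, forall w, setT w -> ((m k w)%:E @[k --> \oo] --> (Z w)%:E)%E}.
  by apply: aeW => w _; apply: cvg_EFin; [exact: nearW|exact: lim].
have ae2 : {ae P, forall w k, setT w -> (`|(m k w)%:E| <= M%:E)%E}.
  by apply: aeW => w k _; rewrite lee_fin.
have mEm k : measurable_fun setT (fun w => (m k w)%:E) by exact/measurable_EFinP.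
have mEZ : measurable_fun setT (fun w => (Z w)%:E) by exact/measurable_EFinP.
have [_ _] := dominated_convergence measurableT mEm mEZ ae1 iM ae2.
have E k : (\int[P]_w (m k w)%:E = (mean (m k))%:E)%E.
  by have := expectation_mean (mm k) (mM k); rewrite unlock.
have EZ : (\int[P]_w (Z w)%:E = (mean Z)%:E)%E.
  by have := expectation_mean mZ ZM; rewrite unlock.
rewrite EZ (funext E) => /fine_cvgP[_] /cvgrPdist_le /(_ e e0)[k0 _ Hk0].
exists k0 => k kk; have := Hk0 k kk; rewrite /= ler_distlC => /andP[h _].
apply: (le_trans h); apply: le_Rintegral => //.
- exact: bounded_rv_integrable (mM k).
- exact: bounded_rv_integrable (FM k).
- by move=> w _; rewrite ge_min lexx.
Qed.
End Mean.

(** * Transfer of convergence in distribution *)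

Section Envelope.
Variables (R : realType) (d : nat).

Lemma test_measurable T (G : skorokhod R d -> R) dd (O : measurableType dd)
    (Q : probability O R) (X : {RV Q >-> skorokhodM R d}) : sk_continuous T G ->
  measurable_fun [set: O] (fun w => G (X w)).
Proof.
move=> GT; apply: (@measurableT_comp _ _ _ _ _ _ (G : skorokhodM R d -> R)).
  exact: sk_continuous_measurable GT.
exact: measurable_funPT.
Qed.

Lemma mean_cvg_lower (T : skorokhod_topology) dd (O : measurableType dd)
    (Q : probability O R) (X : nat -> {RV Q >-> skorokhodM R d}) dd' (O' : measurableType dd')
    (Q' : probability O' R) (X' : {RV Q' >-> skorokhodM R d}) (G : skorokhod R d -> R) :
  sk_bounded G -> sk_continuous T G ->
  ('E_Q[fun w => G (X n w)] @[n --> \oo] --> 'E_Q'[fun w => G (X' w)])%E <->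
  forall e, 0 < e -> exists N, forall n, (N <= n)%N ->
    `|\int[Q']_w G (X' w) - \int[Q]_w G (X n w)| <= e.
Proof.
move=> [M GM] GT.
have E n : ('E_Q[fun w => G (X n w)] = (\int[Q]_w G (X n w))%:E)%E.
  by apply: (@expectation_mean _ _ _ _ _ M) => //; exact: test_measurable GT.
have E' : ('E_Q'[fun w => G (X' w)] = (\int[Q']_w G (X' w))%:E)%E.
  by apply: (@expectation_mean _ _ _ _ _ M) => //; exact: test_measurable GT.
rewrite E' (funext E); split.
  by move=> /fine_cvgP[_] /cvgrPdist_le H e /H[N _ HN]; exists N => n /HN.
move=> H; apply: cvg_EFin; first exact: nearW.
by apply/cvgrPdist_le => e /H[N HN]; exists N.
Qed.

Local Notation sk := (skorokhod R d).
Variables (T T' : skorokhod_topology) (near : R -> sk -> sk -> Prop).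
Hypothesis near_refl : forall f, near 0 f f.
Hypothesis near_sym : forall a f g, near a f g -> near a g f.
Hypothesis near_trans : forall a b f g h, near a f g -> near b g h -> near (a + b) f h.
Hypothesis dist_near : forall f b, 0 < b -> exists2 a, 0 < a &
  forall g, (sk_dist T f g < a%:E)%E -> near b f g.
Implicit Types (f g s t : sk) (G : sk -> R) (S : set (sk * sk)) (M a b c : R).

(** The inf-convolution of G along the pairs (s, t) of S: the value G t counts
at s, and the penalty c * a makes the result Lipschitz for near. Adding M to the
values keeps it bounded, and defined if S is empty. *)
Definition envelope_values G S M c f : set R :=
  M |` [set v | exists s t a, [/\ S (s, t), 0 <= a, near a f s & v = G t + c * a]].

(** The inf-convolution of G along the pairs (s, t) of S: the value G t counts
at s, and the penalty c * a makes the result Lipschitz for near. Adding M to the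
values keeps it bounded, and defined if S is empty. *)
Definition envelope G S M c f : R := inf (envelope_values G S M c f).

Section Bounds.
Variables (G : sk -> R) (S : set (sk * sk)) (M c : R).
Hypotheses (GM : forall f, `|G f| <= M) (c0 : 0 <= c).
Let H := envelope G S M c.

Lemma envelope_values_ge f v : envelope_values G S M c f v -> - M <= v.
Proof.
move=> [->|[s [t [a [_ a0 _ ->]]]]].
  have : 0 <= M by apply: le_trans (GM f).
  lra.
have := GM t; rewrite ler_norml => /andP[h _].
have ca : 0 <= c * a by rewrite mulr_ge0.
by lra.
Qed.

Lemma envelope_has_inf f : has_inf (envelope_values G S M c f).
Proof.
split; first by exists M; left.
by exists (- M) => v; exact: envelope_values_ge.
Qed.

Lemma envelope_le f v : envelope_values G S M c f v -> H f <= v.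
Proof. by apply: ge_inf; case: (envelope_has_inf f). Qed.

Lemma envelope_ge f u : (forall v, envelope_values G S M c f v -> u <= v) -> u <= H f.
Proof. by move=> h; apply: lb_le_inf => //; case: (envelope_has_inf f). Qed.

Lemma envelope_bounded f : `|H f| <= M.
Proof.
rewrite ler_norml; apply/andP; split; first by apply: envelope_ge; exact: envelope_values_ge.
by apply: envelope_le; left.
Qed.

Lemma envelope_near_le b f g : 0 <= b -> near b f g -> H f <= H g + c * b.
Proof.
move=> b0 fg; rewrite -lerBlDr; apply: envelope_ge => v [->|[s [t [a [Sst a0 gs ->]]]]].
  have := envelope_bounded f; rewrite ler_norml => /andP[_ h].
  have cb : 0 <= c * b by rewrite mulr_ge0.
  by lra.
rewrite lerBlDr -addrA -mulrDr; apply: envelope_le; right.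
exists s, t, (a + b); split=> //; first by rewrite addr_ge0.
by rewrite addrC; exact: near_trans gs.
Qed.

Lemma envelope_continuous : sk_continuous T H.
Proof.
move=> f e e0; pose b := e / (2 * (c + 1)).
have c1 : 0 < 2 * (c + 1) by rewrite mulr_gt0// ltr_wpDl.
have b0 : 0 < b by rewrite divr_gt0.
have cb : c * b < e.
  have bE : 2 * (c + 1) * b = e by rewrite mulrC divfK ?gt_eqF.
  move: (b) b0 bE (mulr_ge0 c0 (ltW b0)) => x x0 xE cx0; lra.
have [a a0 Ha] := dist_near f b0; exists a => // g /Ha fg.
have h1 := envelope_near_le (ltW b0) fg.
have h2 := envelope_near_le (ltW b0) (near_sym fg).
apply: le_lt_trans cb; rewrite ler_norml.
by move: (H f) (H g) (c * b) h1 h2 => x y z h1 h2; apply/andP; split; lra.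
Qed.

End Bounds.

Variables (S : nat -> set (sk * sk)) (rho : nat -> R).
Hypothesis rho0 : forall k, 0 < rho k.
Hypothesis S_target : forall f c, 0 < c -> exists k0, forall k, (k0 <= k)%N ->
  forall s t a, S k (s, t) -> near a f s -> a <= rho k -> (sk_dist T' f t < c%:E)%E.

(** With the slope 2 * M / rho k a pair whose source is further than rho k from
f contributes at least M, so that only close pairs matter. *)
Definition lower_test G M k := envelope G (S k) M (2 * M / rho k).

Lemma lower_test_liminf G M f e : (forall f, `|G f| <= M) -> sk_continuous T' G -> 0 < e ->
  exists k0, forall k, (k0 <= k)%N -> G f - e <= lower_test G M k f.
Proof.
move=> GM GT e0; have [c c0 Hc] := GT f e e0.
have M0 : 0 <= M by apply: le_trans (GM f).
have [k0 Hk0] := S_target f c0; exists k0 => k /Hk0 Hk.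
have := GM f; rewrite ler_norml => /andP[_ GfM].
have c20 : 0 <= 2 * M / rho k by rewrite divr_ge0 ?mulr_ge0// ltW.
apply: (envelope_ge GM c20) => v [->|[s [t [a [Sst a0 fs ->]]]]]; first by lra.
have h0 : 0 <= 2 * M / rho k * a by rewrite mulr_ge0.
have [ar|ra] := leP a (rho k).
  have := Hc t (Hk s t a Sst fs ar); rewrite ltr_norml => /andP[_ h].
  by move: h0 h; move: (_ * a) => q; lra.
have := GM t; rewrite ler_norml => /andP[h _].
have : 2 * M <= 2 * M / rho k * a.
  by rewrite mulrAC ler_pdivlMr// ler_wpM2l ?mulr_ge0// ltW.
by move: (_ / _ * _) => q; lra.
Qed.

(** Let X be the limit of F and H k the lower test functions of G. For k large
and then n large, E G (X) is up to a small error at most E (H k (X)), which is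
close to E (H k (F n)), and this is at most E G (F' n) up to the probability of
the exceptional event. Apply this to G and to - G. *)
Lemma envelope_transfer (dO : measure_display) (Omega : measurableType dO)
    (P : probability Omega R) (F F' : nat -> {RV P >-> skorokhodM R d}) :
  (forall k, exists N, forall n, (N <= n)%N ->
    exists2 B : set Omega, measurable B /\ pr P B <= k.+1%:R^-1 &
      forall w, ~ B w -> S k (F n w, F' n w)) ->
  cvg_in_distribution T F -> cvg_in_distribution T' F'.
Proof.
move=> Hbad [dW [W [P1 [X1 HX]]]]; exists dW, W, P1, X1.
have lower G M e : (forall f, `|G f| <= M) -> sk_continuous T' G -> 0 < e ->
    exists N, forall n, (N <= n)%N ->
      \int[P1]_w G (X1 w) - e <= \int[P]_w G (F' n w).
  move=> GM GT e0; have M0 : 0 <= M by apply: le_trans (GM point).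
  pose H k := lower_test G M k.
  have c0 k : 0 <= 2 * M / rho k by rewrite divr_ge0 ?mulr_ge0// ltW.
  have HM k f : `|H k f| <= M := envelope_bounded (S k) GM (c0 k) f.
  have HT k : sk_continuous T (H k) := envelope_continuous (S k) GM (c0 k).
  have e3 : 0 < e / 3 by rewrite divr_gt0.
  have low w b : 0 < b -> exists k0, forall k, (k0 <= k)%N -> G (X1 w) - b <= H k (X1 w).
    by move=> b0; exact: lower_test_liminf GM GT b0.
  have [k0 Hk0] := mean_liminf P1 (fun k => test_measurable X1 (HT k)) (fun k w => HM k (X1 w))
    (test_measurable X1 GT) (fun w => GM (X1 w)) low e3.
  pose k := maxn k0 (Num.truncn ((e / 3)^-1 * (2 * M))).
  have Mk : 2 * M * k.+1%:R^-1 <= e / 3.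
    rewrite ler_pdivrMr ?ltr0n// -ler_pdivrMl//; apply: ltW.
    apply: (@lt_le_trans _ _ (Num.truncn ((e / 3)^-1 * (2 * M))).+1%:R).
      by rewrite real_truncnS_gt ?num_real.
    by rewrite ler_nat ltnS leq_maxr.
  have [N1 HN1] := (mean_cvg_lower F X1 (ex_intro _ M (HM k)) (HT k)).1
    (HX (H k) (ex_intro _ M (HM k)) (HT k)) (e / 3) e3.
  have [N2 HN2] := Hbad k.
  exists (maxn N1 N2) => n; rewrite geq_max => /andP[/HN1 h1 /HN2[B [mB Bk] HB]].
  have h2 := Hk0 k (leq_maxl _ _).
  have h3 : \int[P]_w H k (F n w) <= \int[P]_w G (F' n w) + 2 * M * k.+1%:R^-1.
    apply: (mean_le_off _ _ _ _ mB Bk) => //.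
    - exact: test_measurable (HT k).
    - exact: test_measurable GT.
    move=> w /HB Sw; apply: (envelope_le GM (c0 k)); right.
    by exists (F n w), (F' n w), 0; split=> //; rewrite mulr0 addr0.
  move: h1; rewrite ler_norml => /andP[_ h1].
  move: (\int[P1]_w H k (X1 w)) (\int[P1]_w G (X1 w)) (\int[P]_w H k (F n w))
    (\int[P]_w G (F' n w)) (2 * M * _) h1 h2 h3 Mk => x y z u v h1 h2 h3 Mk.
  by lra.
move=> G Gb GT; apply/(mean_cvg_lower F' X1 Gb GT) => e e0.
have [M GM] := Gb.
have GN : sk_continuous T' (fun f => - G f).
  move=> f b b0; have [a a0 Ha] := GT f b b0; exists a => // g /Ha.
  by rewrite -opprD normrN.
have GNM f : `|- G f| <= M by rewrite normrN.
have [N1 H1] := lower G M e GM GT e0.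
have [N2 H2] := lower _ M e GNM GN e0.
exists (maxn N1 N2) => n; rewrite geq_max => /andP[/H1 h1 /H2].
have N dd (O : measurableType dd) (Q : probability O R) (X : {RV Q >-> skorokhodM R d}) :
    \int[Q]_w (- G (X w)) = - \int[Q]_w G (X w).
  have iG : Q.-integrable setT (EFin \o (fun w => G (X w))).
    by apply: (@bounded_rv_integrable _ _ _ _ _ M) => //; exact: test_measurable GT.
  rewrite -mulN1r -RintegralZl//; apply: eq_Rintegral => w _.
  by rewrite mulN1r.
rewrite !N => h2; rewrite ler_norml; apply/andP; split; lra.
Qed.
End Envelope.

(** * Pairs of embeddings of one sequence *)

Section Transfer.
Variables (R : realType) (d : nat).
Implicit Types (f g x : skorokhod R d) (a b e : R) (y : nat -> 'rV[R]_d).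

Lemma J1near_refl f : J1near 0 f f.
Proof.
exists id, id; split; first by split.
by move=> t _; rewrite !subrr !normr0.
Qed.

Lemma distJ1_J1near f b : 0 < b -> exists2 a, 0 < a &
  forall g, (sk_dist J1 f g < a%:E)%E -> J1near b f g.
Proof.
move=> b0; exists (Num.min b 1); first by rewrite lt_min b0 ltr01.
move=> g /dist_J1near fg; apply: (@J1near_le _ _ (Num.min b 1)); first by rewrite ge_min lexx.
by apply: fg; rewrite ge_min lexx orbT.
Qed.

Lemma regular_sequence_le e e' a n y : e <= e' ->
  regular_sequence e a n y -> regular_sequence e' a n y.
Proof.
move=> ee' [Q [Q1 Q2 Q3 Q4 H]]; exists Q; split=> // i j ij jn HQ.
by apply: le_trans ee'; exact: H.
Qed.

Lemma harmonic_eventually_le b : 0 < b -> exists k0, forall k, (k0 <= k)%N -> k.+1%:R^-1 <= b.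
Proof.
move=> b0; exists (Num.truncn b^-1) => k kk.
rewrite -[leRHS]invrK lef_pV2 ?posrE ?invr_gt0 ?ltr0n//.
apply: (@le_trans _ _ (Num.truncn b^-1).+1%:R); last by rewrite ler_nat.
by rewrite ltW// real_truncnS_gt ?num_real.
Qed.

Definition slow_pairs T k : set (skorokhod R d * skorokhod R d) :=
  [set p | exists n y, [/\ (0 < n)%N, n%:R^-1 <= k.+1%:R^-1 :> R, `|y n - y n.-1| <= k.+1%:R^-1,
     is_embedding J1 n y p.1 & is_embedding T n y p.2]].

Lemma slow_pairs_target T f e : 0 < e -> exists k0, forall k, (k0 <= k)%N ->
  forall g x a, slow_pairs T k (g, x) -> J1near a f g -> a <= k.+1%:R^-1 ->
  (sk_dist T f x < e%:E)%E.
Proof.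
move=> e0; have c0 : 0 < d.+1%:R * 4 :> R by rewrite mulr_gt0.
have b0 : 0 < e / 2 / (d.+1%:R * 4) by rewrite !divr_gt0.
have [k0 Hk0] := harmonic_eventually_le b0; exists k0 => k /Hk0 hk g x a.
move=> [n [y [n0 nk yk Hg Hx]]] fg ak.
apply: le_lt_trans (sk_dist_embedding_le n0 nk yk (J1near_le ak fg) Hg Hx) _.
rewrite lte_fin mulrA; move: hk; rewrite ler_pdivlMr// mulrC => hk.
by apply: (le_lt_trans hk); lra.
Qed.

Definition regular_pairs (gap : nat -> R) k : set (skorokhod R d * skorokhod R d) :=
  [set p | exists n y, [/\ (0 < n)%N, n%:R^-1 <= gap k / 32,
     regular_sequence k.+1%:R^-1 (gap k) n y, is_embedding M2 n y p.1 &
     is_embedding J1 n y p.2]].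

Definition tolerance (gap : nat -> R) k : R := Num.min k.+1%:R^-1 (gap k / 64).

(** A pair at index k allows an oscillation and a gap that are smaller than
those of a fixed partition of f, so that regular_weaknear_J1near applies with
the partition of f. *)
Lemma regular_pairs_target gap f e : (forall k, 0 < gap k <= k.+1%:R^-1) -> 0 < e ->
  exists k0, forall k, (k0 <= k)%N ->
  forall x g a, regular_pairs gap k (x, g) -> weaknear a f x -> a <= tolerance gap k ->
  (sk_dist J1 f g < e%:E)%E.
Proof.
move=> Hgap e0; have c0 : 0 < d.+1%:R :> R by rewrite ltr0n.
pose b := e / 2 / d.+1%:R; have b0 : 0 < b by rewrite !divr_gt0.
have b10 : 0 < b / 10 by rewrite divr_gt0.
have [w [S [w0 PS HS]]] := rcll_partition f b10.
have m0 : 0 < Num.min (b / 10) w by rewrite lt_min b10.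
have [k0 Hk0] := harmonic_eventually_le m0; exists k0 => k /Hk0.
rewrite le_min => /andP[kb kw] x g a [n [y [n0 nk reg Hx Hg]]] fx.
have /andP[g0 gk] := Hgap k.
rewrite /tolerance le_min => /andP[ak ag].
have fg : J1near (Num.max (10 * (b / 10)) (gap k / 8)) f g.
  apply: (regular_weaknear_J1near b10 g0 _ _ n0 nk _ Hg Hx _ HS fx).
  - exact: le_trans kb.
  - by apply: (le_lt_trans ag); lra.
  - exact: regular_sequence_le reg.
  - by apply: separated_partition_le PS; exact: le_trans kw.
apply: (le_lt_trans (J1near_dist fg)); rewrite lte_fin.
have h : Num.max (10 * (b / 10)) (gap k / 8) <= b.
  move: (b) (gap k) b0 g0 (le_trans gk kb) => z u z0 u0 uz.
  by rewrite ge_max; apply/andP; split; lra.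
apply: (@le_lt_trans _ _ (d.+1%:R * b)); first by rewrite ler_wpM2l// ltW.
by rewrite /b mulrC divfK ?gt_eqF//; lra.
Qed.

End Transfer.

Theorem corollary4p1 (R : realType) (d : nat) (T : skorokhod_topology)
    (dO : measure_display) (Omega : measurableType dO)
    (P : probability Omega R)
    (K : nat -> R.-pker borelRV R d ~> borelRV R d)
    (Y : nat -> nat -> {RV P >-> borelRV R d})
    (XJ1 XT : nat -> {RV P >-> skorokhodM R d})
    (hd : (0 < d)%N)
    (hY : forall n : nat, (0 < n)%N -> markov_chain (K n) (Y n))
    (hXJ1 : forall n : nat, (0 < n)%N -> forall w : Omega,
      is_embedding J1 n (fun k => Y n k w) (XJ1 n w))
    (hXT : forall n : nat, (0 < n)%N -> forall w : Omega,
      is_embedding T n (fun k => Y n k w) (XT n w))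
    (hi : small_time_condition K)
    (hii : compact_containment_condition Y) :
  cvg_in_distribution T XT <-> cvg_in_distribution J1 XJ1.
Proof.
have k0 k : 0 < k.+1%:R^-1 :> R by rewrite invr_gt0 ltr0n.
have large (b : R) : 0 < b -> exists N, forall n, (N <= n)%N -> (0 < n)%N /\ n%:R^-1 <= b.
  move=> b0; have [N HN] := harmonic_eventually_le b0; exists N.+1 => -[|n] // Nn.
  by split=> //; exact: HN.
have tight k := tightness hY hi hii (k0 k) (k0 k) (k0 k).
split.
  (* the gap granted by tightness for the level and the probability 1 / (k + 1)
  *)
  pose gap k := projT1 (cid2 (tight k)).
  have Hgap k : 0 < gap k <= k.+1%:R^-1 by rewrite /gap; case: cid2.
  apply: (@envelope_transfer R d T J1 (@weaknear R d) _ _ _ _ (regular_pairs gap) (tolerance gap)).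
  - by move=> f; exact: weaknear_refl.
  - exact: weaknear_sym.
  - exact: weaknear_trans.
  - by move=> f b; exact: sk_dist_weaknear.
  - by move=> k; have /andP[g0 _] := Hgap k; rewrite lt_min k0 divr_gt0.
  - by move=> f c c0; exact: regular_pairs_target.
  move=> k; have [N HN] : exists N, forall n, (N <= n)%N ->
    exists2 B : set Omega, measurable B /\ pr P B <= k.+1%:R^-1 & forall w, ~ B w ->
    regular_sequence k.+1%:R^-1 (gap k) n (fun i => state (Y n) i w) /\
    `|state (Y n) n w - state (Y n) n.-1 w| <= k.+1%:R^-1.
    by rewrite /gap; case: cid2.
  have [|N' HN'] := large (gap k / 32).
    by have /andP[g0 _] := Hgap k; rewrite divr_gt0.
  exists (maxn N N') => n; rewrite geq_max => /andP[/HN[B mB HB] /HN'[n0 ng]].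
  exists B => // w /HB[reg _]; exists n, (fun i => Y n i w); split=> //.
  - exact: embedding_M2 (hXT n n0 w).
  - exact: hXJ1.
apply: (@envelope_transfer R d J1 T (@J1near R d) _ _ _ _ (slow_pairs T) (fun k => k.+1%:R^-1)) => //.
- exact: J1near_refl.
- exact: J1near_sym.
- exact: J1near_trans.
- exact: distJ1_J1near.
- by move=> f c c0; exact: slow_pairs_target.
move=> k; have [a _ [N HN]] := tight k.
have [N' HN'] := large _ (k0 k).
exists (maxn N N') => n; rewrite geq_max => /andP[/HN[B mB HB] /HN'[n0 nk]].
exists B => // w /HB[_ slow]; exists n, (fun i => Y n i w); split=> //.
- exact: hXJ1.
- exact: hXT.
Qed.
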